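(* Let $0<|q|<1$, let $m\ge n\ge1$ be integers, and let $\alpha_1,\dots,\alpha_m\in\mathbb{C}^*$ be pairwise distinct with $\alpha_i\notin\alpha_jq^{\mathbb{Z}\setminus\{0\}}$ for all $i,j$. Then the $K(\mathbb{P}^{n-1})$-valued $q$-series on the left-hand side below has the following analytic continuation: $$P^{\ell_q(Q)}\sum_{d=0}^{\infty}\frac{\prod_{i=1}^m(P\alpha_i;q)_d}{(Pq;q)_d^n}Q^d = P^{\ell_q(Q)}\frac{\prod_{i=1}^m(P\alpha_i;q)_\infty}{(Pq;q)_\infty^n}\sum_{j=1}^m\frac{(q,q,P\alpha_jQ,q/(P\alpha_jQ);q)_\infty}{(P\alpha_j,q/(P\alpha_j),Q,q/Q;q)_\infty}\cdot\frac{(\alpha_j^{-1}q;q)_\infty^n\; e_{q,\alpha_j}^{-1}(1/Q)}{\prod_{i=1,i\ne j}^m(\alpha_i/\alpha_j;q)_\infty\,(q;q)_\infty}\,W_j(1/Q)$$ for $|Q|<1$ and $|\arg(-Q)|<\pi-\delta$, $0<\delta<\pi$, where $$W_j(1/Q)=e_{q,\alpha_j}(1/Q)\sum_{d\ge0}\frac{\prod_{k=0}^{d-1}\big(1-\alpha_j^{-1}q^{-k}\big)^n}{\prod_{i=1}^m\prod_{k=1}^d\big(1-(\alpha_i/\alpha_j)q^{-k}\big)}Q^{-d}.$$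
   Context: Notation: $(a;q)_d=\prod_{k=0}^{d-1}(1-aq^k)$ for $d\in\mathbb{N}\cup\{\infty\}$, and $(a_1,\dots,a_r;q)_d=\prod_i(a_i;q)_d$. $q^{\mathbb{Z}\setminus\{0\}}=\{q^k:k\in\mathbb{Z},k\ne0\}$. $P=\mathcal{O}(-1)$ in $K(\mathbb{P}^{n-1})$, where $(1-P)^n=0$; expressions in $P$ are understood through their expansion in powers of $1-P$ modulo $(1-P)^n$. $\theta_q(Q)=\sum_{d\in\mathbb{Z}}q^{d(d-1)/2}Q^d$; $\ell_q(Q)=-Q\theta_q'(Q)/\theta_q(Q)$; $P^{\ell_q(Q)}=\sum_{a\ge0}(-1)^a\binom{\ell_q(Q)}{a}(1-P)^a$ with $\binom{\ell}{a}=\frac1{a!}\prod_{r=0}^{a-1}(\ell-r)$; $e_{q,\lambda}(Q)=\theta_q(Q)/\theta_q(\lambda Q)$ for $\lambda\in\mathbb{C}^*$, and $e^{-1}_{q,\lambda}=1/e_{q,\lambda}$. The functions $W_j(1/Q)$, $j=1,\dots,m$, are solutions at $Q=\infty$ (understood by analytic continuation in $Q$ where their defining series does not converge) of the $q$-difference equation $\big[(1-q^{Q\partial_Q})^n-Q\prod_{i=1}^m(1-\alpha_iq^{Q\partial_Q})\big]F(Q)=0$, where $q^{Q\partial_Q}:f(Q)\mapsto f(qQ)$; the left-hand series satisfies the same equation modulo $(1-P)^n$.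
   Formalization: The display divides by a nilpotent if some α_j is a power of q; it is proved when no α_j is in q^ℤ, and with (Pα_j;q)_∞ cancelled when α_j = q^{-k}, k≥0; nothing is claimed if α_j = q^k, k≥1. Q where a displayed denominator vanishes or W_j is undefined are excluded. *)

(* Defs.v *)
From HB Require Import structures.
From mathcomp Require Import all_boot all_order all_algebra qpoly complex.
From mathcomp Require Import all_classical all_reals all_analysis.

Set Implicit Arguments.
Unset Strict Implicit.
Unset Printing Implicit Defensive.

Import Order.TTheory GRing.Theory Num.Theory.
Import numFieldNormedType.Exports.

Local Open Scope classical_set_scope.
Local Open Scope ring_scope.

(* [C] is [R[i]]; the alias [C^o] is the one that carries the topology and the
   normed module structure induced by the complex modulus. *)

Section ComplexFunctions.
Context {R : realType}.
Local Notation C := R[i].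

Definition climn (u : nat -> C) : C := limn (u : nat -> C^o).

Definition csum (u : nat -> C) : C := climn (series u).

(* sum over all d in Z, as the sum over d >= 0 plus the sum over d < 0 *)
Definition zsum (u : int -> C) : C :=
  csum (fun d => u d%:Z) + csum (fun d => u (- d.+1%:Z)).

(* principal value in ]-pi, pi]; only meaningful for z != 0 *)
Definition carg (z : C) : R :=
  let t := acos (complex.Re z / complex.Re `|z|) in
  if 0 <= complex.Im z then t else - t.

Definition qpoch (A : comNzRingType) (a q : A) (d : nat) : A :=
  \prod_(k < d) (1 - a * q ^+ k).

Definition qpoch_inf (a q : C) : C := climn (qpoch a q).

(* d(d-1) is even, so the integer division by 2 is exact *)
Definition theta (q Q : C) : C :=
  zsum (fun d : int => q ^ ((d * (d - 1)) %/ 2)%Z * Q ^ d).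

Definition ell (q Q : C) : C :=
  - Q * derive1 (theta q : C^o -> C^o) Q / theta q Q.

Definition echar (q lambda Q : C) : C := theta q Q / theta q (lambda * Q).

Definition gbinom (l : C) (a : nat) : C :=
  (a`!%:R)^-1 * \prod_(r < a) (l - r%:R).

End ComplexFunctions.

(* K(P^{n-1}) with complex coefficients, as C[X]/(X^n) for n >= 1, where X is
   the class of 1 - P.  (qpoly replaces the modulus by X if n = 0.) *)
Section KProj.
Context {R : realType}.
Local Notation C := R[i].

Definition KP (n : nat) := {poly %/ ('X^n : {poly C})}.

Definition Pcl (n : nat) : KP n := in_qpoly 'X^n (1 - 'X).

(* coordinatewise limit in the basis 1, 1 - P, ..., (1 - P)^(n-1) *)
Definition Klim (n : nat) (u : nat -> KP n) : KP n :=
  in_qpoly 'X^n (\poly_(a < n) climn (fun N => (u N : {poly C})`_a)).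

Definition Kqpoch (n : nat) (a : KP n) (q : C) (d : nat) : KP n :=
  qpoch a q%:A d.

Definition Kqpoch_inf (n : nat) (a : KP n) (q : C) : KP n :=
  Klim (Kqpoch a q).

Definition Kqpochs_inf (n : nat) (s : seq (KP n)) (q : C) : KP n :=
  \prod_(a <- s) Kqpoch_inf a q.

(* P^l; the terms of the binomial series with a >= n vanish in K(P^{n-1}) *)
Definition Ppow (n : nat) (l : C) : KP n :=
  \sum_(a < n) ((-1) ^+ a * gbinom l a) *: (1 - Pcl n) ^+ a.

End KProj.

Section Connection.
Context {R : realType}.
Local Notation C := R[i].
Variables (q : C) (m n : nat) (alpha : 'I_m -> C).
Local Notation P := (Pcl n : KP n).

Definition lhs_series (Q : C) : KP n :=
  Klim (series (fun d =>
    (Q ^+ d) *: ((\prod_(i < m) Kqpoch (P * (alpha i)%:A) q d)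
                 / Kqpoch (P * q%:A) q d ^+ n))).

(* coefficient of Q^{-d} in the series defining W_j(1/Q), without the prefactor *)
Definition Wcoef (j : 'I_m) (d : nat) : C :=
  (\prod_(0 <= k < d) (1 - (alpha j)^-1 * q ^- k) ^+ n)
  / \prod_(i < m) \prod_(1 <= k < d.+1) (1 - (alpha i / alpha j) * q ^- k).

(* Domain, in the variable z = 1/Q, of the continued series.  For n < m the
   series is entire.  For m = n the top-order coefficient of the q-difference
   equation, (-1)^n (1 - Q \prod_i alpha_i), vanishes at Q = 1/\prod_i alpha_i,
   so continuation from z = 0 meets possible poles exactly at
   1/z = q^(n+k) / \prod_i alpha_i, k >= 0.  The complement of this closed
   discrete set is connected, so the continuation is unique. *)
Definition Wdom : set C :=
  [set z | m = n -> forall k : nat,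
             z <> (\prod_(i < m) alpha i) * q ^- (n + k)].

Definition power_series_continuation (D : set C) (c : nat -> C) (S : C -> C) :=
  (forall z, D z -> derivable (S : C^o -> C^o) z 1) /\
  (\forall z \near (0 : C^o),
     (series (fun d => c d * z ^+ d) : nat -> C^o) @ \oo --> (S z : C^o)).

(* W_j as a function of z = 1/Q, where S_j is the continued series *)
Definition Wfun (S : 'I_m -> C -> C) (j : 'I_m) (z : C) : C :=
  echar q (alpha j) z * S j z.

(* the points Q at which no scalar denominator vanishes and W_j is defined *)
Definition regular_point (Q : C) : Prop :=
  [/\ theta q Q != 0 /\ theta q (1 / Q) != 0,
      forall j, theta q (alpha j * (1 / Q)) != 0,
      qpoch_inf Q q != 0, qpoch_inf (q / Q) q != 0 & Wdom (1 / Q)].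

Definition scalar_coef (j : 'I_m) (Q : C) : C :=
  qpoch_inf ((alpha j)^-1 * q) q ^+ n * (echar q (alpha j) (1 / Q))^-1
  / ((\prod_(i < m | i != j) qpoch_inf (alpha i / alpha j) q) * qpoch_inf q q).

Definition connection_rhs (S : 'I_m -> C -> C) (Q : C) : KP n :=
  (\prod_(i < m) Kqpoch_inf (P * (alpha i)%:A) q)
    / Kqpoch_inf (P * q%:A) q ^+ n
  * \sum_(j < m)
      Kqpochs_inf [:: q%:A; q%:A; P * (alpha j)%:A * Q%:A;
                      q%:A / (P * (alpha j)%:A * Q%:A)] q
      / Kqpochs_inf [:: P * (alpha j)%:A; q%:A / (P * (alpha j)%:A);
                        Q%:A; q%:A / Q%:A] q
      * (scalar_coef j Q)%:A * (Wfun S j (1 / Q))%:A.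

(* The same expression after cancelling, in the j-th summand, the factor
   (P alpha_j; q)_oo between numerator and denominator.  It is needed when
   alpha_j = q^(-k), k >= 0: this factor is then divisible by 1 - P, hence not
   invertible in K(P^{n-1}), and only the cancelled quotient has an expansion. *)
Definition connection_rhs_cancelled (S : 'I_m -> C -> C) (Q : C) : KP n :=
  (Kqpoch_inf (P * q%:A) q ^+ n)^-1
  * \sum_(j < m)
      (\prod_(i < m | i != j) Kqpoch_inf (P * (alpha i)%:A) q)
      * Kqpochs_inf [:: q%:A; q%:A; P * (alpha j)%:A * Q%:A;
                        q%:A / (P * (alpha j)%:A * Q%:A)] q
      / Kqpochs_inf [:: q%:A / (P * (alpha j)%:A); Q%:A; q%:A / Q%:A] q
      * (scalar_coef j Q)%:A * (Wfun S j (1 / Q))%:A.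

End Connection.

(* Main.v *)
Require Import Defs.
From HB Require Import structures.
From mathcomp Require Import all_boot all_order all_algebra qpoly complex.
From mathcomp Require Import finmap.
From mathcomp Require Import all_classical all_reals all_analysis.
From mathcomp Require Import ring lra zify.
Import Order.TTheory GRing.Theory Num.Theory.
Import numFieldNormedType.Exports.
Set Implicit Arguments.
Unset Strict Implicit.
Unset Printing Implicit Defensive.
Local Open Scope classical_set_scope.
Local Open Scope fset_scope.
Local Open Scope ring_scope.
Import Normc.

(** Why the formula holds.  Write x_j = P alpha_j, (a)_d = (a;q)_d and
   a_d = prod_i (x_i)_d / (Pq)_d^n, so that the left-hand series is
   L = sum_(d >= 0) a_d Q^d.  Everything is an identity between Laurent
   coefficients after multiplication by the theta series
   theta(Q) = sum_l (-1)^l q^(l(l-1)/2) Q^l = (q)_oo (Q)_oo (q/Q)_oo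
   ([jacobi_triple_product]); partial fractions and dominated convergence play
   the role of a contour integral and of its residues.

   The numbers a_d (Pq)_oo^n extend to all integers d, by 0 for d < 0, because
   the factor (1 - P)^n of (P q^(d+1))_oo^n vanishes there.  Truncating that
   product to M factors gives a function of y = q^d which is a polynomial in y
   of small degree over a product of linear factors, and Lagrange
   interpolation at the points 1/(alpha_j q^k), k <= M, writes it as a
   combination of the functions (x_j)_oo / (1 - x_j q^(d+k))
   ([trunc_coef_fractions]).  The coefficient attached to (j, k) is the k-th
   coefficient w_jk of W_j times a quantity which tends to the scalar
   coefficient of the j-th summand of the formula as M grows
   ([residue_coefE], [residue_limit]).

   Each simple fraction can be summed against the theta coefficients
   ([theta_kernel]); the result is x_j^(N+k) times the theta coefficient of
   index N+k times a constant.  Letting M tend to infinity, the N-th Laurent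
   coefficient of theta(Q) (Pq)_oo^n L is a combination over j of
   sum_k w_jk (-1)^(N+k) q^((N+k)(N+k-1)/2) x_j^(N+k)
   ([connection_coefficient]), which formally is the N-th coefficient of
   theta(x_j Q) sum_k w_jk Q^(-k).

   If n < m the w_jk decay faster than geometrically and this is the theorem.
   If m = n the series of W_j has a finite radius of convergence.  Then both
   sides are multiplied by (rho/Q)_oo with rho = q^n / prod_i alpha_i.  The
   product T_j(z) of (rho z)_oo and the series of W_j is entire
   ([twist_coef_entire]): w_jk rho^(-k) has an expansion in powers of q^k to
   every order, and convolving the coefficients of (z)_oo with q^(-ik) gives
   tails of (q^(-i))_oo = 0.  Hence S_j(z) = T_j(z) / (rho z)_oo is the analytic
   continuation of the series, with poles exactly at the points excluded from
   Wdom, and all rearrangements are absolutely convergent for 0 < |Q| < 1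
   ([global_identity]).

   K(P^(n-1)) and C are treated together as complete normed algebras in which
   every element is a complex number plus a nilpotent ([localAlg]). *)

(** * Unordered sums in a complete normed ring *)

(** Convergence along the directed set of finite subsets of the index set.  It
   is insensitive to the order of the terms, so that the many changes of
   variables below are plain bijections of index types. *)
Definition has_sum (R : realType) (V : zmodType) (N : V -> R) (I : choiceType)
    (u : I -> V) (s : V) : Prop :=
  forall e : R, 0 < e -> exists F0 : {fset I},
    forall F : {fset I}, F0 `<=` F -> N (s - \sum_(i <- F) u i) <= e.

(** Summability of a nonnegative family. *)
Definition bounded_sums (R : realType) (I : choiceType) (b : I -> R) : Prop :=
  exists B, forall F : {fset I}, \sum_(i <- F) b i <= B.

Definition tends (R : realType) (V : zmodType) (N : V -> R) (T : Type)
    (G : set_system T) (u : T -> V) (s : V) : Prop :=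
  forall e : R, 0 < e -> \forall t \near G, N (u t - s) <= e.

(** Completeness is asked in the form in which it is used: absolutely summable
   families, over any index type, have a sum. *)
Record ringNorm (R : realType) (V : comNzRingType) := RingNorm {
  rn :> V -> R;
  rn_eq0 : forall x, rn x = 0 -> x = 0;
  rn0 : rn 0 = 0;
  rnN : forall x, rn (- x) = rn x;
  rnD : forall x y, rn (x + y) <= rn x + rn y;
  rnM : forall x y, rn (x * y) <= rn x * rn y;
  rn_complete : forall (I : choiceType) (u : I -> V),
    bounded_sums (fun i => rn (u i)) -> exists s, has_sum rn u s
}.

Section Sums.
Variables (R : realType) (V : comNzRingType) (N : ringNorm R V).

Lemma rn_ge0 x : 0 <= N x.
Proof. by have := rnD N x (- x); rewrite subrr rn0 rnN; lra. Qed.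

Lemma rn_dist x y : N (x - y) = N (y - x).
Proof. by rewrite -rnN opprB. Qed.

Lemma rn_tri x y z : N (x - z) <= N (x - y) + N (y - z).
Proof. by have := rnD N (x - y) (y - z); rewrite addrA subrK. Qed.

Lemma rn_sum (I : Type) (r : seq I) (P : pred I) (u : I -> V) :
  N (\sum_(i <- r | P i) u i) <= \sum_(i <- r | P i) N (u i).
Proof.
elim/big_rec2: _ => [|i y x _ h]; first by rewrite rn0.
by apply: le_trans (rnD _ _ _) _; rewrite lerD2l.
Qed.

Lemma rnX x k : N 1 <= 1 -> N (x ^+ k) <= N x ^+ k.
Proof.
move=> h1; elim: k => [|k IH]; rewrite ?expr0 // !exprS.
by apply: le_trans (rnM _ _ _) _; apply: ler_wpM2l IH; apply: rn_ge0.
Qed.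

Lemma rn_small x : (forall e, 0 < e -> N x <= e) -> x = 0.
Proof.
move=> h; apply: (@rn_eq0 _ _ N); apply/eqP; rewrite eq_le rn_ge0 andbT.
by apply/ler_addgt0Pr => e e0; rewrite add0r; apply: h.
Qed.

Section OneIndex.
Variable I : choiceType.
Implicit Types (u v : I -> V) (s t : V).

Lemma has_sum_uniq u s t : has_sum N u s -> has_sum N u t -> s = t.
Proof.
move=> hs ht; apply/eqP; rewrite -subr_eq0; apply/eqP/rn_small => e e0.
have e2 : 0 < e / 2 by lra.
have [F0 h0] := hs _ e2; have [F1 h1] := ht _ e2.
have := h0 (F0 `|` F1) (fsubsetUl _ _); have := h1 (F0 `|` F1) (fsubsetUr _ _).
have := rn_tri s (\sum_(i <- F0 `|` F1) u i) t.
by rewrite [X in _ <= _ + X -> _]rn_dist; lra.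
Qed.

Lemma eq_has_sum u v s : u =1 v -> has_sum N u s -> has_sum N v s.
Proof.
move=> uv hs e /hs [F0 h]; exists F0 => F /h.
by rewrite (eq_bigr v).
Qed.

Lemma has_sumD u v s t :
  has_sum N u s -> has_sum N v t -> has_sum N (fun i => u i + v i) (s + t).
Proof.
move=> hs ht e e0; have e2 : 0 < e / 2 by lra.
have [F0 h0] := hs _ e2; have [F1 h1] := ht _ e2.
exists (F0 `|` F1) => F hF.
have := h0 F (fsubset_trans (fsubsetUl _ _) hF).
have := h1 F (fsubset_trans (fsubsetUr _ _) hF).
rewrite big_split /= opprD addrACA.
have := rnD N (s - \sum_(i <- F) u i) (t - \sum_(i <- F) v i); lra.
Qed.

Lemma has_sumZ c u s : has_sum N u s -> has_sum N (fun i => c * u i) (c * s).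
Proof.
move=> hs e e0.
have c1 : 0 < N c + 1 by have := rn_ge0 c; lra.
have [|F0 h] := hs (e / (N c + 1)); first by rewrite divr_gt0.
exists F0 => F /h hF.
rewrite -mulr_sumr -mulrBr; apply: le_trans (rnM _ _ _) _.
apply: le_trans (_ : (N c + 1) * (e / (N c + 1)) <= _).
  by apply: ler_pM => //; rewrite ?rn_ge0 //; lra.
by rewrite mulrCA divff ?mulr1 // gt_eqF.
Qed.

Lemma has_sum0 : has_sum N (fun _ : I => 0) 0.
Proof.
move=> e e0; exists fset0 => F _.
by rewrite big1 // subrr rn0 ltW.
Qed.

Lemma has_sum_bigop (J : Type) (r : seq J) (u : J -> I -> V) (s : J -> V) :
  (forall j, has_sum N (u j) (s j)) ->
  has_sum N (fun i => \sum_(j <- r) u j i) (\sum_(j <- r) s j).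
Proof.
move=> h; elim: r => [|j r IH].
  by rewrite big_nil; apply: eq_has_sum has_sum0 => i; rewrite big_nil.
rewrite big_cons; apply: eq_has_sum (has_sumD (h j) IH) => i.
by rewrite big_cons.
Qed.

Lemma has_sum_norm u s B :
  has_sum N u s -> (forall F : {fset I}, \sum_(i <- F) N (u i) <= B) -> N s <= B.
Proof.
move=> hs hB; apply/ler_addgt0Pr => e /hs [F0 /(_ F0 (fsubset_refl _)) h].
have := rnD N (s - \sum_(i <- F0) u i) (\sum_(i <- F0) u i).
rewrite subrK => h2; have := rn_sum F0 predT u; have := hB F0; lra.
Qed.

End OneIndex.


Lemma fpreimage_inj (I K : choiceType) (f : K -> I) (F : {fset I}) :
  injective f -> exists G : {fset K}, forall k, (k \in G) = (f k \in F).
Proof.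
move=> finj; have fin : finite_set (f @^-1` [set` F]).
  by apply: finite_preimage => [x y _ _ /finj //|]; exact: finite_fset.
by exists (fset_set (f @^-1` [set` F])) => k; rewrite in_fset_set // mem_setE.
Qed.

(** Sums may be computed on the image of an injection that meets the
   support. *)
Lemma has_sum_inj (I K : choiceType) (f : K -> I) (u : I -> V) s :
  injective f -> (forall i, (forall k, i != f k) -> u i = 0) ->
  has_sum N (u \o f) s <-> has_sum N u s.
Proof.
move=> finj h0.
have key (F : {fset I}) (G : {fset K}) : (forall k, (k \in G) = (f k \in F)) ->
    \sum_(i <- F) u i = \sum_(k <- G) u (f k).
  move=> hG; have <- : \sum_(i <- [fset f k | k in G]) u i = \sum_(k <- G) u (f k).
    by rewrite big_imfset //= => ? ? _ _ /finj.
  apply/esym/big_fset_incl => [|i iF inG].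
    by apply/fsubsetP => i /imfsetP [k /= kG ->]; rewrite -hG.
  apply: h0 => k; apply: contraNneq inG => ik; rewrite ik.
  by apply: in_imfset; rewrite hG -ik.
split=> hs e /hs [F0 h].
  exists [fset f k | k in F0] => F hF.
  have [G hG] := fpreimage_inj F finj.
  rewrite (key F G hG); apply: h; apply/fsubsetP => k kF0.
  by rewrite hG; apply: (fsubsetP hF); apply: in_imfset.
have [G0 hG0] := fpreimage_inj F0 finj.
exists G0 => G hG.
pose F := F0 `|` [fset f k | k in G].
suff <- : \sum_(i <- F) u i = \sum_(k <- G) u (f k) by apply: h; apply: fsubsetUl.
apply: key => k; rewrite in_fsetU -hG0.
apply/idP/orP => [kG|[kG|/imfsetP [k' /= k'G /finj ->] //]].
  by right; apply: in_imfset.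
exact: (fsubsetP hG).
Qed.

Lemma has_sum_reindex (I K : choiceType) (f : K -> I) (u : I -> V) s :
  bijective f -> has_sum N u s -> has_sum N (fun k => u (f k)) s.
Proof.
move=> [g fK gK] hs; apply/(has_sum_inj (f := f)) => //; first exact: can_inj fK.
by move=> i /(_ (g i)); rewrite gK eqxx.
Qed.

(** Summation by packets, here the fibres of p.  Given a finite set G of
   indices j, one finite set F is good for s and, up to e/(2(|G|+1)), for all
   the fibres over G; the part of F that lies over G then compares the two
   sums. *)
Lemma has_sum_fiber (I J : choiceType) (p : I -> J) (u : I -> V) (g : J -> V) s :
  has_sum N u s ->
  (forall j, has_sum N (fun i => if p i == j then u i else 0) (g j)) ->
  has_sum N g s.
Proof.
move=> hs hg e e0; have e2 : 0 < e / 2 by lra.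
have [F0 h0] := hs _ e2; exists [fset p i | i in F0] => G hG.
have d0 : 0 < e / 2 / (#|` G|%:R + 1) by rewrite divr_gt0 // ltr_wpDl.
set d := _ / (_ + 1) in d0.
have [F1 h1] : exists F1 : {fset I}, forall j, j \in enum_fset G ->
    forall F : {fset I}, F1 `<=` F ->
      N (g j - \sum_(i <- F) (if p i == j then u i else 0)) <= d.
  elim: (enum_fset G) => [|j r [F1 IH]]; first by exists fset0.
  have [F2 h2] := hg j _ d0; exists (F1 `|` F2) => k.
  rewrite inE => /orP [/eqP -> F hF|kr F hF].
    by apply: h2; apply: fsubset_trans hF; apply: fsubsetUr.
  by apply: IH => //; apply: fsubset_trans hF; apply: fsubsetUl.
(* F' is the part of F that lies over G. *)
pose F := F0 `|` F1; pose F' := [fset i in F | p i \in G].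
have inF' i : (i \in F') = (i \in F) && (p i \in G) by rewrite !inE.
have -> : s - \sum_(j <- G) g j = (s - \sum_(i <- F') u i) -
   \sum_(j <- G) (g j - \sum_(i <- F) (if p i == j then u i else 0)).
  rewrite sumrB opprB exchange_big /=.
  have -> : \sum_(i <- F) \sum_(j <- G) (if p i == j then u i else 0)
            = \sum_(i <- F') u i.
    transitivity (\sum_(i <- F) (if p i \in G then u i else 0)).
      apply: eq_bigr => i _; case: ifP => iG.
        rewrite (big_fsetD1 (p i)) //= eqxx big_seq big1 ?addr0 // => j.
        by rewrite in_fsetD1 eq_sym => /andP [/negPf -> _].
      rewrite big_seq big1 // => j jG; case: eqP => // pij.
      by move: iG; rewrite pij jG.
    transitivity (\sum_(i <- F') (if p i \in G then u i else 0)).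
      apply/esym/big_fset_incl => [|i iF].
        by apply/fsubsetP => i; rewrite inF' => /andP [].
      by rewrite inF' iF /= => /negPf ->.
    by rewrite big_seq [RHS]big_seq; apply: eq_bigr => i; rewrite inF' => /andP [_ ->].
  by rewrite addrA subrK.
apply: le_trans (_ : e / 2 + e / 2 <= _); last by lra.
apply: le_trans (rnD _ _ _) _; rewrite rnN; apply: lerD.
  apply: h0; apply/fsubsetP => i iF0; rewrite inF' in_fsetU iF0 /=.
  by apply: (fsubsetP hG); apply: in_imfset.
apply: le_trans (rn_sum _ _ _) _.
apply: le_trans (_ : \sum_(j <- G) d <= _).
  rewrite big_seq [leRHS]big_seq; apply: ler_sum => j jG.
  by apply: h1 => //; apply: fsubsetUr.
rewrite big_const_seq count_predT iter_addr_0 -[leLHS]mulr_natl /d mulrA ler_pdivrMr ?ltr_wpDl //.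
by rewrite mulrC ler_pM2l // lerDl.
Qed.

Lemma has_sum_fubini (J K : choiceType) (u : J * K -> V) (g : J -> V) s :
  has_sum N u s -> (forall j, has_sum N (fun k => u (j, k)) (g j)) ->
  has_sum N g s.
Proof.
move=> hs hg; apply: (has_sum_fiber (p := fst) hs) => j.
apply/(has_sum_inj (f := fun k => (j, k))) => [k k' [] //|[j' k] /= h|].
  by case: eqP => // jj; have := h k; rewrite jj eqxx.
by apply: eq_has_sum (hg j) => k /=; rewrite eqxx.
Qed.

Lemma has_sum_fin (K : finType) (u : K -> V) : has_sum N u (\sum_k u k).
Proof.
move=> e e0; exists [fset k in enum K] => F hF.
rewrite (perm_big (enum_fset F)) ?subrr ?rn0 ?ltW //=.
apply: uniq_perm; rewrite ?index_enum_uniq ?fset_uniq // => k.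
rewrite mem_index_enum; apply/esym/(fsubsetP hF).
by rewrite in_fset mem_enum.
Qed.

(** Cauchy products are sums over the fibres of (a, b) |-> a + b. *)
Lemma has_sum_antidiag (u : nat * nat -> V) s :
  has_sum N u s ->
  has_sum N (fun k => \sum_(a < k.+1) u (val a, k - a)%N) s.
Proof.
move=> hs; apply: (has_sum_fiber (p := fun x => (x.1 + x.2)%N) hs) => k.
apply/(has_sum_inj (f := fun a : 'I_k.+1 => (val a, k - a)%N)).
- by move=> a b [/val_inj].
- move=> [a b] h; case: eqP => //= abk.
  have ak : (a < k.+1)%N by lia.
  by have := h (Ordinal ak); rewrite /= -abk addKn eqxx.
apply: eq_has_sum (has_sum_fin _) => a /=.
by rewrite subnKC ?eqxx // -ltnS.
Qed.

End Sums.

Section BoundedSums.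
Variable R : realType.

Lemma bounded_sums_le (I : choiceType) (a b : I -> R) :
  (forall i, a i <= b i) -> bounded_sums b -> bounded_sums a.
Proof.
by move=> ab [B h]; exists B => F; apply: le_trans (h F); apply: ler_sum.
Qed.

Lemma bounded_sumsZ (I : choiceType) (b : I -> R) C :
  0 <= C -> bounded_sums b -> bounded_sums (fun i => C * b i).
Proof.
by move=> C0 [B h]; exists (C * B) => F; rewrite -mulr_sumr; apply: ler_wpM2l.
Qed.

Lemma bounded_sums_inj (I K : choiceType) (f : K -> I) (b : I -> R) :
  injective f -> bounded_sums b -> bounded_sums (b \o f).
Proof.
move=> finj [B h]; exists B => F.
rewrite (_ : \sum_(k <- F) _ = \sum_(i <- [fset f k | k in F]) b i) //.
by rewrite big_imfset //= => ? ? _ _ /finj.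
Qed.

Lemma ler_sum_sub (I : eqType) (r r' : seq I) (b : I -> R) :
  uniq r -> uniq r' -> {subset r <= r'} -> (forall i, 0 <= b i) ->
  \sum_(i <- r) b i <= \sum_(i <- r') b i.
Proof.
move=> ur ur' rr' b0; rewrite [leRHS](bigID (mem r)) /= -(big_filter r' (fun i => i \in r)).
rewrite (_ : \sum_(i <- [seq i <- r' | i \in r]) b i = \sum_(i <- r) b i).
  by rewrite lerDl sumr_ge0.
apply: perm_big; apply: uniq_perm; rewrite ?filter_uniq // => i.
by rewrite mem_filter; case: (boolP (i \in r)) => //= /rr'.
Qed.

(** A finite set of pairs lies in the product of its projections. *)
Lemma bounded_sums_prod (I J : choiceType) (a : I -> R) (b : J -> R) :
  (forall i, 0 <= a i) -> (forall j, 0 <= b j) ->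
  bounded_sums a -> bounded_sums b ->
  bounded_sums (fun x : I * J => a x.1 * b x.2).
Proof.
move=> a0 b0 [A hA] [B hB]; exists (A * B) => F.
pose F1 := [fset x.1 | x in F]; pose F2 := [fset x.2 | x in F].
apply: le_trans (ler_sum_sub (r' := [seq (i, j) | i <- enum_fset F1, j <- enum_fset F2]) _ _ _ _) _.
- exact: fset_uniq.
- by apply: allpairs_uniq => [||[? ?] [? ?] _ _ //]; exact: fset_uniq.
- move=> [i j] ijF; apply/allpairsP; exists (i, j); split=> //=.
    by apply/imfsetP; exists (i, j).
  by apply/imfsetP; exists (i, j).
- by move=> x; apply: mulr_ge0.
rewrite big_allpairs /=; under eq_bigr do rewrite -mulr_sumr.
rewrite -mulr_suml; apply: ler_pM => //; exact: sumr_ge0.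
Qed.

Lemma bounded_sums_nat (b : nat -> R) B :
  (forall k, 0 <= b k) -> (forall n, \sum_(k < n) b k <= B) ->
  bounded_sums b.
Proof.
move=> b0 hB; exists B => F; pose n := (\max_(k <- F) k).+1.
apply: le_trans (hB n); rewrite -(big_mkord predT b).
apply: ler_sum_sub => //; rewrite ?iota_uniq ?fset_uniq // => k kF.
by rewrite mem_index_iota /= /n ltnS; apply: leq_bigmax_seq.
Qed.

Lemma geometric_sum_le (r : R) d : 0 <= r < 1 -> \sum_(k < d) r ^+ k <= (1 - r)^-1.
Proof.
move=> /andP [r0 r1]; rewrite -[leRHS]mul1r ler_pdivlMr ?subr_gt0 // mulrC.
by rewrite -opprB mulNr -subrX1 opprB lerBlDr lerDl exprn_ge0.
Qed.

Lemma bounded_sums_geo (x C : R) (b : nat -> R) :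
  0 <= x < 1 -> (forall k, b k <= C * x ^+ k) -> bounded_sums b.
Proof.
move=> /andP [x0 x1] hb; apply: bounded_sums_le hb _.
have C0 : C <= `|C| by apply: ler_norm.
apply: (@bounded_sums_le _ _ (fun k => `|C| * x ^+ k)) => [k|].
  by apply: ler_wpM2r C0; apply: exprn_ge0.
apply: bounded_sumsZ => //.
apply: (@bounded_sums_nat _ (1 - x)^-1) => [k|n]; first exact: exprn_ge0.
by apply: geometric_sum_le; rewrite x0.
Qed.

Lemma bounded_sums_int (b : int -> R) :
  (forall l, 0 <= b l) ->
  bounded_sums (fun k : nat => b k) -> bounded_sums (fun k : nat => b (- k%:Z)) ->
  bounded_sums b.
Proof.
move=> b0 [A hA] [B hB]; exists (A + B) => F.
have [n nF] : exists n, forall l, l \in F -> (`|l| < n)%N.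
  exists (\max_(l <- F) `|l|%N).+1 => l lF.
  by rewrite ltnS; apply: (@leq_bigmax_seq _ _ _ absz l).
have h1 := hA [fset k in iota 0 n]; have h2 := hB [fset k in iota 0 n].
apply: le_trans (lerD h1 h2).
have iotaE (c : nat -> R) : \sum_(k <- [fset k in iota 0 n]) c k = \sum_(k <- iota 0 n) c k.
  apply: perm_big; apply: uniq_perm; rewrite ?iota_uniq ?fset_uniq // => k.
  by rewrite in_fset.
rewrite !iotaE.
pose r1 := [seq l <- enum_fset F | 0 <= l]; pose r2 := [seq l <- enum_fset F | ~~ (0 <= l)].
rewrite (bigID (fun l => 0 <= l)) /=; apply: lerD.
  rewrite -big_filter -(big_map Posz predT b).
  apply: ler_sum_sub => //; first by rewrite filter_uniq ?fset_uniq.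
    by rewrite map_inj_uniq; [exact: (iota_uniq 0 n)|move=> ? ? []].
  move=> l; rewrite mem_filter => /andP [l0 lF]; apply/mapP; exists `|l|%N; last lia.
  by rewrite mem_iota /= add0n nF.
rewrite -big_filter -(big_map (fun k => - Posz k) predT b).
apply: ler_sum_sub => //; first by rewrite filter_uniq ?fset_uniq.
  by rewrite map_inj_uniq; [exact: (iota_uniq 0 n)|move=> ? ? /oppr_inj []].
move=> l; rewrite mem_filter => /andP [l0 lF]; apply/mapP; exists `|l|%N; last lia.
by rewrite mem_iota /= add0n nF.
Qed.

Lemma bounded_sums_sup (I : choiceType) (b : I -> R) :
  bounded_sums b -> exists s, (forall F : {fset I}, \sum_(i <- F) b i <= s) /\
  forall e, 0 < e -> exists F : {fset I}, s - e < \sum_(i <- F) b i.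
Proof.
move=> [B hB]; pose E : set R := [set \sum_(i <- F) b i | F in [set: {fset I}]].
have hE : has_sup E.
  split; first by exists (\sum_(i <- fset0) b i); exists fset0.
  by exists B => _ [F _ <-].
exists (sup E); split=> [F|e e0]; first by apply: sup_upper_bound => //; exists F.
by have [_ [F _ <-] h] := sup_adherent e0 hE; exists F.
Qed.

(** Take a finite set whose sum is within e of the supremum. *)
Lemma bounded_sums_tail (I : choiceType) (b : I -> R) e :
  (forall i, 0 <= b i) -> bounded_sums b -> 0 < e ->
  exists F0 : {fset I}, forall F : {fset I}, F0 `<=` F ->
    \sum_(i <- F `\` F0) b i <= e.
Proof.
move=> b0 /bounded_sums_sup [s [us hs]] e0; have [F0 h] := hs e e0.
exists F0 => F F0F; have := us F.
rewrite (big_fsetID _ (mem F0)) /=.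
have -> : [fset x in F | x \in F0] = F0.
  by apply/fsetP => x; rewrite !inE /= andbC; case: (boolP (x \in F0)) => // /(fsubsetP F0F).
have -> : [fset x in F | x \notin F0] = F `\` F0.
  by apply/fsetP => x; rewrite in_fsetD !inE /= andbC.
lra.
Qed.

End BoundedSums.

(** * Products of sums, limits and dominated convergence *)

Section SumsProducts.
Variables (R : realType) (V : comNzRingType) (N : ringNorm R V).

(** For finitely many rows, one finite set of columns approximates all the row
   sums at once. *)
Lemma bounded_sums_rows (J K : choiceType) (u : J * K -> V) (g : J -> V) :
  bounded_sums (fun x => N (u x)) ->
  (forall j, has_sum N (fun k => u (j, k)) (g j)) ->
  bounded_sums (fun j => N (g j)).
Proof.
move=> [B hB] hg; exists B => G; apply/ler_addgt0Pr => e e0.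
have d0 : 0 < e / (#|` G|%:R + 1) by rewrite divr_gt0 // ltr_wpDl.
set d := _ / (_ + 1) in d0.
have [F hF] : exists F : {fset K}, forall j, j \in enum_fset G ->
    N (g j) <= d + \sum_(k <- F) N (u (j, k)).
  have [F hF] : exists F0 : {fset K}, forall j, j \in enum_fset G ->
      forall F : {fset K}, F0 `<=` F -> N (g j) <= d + \sum_(k <- F) N (u (j, k)).
    elim: (enum_fset G) => [|j r [F1 IH]]; first by exists fset0.
    have [F2 h2] := hg j _ d0; exists (F1 `|` F2) => k.
    rewrite inE => /orP [/eqP -> F hF|kr F hF].
      have := h2 F (fsubset_trans (fsubsetUr _ _) hF).
      have := rnD N (g j - \sum_(k <- F) u (j, k)) (\sum_(k <- F) u (j, k)).
      by rewrite subrK; have := rn_sum N F predT (fun k => u (j, k)); lra.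
    by apply: IH => //; apply: fsubset_trans hF; apply: fsubsetUl.
  by exists F => j /hF; apply.
apply: le_trans (_ : \sum_(j <- G) (d + \sum_(k <- F) N (u (j, k))) <= _).
  by rewrite big_seq [leRHS]big_seq; apply: ler_sum => j jG; apply: hF.
rewrite big_split /= addrC; apply: lerD.
  have := hB [fset x in [seq (j, k) | j <- enum_fset G, k <- enum_fset F]].
  rewrite (_ : \sum_(x <- _) _ = \sum_(j <- G) \sum_(k <- F) N (u (j, k))) //.
  rewrite -[RHS](@big_allpairs _ _ _ _ _ _ _ (fun x => N (u x))).
  apply: perm_big; apply: uniq_perm => [||x]; [exact: fset_uniq| |by rewrite in_fset].
  by apply: allpairs_uniq => [||[? ?] [? ?] _ _ //]; exact: fset_uniq.
rewrite big_const_seq count_predT iter_addr_0 -[leLHS]mulr_natl /d mulrA ler_pdivrMr ?ltr_wpDl //.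
by rewrite mulrC ler_pM2l // lerDl.
Qed.

Lemma bounded_sums_mul (J K : choiceType) (u : J -> V) (v : K -> V) :
  bounded_sums (fun j => N (u j)) -> bounded_sums (fun k => N (v k)) ->
  bounded_sums (fun x : J * K => N (u x.1 * v x.2)).
Proof.
move=> hu hv; apply: bounded_sums_le (bounded_sums_prod _ _ hu hv) => [x||] *.
- exact: rnM.
- exact: rn_ge0.
- exact: rn_ge0.
Qed.

Lemma has_sum_mul (J K : choiceType) (u : J -> V) (v : K -> V) s t :
  bounded_sums (fun j => N (u j)) -> bounded_sums (fun k => N (v k)) ->
  has_sum N u s -> has_sum N v t ->
  has_sum N (fun x : J * K => u x.1 * v x.2) (s * t).
Proof.
move=> bu bv hu hv.
have [w hw] := rn_complete (bounded_sums_mul bu bv).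
have h : has_sum N (fun j => u j * t) w.
  by apply: (has_sum_fubini hw) => j /=; apply: has_sumZ.
suff <- : w = s * t by [].
apply: has_sum_uniq h _; rewrite mulrC.
by apply: eq_has_sum (has_sumZ t hu) => j; rewrite mulrC.
Qed.

Section Tends.
Variables (T : Type) (G : set_system T).
Context {FG : ProperFilter G}.
Implicit Types (u v : T -> V).

Lemma tends_cst x : tends N G (fun=> x) x.
Proof. by move=> e e0; apply: nearW => t; rewrite subrr rn0 ltW. Qed.

Lemma tends_uniq u s t : tends N G u s -> tends N G u t -> s = t.
Proof.
move=> hs ht; apply/eqP; rewrite -subr_eq0; apply/eqP/(rn_small (N := N)) => e e0.
have e2 : 0 < e / 2 by lra.
have [x [h1 h2]] := filter_ex (filterI (hs _ e2) (ht _ e2)).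
by have := rn_tri N s (u x) t; rewrite (rn_dist N s (u x)); lra.
Qed.

Lemma tends_near_eq u v s : (\forall t \near G, u t = v t) ->
  tends N G u s -> tends N G v s.
Proof.
move=> huv hu e /hu; apply: filterS2 huv => t -> //.
Qed.

Lemma tendsD u v s t : tends N G u s -> tends N G v t ->
  tends N G (fun x => u x + v x) (s + t).
Proof.
move=> hs ht e e0; have e2 : 0 < e / 2 by lra.
apply: filterS2 (hs _ e2) (ht _ e2) => x h1 h2.
by have := rnD N (u x - s) (v x - t); rewrite opprD addrACA; lra.
Qed.

Lemma tendsZ c u s : tends N G u s -> tends N G (fun x => c * u x) (c * s).
Proof.
move=> hs e e0.
have c1 : 0 < N c + 1 by have := rn_ge0 N c; lra.
have h0 : 0 < e / (N c + 1) by rewrite divr_gt0.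
apply: filterS (hs _ h0) => x hx.
rewrite -mulrBr; apply: le_trans (rnM _ _ _) _.
apply: le_trans (_ : (N c + 1) * (e / (N c + 1)) <= _).
  by apply: ler_pM => //; rewrite ?rn_ge0 //; lra.
by rewrite mulrCA divff ?mulr1 // gt_eqF.
Qed.

Lemma tendsM u v s t : tends N G u s -> tends N G v t ->
  tends N G (fun x => u x * v x) (s * t).
Proof.
move=> hs ht.
have h0 : tends N G (fun x => (u x - s) * (v x - t)) 0.
  move=> e e0; have m0 : 0 < Num.min e 1 by rewrite lt_min e0 ltr01.
  apply: filterS2 (hs _ m0) (ht _ m0) => x h1 h2.
  rewrite subr0; apply: le_trans (rnM _ _ _) _.
  apply: le_trans (_ : Num.min e 1 * Num.min e 1 <= _).
    by apply: ler_pM => //; apply: rn_ge0.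
  apply: le_trans (_ : e * 1 <= _); last by rewrite mulr1.
  by apply: ler_pM; rewrite ?ge_min ?lexx ?orbT // ltW.
have h1 := tendsD h0 (tendsD (tendsZ t hs) (tendsZ s ht)).
have h2 := tendsD h1 (tends_cst (- (s * t))).
have -> : s * t = 0 + (t * s + s * t) - s * t by ring.
by apply: tends_near_eq h2; apply: nearW => x; ring.
Qed.

Lemma tends_big (op : V -> V -> V) (idx : V) (I : Type) (r : seq I) (P : pred I)
    (u : I -> T -> V) (s : I -> V) :
  (forall f g x y, tends N G f x -> tends N G g y ->
     tends N G (fun t => op (f t) (g t)) (op x y)) ->
  (forall i, tends N G (u i) (s i)) ->
  tends N G (fun t => \big[op/idx]_(i <- r | P i) u i t) (\big[op/idx]_(i <- r | P i) s i).
Proof.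
move=> hop h; elim: r => [|i r IH].
  rewrite big_nil; apply: tends_near_eq (tends_cst idx).
  by apply: nearW => x; rewrite big_nil.
rewrite big_cons; case: ifP => Pi; [apply: tends_near_eq (hop _ _ _ _ (h i) IH)|apply: tends_near_eq IH];
  by apply: nearW => x; rewrite big_cons Pi.
Qed.

Lemma tends_sum (I : Type) (r : seq I) (P : pred I) (u : I -> T -> V) (s : I -> V) :
  (forall i, tends N G (u i) (s i)) ->
  tends N G (fun x => \sum_(i <- r | P i) u i x) (\sum_(i <- r | P i) s i).
Proof. by apply: tends_big => f g x y; apply: tendsD. Qed.

Lemma tends_prod (I : Type) (r : seq I) (P : pred I) (u : I -> T -> V) (s : I -> V) :
  (forall i, tends N G (u i) (s i)) ->
  tends N G (fun x => \prod_(i <- r | P i) u i x) (\prod_(i <- r | P i) s i).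
Proof. by apply: tends_big => f g x y; apply: tendsM. Qed.

Lemma tendsX u s k : tends N G u s -> tends N G (fun x => u x ^+ k) (s ^+ k).
Proof.
move=> h; elim: k => [|k IH]; first exact: tends_cst.
rewrite exprS; apply: tends_near_eq (tendsM h IH).
by apply: nearW => x; rewrite exprS.
Qed.

Lemma tends_comp (T' : Type) (G' : set_system T') (f : T' -> T) u s :
  f @ G' --> G -> tends N G u s -> tends N G' (u \o f) s.
Proof. by move=> hf hu e /hu /hf. Qed.

Lemma tends_norm_le u s B : tends N G u s -> (\forall t \near G, N (u t) <= B) ->
  N s <= B.
Proof.
move=> hs hB; apply/ler_addgt0Pr => e e0.
have [x [h1 h2]] := filter_ex (filterI (hs _ e0) hB).
by have := rnD N (s - u x) (u x); rewrite subrK [N (s - _)]rn_dist; lra.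
Qed.

Lemma has_sum_tail (I : choiceType) (u : I -> V) s (b : I -> R) (F0 : {fset I}) e :
  (forall i, N (u i) <= b i) ->
  (forall F : {fset I}, F0 `<=` F -> \sum_(i <- F `\` F0) b i <= e) ->
  has_sum N u s -> N (s - \sum_(i <- F0) u i) <= e.
Proof.
move=> ub hb hs; apply/ler_addgt0Pr => d /hs [F1 h].
have h1 := h (F0 `|` F1) (fsubsetUr _ _).
have h2 := hb (F0 `|` F1) (fsubsetUl _ _).
have h3 : N (\sum_(i <- F0 `|` F1) u i - \sum_(i <- F0) u i) <= e.
  rewrite (big_fsetID _ (mem F0)) /=.
  have -> : [fset x in F0 `|` F1 | x \in F0] = F0.
    apply/fsetP => x; rewrite in_fset /= inE /= in_fsetU.
    by case: (x \in F0); rewrite ?andbF.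
  have -> : [fset x in F0 `|` F1 | x \notin F0] = (F0 `|` F1) `\` F0.
    by apply/fsetP => x; rewrite in_fsetD !inE /= andbC.
  rewrite addrAC subrr add0r; apply: le_trans (rn_sum _ _ _ _) _.
  by apply: le_trans h2; apply: ler_sum.
by have := rn_tri N s (\sum_(i <- F0 `|` F1) u i) (\sum_(i <- F0) u i); lra.
Qed.

(** Dominated convergence for sums.  Outside a finite set F0 the majorant b
   makes every tail at most e/3, uniformly in t; on F0 the limit is taken term
   by term. *)
Lemma tannery (I : choiceType) (u : T -> I -> V) (v : I -> V) (b : I -> R)
    (U : T -> V) (W : V) :
  (forall i, tends N G (u^~ i) (v i)) -> bounded_sums b ->
  (\forall t \near G, forall i, N (u t i) <= b i) ->
  (\forall t \near G, has_sum N (u t) (U t)) -> has_sum N v W ->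
  tends N G U W.
Proof.
move=> uv bb ub hU hW e e0; have e3 : 0 < e / 3 by lra.
have vb i : N (v i) <= b i.
  by apply: tends_norm_le (uv i) _; apply: filterS ub => t; apply.
have b0 i : 0 <= b i by apply: le_trans (vb i); apply: rn_ge0.
have [F0 hF0] := bounded_sums_tail b0 bb e3.
have hv := has_sum_tail vb hF0 hW.
have hs : tends N G (fun t => \sum_(i <- F0) u t i) (\sum_(i <- F0) v i).
  by apply: tends_sum => i; apply: uv.
have h1 : \forall t \near G, N (U t - \sum_(i <- F0) u t i) <= e / 3.
  by apply: filterS2 ub hU => t ubt hUt; apply: has_sum_tail ubt hF0 hUt.
apply: filterS2 h1 (hs _ e3) => t h1 h2.
have := rn_tri N (U t) (\sum_(i <- F0) u t i) W.
have := rn_tri N (\sum_(i <- F0) u t i) (\sum_(i <- F0) v i) W.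
by rewrite (rn_dist N (\sum_(i <- F0) v i) W); lra.
Qed.

End Tends.

Lemma has_sum_series (u : nat -> V) s : has_sum N u s ->
  tends N \oo (series u) s.
Proof.
move=> hs e /hs [F0 h].
exists (\max_(k <- F0) k).+1 => // n /= hn.
rewrite /series /= rn_dist.
have -> : \sum_(0 <= k < n) u k = \sum_(k <- [fset k in iota 0 n]) u k.
  rewrite /index_iota subn0; apply/esym/perm_big; apply: uniq_perm; rewrite ?iota_uniq ?fset_uniq // => k.
  by rewrite in_fset.
apply: h; apply/fsubsetP => k kF; rewrite in_fset /= mem_iota add0n /=.
by apply: leq_trans hn; rewrite ltnS; apply: leq_bigmax_seq.
Qed.

End SumsProducts.

(** * The norms of C and of truncated polynomials *)

Section RealNorm.
Variable R : realType.

(** Of a nonnegative family the sum is the supremum of the finite sums. *)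
Lemma has_sum_sup (I : choiceType) (b : I -> R) :
  (forall i, 0 <= b i) -> bounded_sums b ->
  exists s, has_sum (fun x : R => `|x|) b s.
Proof.
move=> b0 /bounded_sums_sup [s [us hs]]; exists s => e e0.
have [F0 h] := hs e e0; exists F0 => F F0F; have h1 := us F.
have h2 : \sum_(i <- F0) b i <= \sum_(i <- F) b i.
  by apply: ler_sum_sub; rewrite ?fset_uniq // => i; apply: (fsubsetP F0F).
by rewrite ger0_norm; lra.
Qed.

(** u = (u + |u|) - |u| is a difference of nonnegative summable families. *)
Lemma real_complete (I : choiceType) (u : I -> R) :
  bounded_sums (fun i => `|u i|) -> exists s, has_sum (fun x : R => `|x|) u s.
Proof.
move=> hu; have [s hs] := has_sum_sup (fun i => normr_ge0 (u i)) hu.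
have [] := @has_sum_sup _ (fun i => u i + `|u i|).
- by move=> i; have := ler_norm (- u i); rewrite normrN; lra.
- apply: (@bounded_sums_le _ _ _ (fun i => 2 * `|u i|)); last exact: bounded_sumsZ hu.
  by move=> i; have := ler_norm (u i); lra.
move=> t ht; exists (t - s) => e e0; have e2 : 0 < e / 2 by lra.
have [F0 h0] := hs _ e2; have [F1 h1] := ht _ e2.
exists (F0 `|` F1) => F hF.
have := h0 F (fsubset_trans (fsubsetUl _ _) hF).
have := h1 F (fsubset_trans (fsubsetUr _ _) hF).
rewrite big_split /=; set a := \sum_(i <- F) u i; set b := \sum_(i <- F) `|u i|.
move=> h2 h3; rewrite (_ : t - s - a = (t - (a + b)) - (s - b)); last by ring.
by apply: le_trans (ler_normB _ _) _; lra.
Qed.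

Lemma normc_ge0 (z : R[i]) : 0 <= normc z.
Proof. by case: z => a b; apply: sqrtr_ge0. Qed.

Lemma ger_normc_Re (z : R[i]) : `|complex.Re z| <= normc z.
Proof.
case: z => a b /=; rewrite -sqrtr_sqr; apply: ler_wsqrtr.
by rewrite lerDl sqr_ge0.
Qed.

Lemma ger_normc_Im (z : R[i]) : `|complex.Im z| <= normc z.
Proof.
case: z => a b /=; rewrite -sqrtr_sqr; apply: ler_wsqrtr.
by rewrite lerDr sqr_ge0.
Qed.

Lemma ler_normcM (y z : R[i]) : normc (y * z) <= normc y * normc z.
Proof. by rewrite normcM. Qed.

Lemma normc_le_parts (z : R[i]) : normc z <= `|complex.Re z| + `|complex.Im z|.
Proof.
case: z => a b /=; rewrite -[leRHS]ger0_norm ?addr_ge0 // -sqrtr_sqr.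
apply: ler_wsqrtr; rewrite sqrrD !real_normK ?num_real //.
by rewrite lerD2r lerDl mulrn_wge0 // mulr_ge0.
Qed.

Lemma Re_sum (I : Type) (r : seq I) (u : I -> R[i]) :
  complex.Re (\sum_(i <- r) u i) = \sum_(i <- r) complex.Re (u i).
Proof. by elim/big_rec2: _ => //= i x y _ <-; case: (u i) y => [? ?] [? ?]. Qed.

Lemma Im_sum (I : Type) (r : seq I) (u : I -> R[i]) :
  complex.Im (\sum_(i <- r) u i) = \sum_(i <- r) complex.Im (u i).
Proof. by elim/big_rec2: _ => //= i x y _ <-; case: (u i) y => [? ?] [? ?]. Qed.

Lemma complex_complete (I : choiceType) (u : I -> R[i]) :
  bounded_sums (fun i => normc (u i)) -> exists s, has_sum (@normc R) u s.
Proof.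
move=> hu.
have [a ha] := real_complete (bounded_sums_le (fun i => ger_normc_Re (u i)) hu).
have [b hb] := real_complete (bounded_sums_le (fun i => ger_normc_Im (u i)) hu).
exists (a +i* b)%C => e e0; have e2 : 0 < e / 2 by lra.
have [F0 h0] := ha _ e2; have [F1 h1] := hb _ e2.
exists (F0 `|` F1) => F hF.
have := h0 F (fsubset_trans (fsubsetUl _ _) hF).
have := h1 F (fsubset_trans (fsubsetUr _ _) hF).
have := normc_le_parts ((a +i* b)%C - \sum_(i <- F) u i).
rewrite -Re_sum -Im_sum; case: (\sum_(i <- F) u i) => x y /=; lra.
Qed.

Definition complexNorm : ringNorm R R[i] := {|
  rn := @normc R;
  rn_eq0 := @eq0_normc R;
  rn0 := normc0 R;
  rnN := @normcN R;
  rnD := @le_normcD R;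
  rnM := ler_normcM;
  rn_complete := complex_complete |}.

End RealNorm.

Section TruncatedNorm.
Variables (R : realType) (n : nat).
Local Notation C := R[i].
Local Notation K := (@KP R n).
Local Notation n' := n.-1.+1.

(** The l1 norm of the coordinates: it is submultiplicative and restricts to
   the modulus on constants.  The number of coordinates is max(n, 1), as the
   modulus is X when n = 0. *)
Definition knorm (x : K) : R := \sum_(a < n') normc (x : {poly C})`_a.

Lemma size_KP (x : K) : (size (x : {poly C}) <= n')%N.
Proof.
by apply: leq_trans (size_npoly x) _; rewrite mk_monic_Xn size_polyXn.
Qed.

Lemma coef_KP_default (x : K) a : (n' <= a)%N -> (x : {poly C})`_a = 0.
Proof. by move=> h; rewrite nth_default // (leq_trans (size_KP x)). Qed.

Lemma coef_in_qpoly (p : {poly C}) a :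
  (in_qpoly 'X^n p : {poly C})`_a = if (a < n')%N then p`_a else 0.
Proof.
case: ltnP => h; last exact: coef_KP_default.
rewrite [in RHS](Pdiv.RingMonic.rdivp_eq (monic_mk_monic 'X^n) p) coefD.
suff -> : (Pdiv.CommonRing.rdivp p (mk_monic 'X^n) * mk_monic 'X^n)`_a = 0.
  by rewrite add0r.
by rewrite mk_monic_Xn coefMXn h.
Qed.

Lemma coef_KPM (x y : K) a : (a < n')%N ->
  (x * y : {poly C})`_a = ((x : {poly C}) * (y : {poly C}))`_a.
Proof. by move=> h; rewrite (coef_in_qpoly ((x : {poly C}) * (y : {poly C}))) h. Qed.

Lemma KP_eqP (x y : K) :
  (forall a, (a < n')%N -> (x : {poly C})`_a = (y : {poly C})`_a) -> x = y.
Proof.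
move=> h; apply/val_inj/polyP => a /=.
by case: (ltnP a n') => [/h //|ha]; rewrite !coef_KP_default.
Qed.

Lemma knorm_eq0 x : knorm x = 0 -> x = 0.
Proof.
move=> /psumr_eq0P h; apply: KP_eqP => a ha; rewrite coef0.
by apply: eq0_normc; apply: (h (fun i _ => normc_ge0 _) (Ordinal ha)).
Qed.

Lemma knorm0 : knorm 0 = 0.
Proof. by apply: big1 => a _; rewrite coef0 normc0. Qed.

Lemma knormN x : knorm (- x) = knorm x.
Proof. by apply: eq_bigr => a _; rewrite /= coefN normcN. Qed.

Lemma knormD x y : knorm (x + y) <= knorm x + knorm y.
Proof.
by rewrite -big_split; apply: ler_sum => a _; rewrite /= coefD le_normcD.
Qed.

(** The coefficients of the product form the truncation of a Cauchy product. *)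
Lemma knormM x y : knorm (x * y) <= knorm x * knorm y.
Proof.
rewrite /knorm.
under eq_bigr => a _ do rewrite coef_KPM ?ltn_ord // coefM.
pose f a := normc (x : {poly C})`_a; pose g a := normc (y : {poly C})`_a.
have g0 a : 0 <= g a by apply: normc_ge0.
apply: le_trans (_ : \sum_(a < n') \sum_(b < n') (if (b <= a)%N then f b * g (a - b)%N else 0) <= _).
  apply: ler_sum => a _; apply: le_trans (_ : \sum_(b < a.+1) f b * g (a - b)%N <= _).
    apply: le_trans (rn_sum (complexNorm R) _ _ _) _.
    by apply: ler_sum => b _ /=; rewrite normcM.
  rewrite -(big_mkord predT (fun b => f b * g (a - b)%N)).
  rewrite -(big_mkord predT (fun b => if (b <= a)%N then f b * g (a - b)%N else 0)).
  rewrite [leRHS](big_cat_nat _ (n := a.+1)) //=.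
  apply: le_trans (_ : \sum_(0 <= b < a.+1) (if (b <= a)%N then f b * g (a - b)%N else 0) <= _).
    by rewrite big_nat_cond [leRHS]big_nat_cond; apply: ler_sum => b /andP [/andP [_]]; rewrite ltnS => ->.
  rewrite lerDl; apply: sumr_ge0 => b _; case: ifP => // _.
  by apply: mulr_ge0; rewrite ?g0 ?normc_ge0.
rewrite exchange_big /= mulr_suml; apply: ler_sum => b _.
apply: le_trans (_ : f b * \sum_(a < n') (if (b <= a)%N then g (a - b)%N else 0) <= _).
  by rewrite mulr_sumr; apply: ler_sum => a _; case: ifP; rewrite ?mulr0.
apply: ler_wpM2l; first exact: normc_ge0.
rewrite -(big_mkord predT (fun a => if (b <= a)%N then g (a - b)%N else 0)).
rewrite (big_cat_nat _ (n := b)) //= ?(ltnW (ltn_ord b)) //.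
rewrite (_ : \sum_(0 <= a < b) _ = 0) ?add0r; last first.
  rewrite big_nat_cond big1 // => a /andP [/andP [_ h] _].
  by rewrite leqNgt h.
rewrite -{1}[val b]add0n big_addn -(big_mkord predT g).
rewrite [leRHS](big_cat_nat _ (n := n' - b)) //= ?leq_subr //.
apply: le_trans (_ : \sum_(0 <= i < n' - b) g i <= _).
  by apply: ler_sum => i _; rewrite leq_addl addnK.
by rewrite lerDl; apply: sumr_ge0.
Qed.

Lemma knorm_complete (I : choiceType) (u : I -> K) :
  bounded_sums (fun i => knorm (u i)) -> exists s, has_sum knorm u s.
Proof.
move=> hu.
have /choice [s hs] : forall a : 'I_n', exists s, has_sum (complexNorm R) (fun i => (u i : {poly C})`_a) s.
  move=> a; apply: rn_complete; apply: bounded_sums_le hu => i.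
  by rewrite /knorm (bigD1 a) //= lerDl; apply: sumr_ge0 => b _; apply: normc_ge0.
exists (in_qpoly 'X^n (\poly_(a < n') (if insub a is Some b then s b else 0))) => e e0.
have d0 : 0 < e / n'%:R by rewrite divr_gt0 // ltr0n.
have [F0 h] : exists F0 : {fset I}, forall a, a \in enum 'I_n' ->
    forall F : {fset I}, F0 `<=` F -> normc (s a - \sum_(i <- F) (u i : {poly C})`_a) <= e / n'%:R.
  elim: (enum _) => [|j r [F1 IH]]; first by exists fset0.
  have [F2 h2] := hs j _ d0; exists (F1 `|` F2) => k.
  rewrite inE => /orP [/eqP -> F hF|kr F hF].
    by apply: h2; apply: fsubset_trans hF; apply: fsubsetUr.
  by apply: IH => //; apply: fsubset_trans hF; apply: fsubsetUl.
exists F0 => F /h hF; rewrite /knorm.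
apply: le_trans (_ : \sum_(a < n') e / n'%:R <= _).
  apply: ler_sum => a _; rewrite /= coefB coef_in_qpoly ltn_ord coef_poly ltn_ord valK.
  by rewrite coefn_sum; apply: hF; rewrite mem_enum.
by rewrite sumr_const card_ord -[leLHS]mulr_natl mulrC divfK // pnatr_eq0.
Qed.

Definition truncatedNorm : ringNorm R K := {|
  rn := knorm;
  rn_eq0 := knorm_eq0;
  rn0 := knorm0;
  rnN := knormN;
  rnD := knormD;
  rnM := knormM;
  rn_complete := knorm_complete |}.

End TruncatedNorm.

(** * Complete local algebras over C *)

(** A complete commutative algebra over C in which every element is a complex
   number, its residue, plus a nilpotent of bounded index.  Invertibility is
   then a condition on the residue ([unit_res]) and inverses are bounded in
   terms of it ([inv_bound]). *)
Record localAlg (R : realType) := LocalAlg {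
  la_ring :> comUnitRingType;
  la_norm : ringNorm R la_ring;
  emb : {rmorphism R[i] -> la_ring};
  res : {rmorphism la_ring -> R[i]};
  la_exp : nat;
  embK : forall c, res (emb c) = c;
  norm_emb : forall c, la_norm (emb c) = normc c;
  norm_res : forall x, normc (res x) <= la_norm x;
  la_nilpotent : forall x, (x - emb (res x)) ^+ la_exp = 0
}.

Section LocalAlgTheory.
Variables (R : realType) (A : localAlg R).
Local Notation C := R[i].
Local Notation N := (la_norm A).
Implicit Types x y : A.

Lemma norm1 : N 1 = 1.
Proof. by have := norm_emb A 1; rewrite rmorph1 => ->; exact: normc1. Qed.

Lemma normX x k : N (x ^+ k) <= N x ^+ k.
Proof. by apply: rnX; rewrite norm1. Qed.

Lemma norm_embM c x : N (emb A c * x) <= normc c * N x.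
Proof. by rewrite -(norm_emb A) rnM. Qed.

Lemma norm_prod (I : Type) (r : seq I) (P : pred I) (u : I -> A) (b : I -> R) :
  (forall i, N (u i) <= b i) ->
  N (\prod_(i <- r | P i) u i) <= \prod_(i <- r | P i) b i.
Proof.
move=> h; elim/big_rec2: _ => [|i y x _ IH]; first by rewrite norm1.
by apply: le_trans (rnM _ _ _) _; apply: ler_pM => //; apply: rn_ge0.
Qed.

(** With c the residue of x and n the index, c^n = c^n - (c - x)^n is divisible
   by x, with a finite geometric sum as quotient.  This inverts x as soon as
   c is invertible, with an explicit bound. *)
Lemma geometric_inverse x : exists2 W, x * W = emb A (res A x) ^+ la_exp A &
  N W <= (la_exp A)%:R * (1 + 2 * N x) ^+ la_exp A.
Proof.
set c := emb A (res A x); set n := la_exp A.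
exists (\sum_(i < n) c ^+ (n.-1 - i) * (c - x) ^+ i).
  have := subrXX c (c - x) n; rewrite subKr => <-.
  by rewrite -[c - x]opprB exprNn la_nilpotent mulr0 subr0.
apply: le_trans (rn_sum _ _ _ _) _.
have hc : N c <= N x by rewrite norm_emb norm_res.
have x0 := rn_ge0 N x.
apply: le_trans (_ : \sum_(i < n) (1 + 2 * N x) ^+ n <= _); last first.
  by rewrite sumr_const card_ord -[leLHS]mulr_natl.
apply: ler_sum => i _; apply: le_trans (rnM _ _ _) _.
apply: le_trans (_ : (1 + 2 * N x) ^+ (n.-1 - i) * (1 + 2 * N x) ^+ i <= _).
  apply: ler_pM; rewrite ?rn_ge0 //; apply: le_trans (normX _ _) _; apply: lerXn2r.
  - by rewrite nnegrE rn_ge0.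
  - by rewrite nnegrE; lra.
  - lra.
  - by rewrite nnegrE rn_ge0.
  - by rewrite nnegrE; lra.
  - by have := rnD N c (- x); rewrite rnN; lra.
rewrite -exprD; apply: ler_weXn2l; first lra.
by have := ltn_ord i; lia.
Qed.

Lemma unit_res x : (x \is a GRing.unit) = (res A x != 0).
Proof.
apply/idP/idP => [/(rmorph_unit (res A))|]; first by rewrite unitfE.
move=> h; have [W hW _] := geometric_inverse x.
have : x * W \is a GRing.unit.
  by rewrite hW unitrX // rmorph_unit // unitfE.
by rewrite unitrM => /andP [].
Qed.

Lemma emb_unit (c : C) : c != 0 -> emb A c \is a GRing.unit.
Proof. by rewrite unit_res embK. Qed.

Lemma inv_bound B c : 0 < c -> exists2 D, 0 <= D &
  forall x, N x <= B -> c <= normc (res A x) -> N x^-1 <= D.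
Proof.
move=> c0; exists ((la_exp A)%:R * (1 + 2 * `|B|) ^+ la_exp A * c^-1 ^+ la_exp A).
  have B0 := normr_ge0 B; have c1 := ltW c0.
  by rewrite !mulr_ge0 ?exprn_ge0 ?invr_ge0 //; lra.
move=> x xB cx; have [W hW nW] := geometric_inverse x.
have rx : res A x != 0.
  by apply: contraTneq cx => ->; rewrite normc0 -ltNge.
have -> : x^-1 = W * emb A ((res A x)^-1) ^+ la_exp A.
  have ux : x \is a GRing.unit by rewrite unit_res.
  apply: (mulrI ux); rewrite divrr // mulrA hW -exprMn -rmorphM divff //.
  by rewrite rmorph1 expr1n.
apply: le_trans (rnM _ _ _) _.
have x0 := rn_ge0 N x; have xB' : N x <= `|B| by apply: le_trans (ler_norm _).
apply: ler_pM; rewrite ?rn_ge0 //.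
  apply: le_trans nW _; apply: ler_wpM2l => //; apply: lerXn2r; rewrite ?nnegrE; lra.
apply: le_trans (normX _ _) _; rewrite norm_emb normcV; apply: lerXn2r.
- by rewrite nnegrE invr_ge0 normc_ge0.
- by rewrite nnegrE invr_ge0 ltW.
- by rewrite lef_pV2 // posrE (lt_le_trans c0).
Qed.

Lemma tends_res (T : Type) (G : set_system T) (FG : Filter G) (u : T -> A) s :
  tends N G u s -> tends (complexNorm R) G (fun t => res A (u t)) (res A s).
Proof.
move=> h e /h; apply: filterS => t; apply: le_trans.
by rewrite -rmorphB norm_res.
Qed.

Lemma tends_emb (T : Type) (G : set_system T) (FG : Filter G) (u : T -> C) s :
  tends (complexNorm R) G u s -> tends N G (fun t => emb A (u t)) (emb A s).
Proof.
by move=> h e /h; apply: filterS => t; apply: le_trans; rewrite -rmorphB norm_emb.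
Qed.

Lemma has_sum_emb (I : choiceType) (u : I -> C) s :
  has_sum (complexNorm R) u s -> has_sum N (fun i => emb A (u i)) (emb A s).
Proof.
move=> h e /h [F0 hF]; exists F0 => F /hF; apply: le_trans.
by rewrite -rmorph_sum -rmorphB norm_emb.
Qed.

End LocalAlgTheory.

Section Instances.
Variable R : realType.
Local Notation C := R[i].

Lemma complex_nilpotent (x : C) : (x - x) ^+ 1 = 0.
Proof. by rewrite subrr expr1. Qed.

Definition complexAlg : localAlg R :=
  @LocalAlg R C (complexNorm R) idfun idfun 1
   (fun=> erefl) (fun=> erefl) (fun x => lexx _) complex_nilpotent.

Variable n : nat.
Local Notation K := (@KP R n).
Local Notation n' := n.-1.+1.

Definition ctcoef (x : K) : C := (x : {poly C})`_0.

Fact ctcoef_is_zmod_morphism : zmod_morphism ctcoef.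
Proof. by move=> x y; rewrite /ctcoef /= coefB. Qed.

Fact ctcoef_is_monoid_morphism : monoid_morphism ctcoef.
Proof.
split=> [|x y]; first by rewrite /ctcoef /= coefC.
by rewrite /ctcoef coef_KPM // coef0M.
Qed.

HB.instance Definition _ := GRing.isZmodMorphism.Build K C ctcoef
  ctcoef_is_zmod_morphism.
HB.instance Definition _ := GRing.isMonoidMorphism.Build K C ctcoef
  ctcoef_is_monoid_morphism.

Lemma coef_scalar (c : C) a : ((c%:A : K) : {poly C})`_a = if a == 0%N then c else 0.
Proof. by rewrite /= coefZ coefC; case: eqP; rewrite ?mulr1 ?mulr0. Qed.

Lemma ctcoefK (c : C) : ctcoef (c%:A : K) = c.
Proof. by rewrite /ctcoef coef_scalar. Qed.

Lemma knorm_scalar (c : C) : knorm (c%:A : K) = normc c.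
Proof.
rewrite /knorm big_ord_recl coef_scalar big1 ?addr0 // => a _.
by rewrite coef_scalar normc0.
Qed.

Lemma normc_ctcoef (x : K) : normc (ctcoef x) <= knorm x.
Proof.
rewrite /knorm big_ord_recl lerDl; apply: sumr_ge0 => a _; exact: normc_ge0.
Qed.

(** x minus its constant term is a multiple of X. *)
Lemma KP_nilpotent (x : K) : (x - (ctcoef x)%:A) ^+ n' = 0.
Proof.
have [y hy] : exists y : K, x - (ctcoef x)%:A = in_qpoly 'X^n 'X * y.
  exists (in_qpoly 'X^n (\poly_(a < n') (x : {poly C})`_a.+1)).
  apply: KP_eqP => a ha; rewrite -in_qpolyM coef_in_qpoly ha coefXM coefB coef_scalar.
  case: a ha => [|a] ha /=; first by rewrite subrr.
  by rewrite subr0 coef_poly (ltnW ha).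
rewrite hy exprMn -rmorphXn /=.
suff -> : in_qpoly 'X^n 'X^n' = 0 :> K by rewrite mul0r.
by apply: KP_eqP => a ha; rewrite coef_in_qpoly ha coefXn coef0 ltn_eqF.
Qed.

Definition truncatedAlg : localAlg R :=
  @LocalAlg R K (truncatedNorm R n) (GRing.in_alg K) ctcoef n'
    ctcoefK knorm_scalar normc_ctcoef KP_nilpotent.

End Instances.

(** * Lagrange interpolation at reciprocal nodes *)

Section Lagrange.
Variables (F : fieldType) (S : finType) (c : S -> F).
Hypotheses (c_inj : injective c) (c_neq0 : forall s, c s != 0).

(** Both sides have degree less than |S| and agree at the |S| points 1/c_s. *)
Lemma lagrange_reciprocal (p : {poly F}) : (size p <= #|S|)%N ->
  p = \sum_s (p.[(c s)^-1] / \prod_(t | t != s) (1 - c t / c s)) *: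
        \prod_(t | t != s) (1 - c t *: 'X).
Proof.
move=> sp; apply/eqP; rewrite -subr_eq0; apply/eqP.
set g := \sum_s _.
have sg : (size g <= #|S|)%N.
  apply: leq_trans (size_sum _ _ _) _; apply/bigmax_leqP => s _.
  apply: leq_trans (size_scale_leq _ _) _.
  apply: leq_trans (size_prod_leq _ _) _.
  have -> : #|[pred t | t != s]| = #|S|.-1 by rewrite (cardC1 s).
  have S0 : (0 < #|S|)%N by apply/card_gt0P; exists s.
  rewrite leq_subLR; apply: leq_trans (_ : (\sum_(t | t != s) 2).+1 <= _)%N.
    rewrite ltnS; apply: leq_sum => t _.
    apply: leq_trans (size_polyD _ _) _; rewrite geq_max size_poly1 size_polyN /=.
    by apply: leq_trans (size_scale_leq _ _) _; rewrite size_polyX.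
  rewrite sum_nat_const (cardC1 s); lia.
have ev i s : (1 - c i *: 'X).[(c s)^-1] = 1 - c i / c s.
  by rewrite hornerD hornerN hornerC hornerZ hornerX.
have gs s : g.[(c s)^-1] = p.[(c s)^-1].
  rewrite horner_sum (bigD1 s) //= [X in _ + X]big1 ?addr0 => [|t ts].
    rewrite hornerZ horner_prod.
    rewrite [X in _ * X](eq_bigr _ (fun i _ => ev i s)).
    rewrite divfK //; apply/prodf_neq0 => t ts; rewrite subr_eq0 eq_sym.
    apply: contraNneq ts => h; apply/eqP/c_inj.
    by rewrite -[LHS](divfK (c_neq0 s)) h mul1r.
  rewrite hornerZ horner_prod [X in _ * X](bigD1 s) 1?eq_sym //=.
  by rewrite ev divff // subrr mul0r mulr0.
apply: (@roots_geq_poly_eq0 _ _ [seq (c s)^-1 | s <- enum S]).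
- by apply/allP => _ /mapP [s _ ->]; rewrite /root hornerD hornerN gs subrr.
- by rewrite map_inj_uniq ?enum_uniq // => s t /invr_inj /c_inj.
- rewrite size_map -cardE; apply: leq_trans (size_polyD _ _) _.
  by rewrite size_polyN geq_max sp sg.
Qed.

Lemma lagrange_eval (B : comNzRingType) (f : {rmorphism F -> B}) (p : {poly F}) (t : B) :
  (size p <= #|S|)%N ->
  (map_poly f p).[t] = \sum_s f (p.[(c s)^-1] / \prod_(i | i != s) (1 - c i / c s)) *
        \prod_(i | i != s) (1 - f (c i) * t).
Proof.
move=> sp; rewrite [in LHS](lagrange_reciprocal sp) rmorph_sum horner_sum.
apply: eq_bigr => s _; rewrite /= map_polyZ hornerZ rmorph_prod horner_prod.
congr (_ * _); apply: eq_bigr => i _.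
by rewrite rmorphB rmorph1 /= map_polyZ map_polyX hornerD hornerN hornerC hornerZ hornerX.
Qed.

End Lagrange.

Lemma prod_ord_neq (B : comNzRingType) L k (F : nat -> B) : (k < L)%N ->
  \prod_(l < L | val l != k) F l =
  (\prod_(l < k) F l) * \prod_(l < L - k.+1) F (k.+1 + l)%N.
Proof.
move=> kL; rewrite -(big_mkord (fun l => l != k) F).
rewrite (big_cat_nat _ (n := k)) //=; last exact: ltnW.
rewrite [X in _ * X]big_ltn_cond // eqxx /=; congr (_ * _).
  rewrite big_nat_cond big_mkord; apply: eq_bigl => l.
  by rewrite /= ltn_ord /= neq_ltn ltn_ord.
rewrite -{1}[k.+1]add0n big_addn big_nat_cond big_mkord.
apply: eq_big => [l|l _]; last by rewrite addnC.
by rewrite /= ltn_ord /= neq_ltn; lia.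
Qed.

(** * Finite q-Pochhammer symbols and the q-binomial theorem *)

Lemma qpochS (B : comNzRingType) (a p : B) d :
  qpoch a p d.+1 = qpoch a p d * (1 - a * p ^+ d).
Proof. by rewrite /qpoch big_ord_recr. Qed.

Lemma qpoch0 (B : comNzRingType) (a p : B) : qpoch a p 0 = 1.
Proof. by rewrite /qpoch big_ord0. Qed.

Lemma qpochD (B : comNzRingType) (a p : B) d e :
  qpoch a p (d + e) = qpoch a p d * qpoch (a * p ^+ d) p e.
Proof.
rewrite /qpoch big_split_ord /=; congr (_ * _).
by apply: eq_bigr => k _; rewrite exprD mulrA.
Qed.

Lemma qpochSl (B : comNzRingType) (a p : B) d :
  qpoch a p d.+1 = (1 - a) * qpoch (a * p) p d.
Proof. by rewrite -add1n qpochD qpochS qpoch0 mul1r expr0 mulr1 expr1. Qed.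

Lemma rmorph_qpoch (B D : comNzRingType) (f : {rmorphism B -> D}) a p d :
  f (qpoch a p d) = qpoch (f a) (f p) d.
Proof.
rewrite /qpoch rmorph_prod; apply: eq_bigr => k _.
by rewrite rmorphB rmorph1 rmorphM rmorphXn.
Qed.

Lemma normcX (R : realType) (x : R[i]) k : normc (x ^+ k) = normc x ^+ k.
Proof. by elim: k => [|k IH]; rewrite ?expr0 ?exprS ?normcM ?IH //; exact: normc1. Qed.

Lemma normcB_ge (R : realType) (x y : R[i]) : normc x - normc y <= normc (x - y).
Proof. by have := le_normcD (x - y) y; rewrite subrK; lra. Qed.

Section Growth.
Variable R : realType.

(** The finitely many terms before K are absorbed into the constant D. *)
Lemma geometric_decay (b : nat -> R) K : (forall k, 0 <= b k) ->
  (forall k, (K <= k)%N -> b k.+1 <= 1/2 * b k) ->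
  exists2 D, 0 <= D & forall k, b k <= D * (1/2) ^+ k.
Proof.
move=> b0 hb; exists (\sum_(j < K.+1) b j * 2 ^+ j).
  by apply: sumr_ge0 => j _; rewrite mulr_ge0 ?exprn_ge0.
have h k : (k <= K)%N -> b k <= (\sum_(j < K.+1) b j * 2 ^+ j) * (1/2) ^+ k.
  move=> kK; have kK1 : (k < K.+1)%N by [].
  rewrite (bigD1 (Ordinal kK1)) //= mulrDl -mulrA -exprMn.
  rewrite (_ : 2 * (1/2) = 1 :> R); last by lra.
  rewrite expr1n mulr1 lerDl mulr_ge0 ?exprn_ge0 ?sumr_ge0 // => *.
  by rewrite mulr_ge0 ?exprn_ge0.
elim=> [|k IH]; first exact: h.
case: (ltnP k K) => kK; first exact: h.
apply: le_trans (hb _ kK) _; rewrite exprS [leRHS]mulrCA.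
by apply: ler_wpM2l IH.
Qed.

Lemma power_small (r B e : R) : 0 <= r < 1 -> 0 <= B -> 0 < e ->
  exists K, forall k, (K <= k)%N -> r ^+ k * B <= e.
Proof.
move=> /andP [r0 r1] B0 e0.
have : (fun n => r ^+ n) @ \oo --> (0 : R) by apply: cvg_expr; rewrite ger0_norm.
have d0 : 0 < e / (B + 1) by rewrite divr_gt0 //; lra.
move=> /cvgrPdist_le /(_ _ d0) [K _ hK]; exists K => k /hK /=.
rewrite sub0r normrN ger0_norm ?exprn_ge0 // => h.
apply: le_trans (_ : e / (B + 1) * (B + 1) <= _); last by rewrite divfK //; lra.
by apply: ler_pM => //; rewrite ?exprn_ge0 //; lra.
Qed.

(** The ratio r^k B of consecutive terms tends to 0. *)
Lemma superexponential (r B : R) : 0 <= r < 1 -> 0 <= B ->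
  exists2 D, 0 <= D & forall k, r ^+ 'C(k, 2) * B ^+ k <= D * (1/2) ^+ k.
Proof.
move=> r01 B0; have /andP [r0 r1] := r01.
have [|K hK] := @power_small r B (1/2) r01 B0; first by lra.
apply: (@geometric_decay _ K) => k; first by rewrite mulr_ge0 ?exprn_ge0.
move=> /hK h; rewrite binS bin1 exprD exprS.
rewrite (_ : _ * _ * _ = r ^+ k * B * (r ^+ 'C(k, 2) * B ^+ k)); last by ring.
by apply: ler_wpM2r h; rewrite mulr_ge0 ?exprn_ge0.
Qed.

Lemma bounded_sums_half D (b : nat -> R) :
  (forall k, b k <= D * (1/2) ^+ k) -> bounded_sums b.
Proof. by apply: bounded_sums_geo; lra. Qed.

End Growth.

Section IntegerIndexedSums.
Variables (R : realType) (V : comNzRingType) (N : ringNorm R V).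

Lemma has_sum_nat_fin (u : nat -> V) n :
  (forall k, (n <= k)%N -> u k = 0) -> has_sum N u (\sum_(k < n) u k).
Proof.
move=> h; apply/(@has_sum_inj _ _ N _ _ (@nat_of_ord n)); first exact: val_inj.
  by move=> k hk; apply: h; rewrite leqNgt; apply/negP => kn; have /eqP := hk (Ordinal kn).
exact: has_sum_fin.
Qed.

Lemma has_sum_centered (u : int -> V) M :
  (forall l, M%:Z + l < 0 -> u l = 0) -> (forall l, M%:Z < l -> u l = 0) ->
  has_sum N u (\sum_(k < (M + M).+1) u (k%:Z - M%:Z)).
Proof.
move=> h1 h2; apply/(@has_sum_inj _ _ N _ _ (fun k : 'I_(M + M).+1 => k%:Z - M%:Z)).
- by move=> j k jk; apply: val_inj => /=; move: jk; lia.
- move=> l hl; case: (ltrP (M%:Z + l) 0) => [/h1 //|Ml].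
  case: (ltrP M%:Z l) => [/h2 //|lM].
  have hk : (`|(M%:Z + l)%R| < (M + M).+1)%N by lia.
  by have /eqP := hl (Ordinal hk); case; rewrite /=; lia.
exact: has_sum_fin.
Qed.

Lemma cvg_infty (f : nat -> nat) : (forall n, exists M0, forall M, (M0 <= M)%N -> (n <= f M)%N) ->
  f @ \oo --> \oo.
Proof.
move=> h P [n _ hn]; have [M0 hM] := h n; exists M0 => // M /= /hM; exact: hn.
Qed.

End IntegerIndexedSums.

Section TendsInverse.
Variables (R : realType) (A : localAlg R) (T : Type) (G : set_system T).
Context {FG : ProperFilter G}.
Local Notation N := (la_norm A).

(** Near s the residue of u is bounded below, so the inverses stay bounded;
   then use u^-1 - s^-1 = u^-1 s^-1 (s - u). *)
Lemma tendsV (u : T -> A) s : s \is a GRing.unit -> tends N G u s ->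
  tends N G (fun t => (u t)^-1) s^-1.
Proof.
move=> us hu.
have c0 : 0 < normc (res A s).
  rewrite lt_neqAle normc_ge0 andbT eq_sym.
  by move: us; rewrite unit_res; apply: contraNneq => /eq0_normc ->.
have c2 : 0 < normc (res A s) / 2 by lra.
have [D D0 hD] := inv_bound A (N s + 1) c2.
have near1 : \forall t \near G, N (u t) <= N s + 1 /\ normc (res A s) / 2 <= normc (res A (u t)).
  have m0 : 0 < Num.min 1 (normc (res A s) / 2) by rewrite lt_min ltr01 c2.
  apply: filterS (hu _ m0) => t ht; move: (ht); rewrite le_min => /andP [h1 h2].
  split; first by have := rnD N (u t - s) s; rewrite subrK; lra.
  have := norm_res (u t - s); rewrite rmorphB /= -normcN opprB => h3.
  by have := normcB_ge (res A s) (res A s - res A (u t)); rewrite subKr; lra.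
move=> e e0; have k0 : 0 <= D * N s^-1 by rewrite mulr_ge0 ?rn_ge0.
have d0 : 0 < e / (D * N s^-1 + 1) by rewrite divr_gt0 //; lra.
apply: filterS2 near1 (hu _ d0) => t [h1 h2] h3.
have ut : u t \is a GRing.unit.
  rewrite unit_res; apply: contraTneq h2 => ->; have := normc0 R => ->.
  by rewrite -ltNge.
have -> : (u t)^-1 - s^-1 = (u t)^-1 * s^-1 * (s - u t).
  by rewrite mulrBr mulrVK // mulrAC mulVr // mul1r.
apply: le_trans (rnM _ _ _) _; rewrite (rn_dist N s).
apply: le_trans (_ : (D * N s^-1 + 1) * (e / (D * N s^-1 + 1)) <= _); last first.
  by rewrite mulrCA divff ?mulr1 // gt_eqF //; lra.
apply: ler_pM; rewrite ?rn_ge0 //; apply: le_trans (rnM _ _ _) _.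
apply: le_trans (_ : D * N s^-1 <= _); last by lra.
by apply: ler_wpM2r; rewrite ?rn_ge0 ?hD.
Qed.

End TendsInverse.

Section QPochhammer.
Variables (R : realType) (q : R[i]).
Hypotheses (q_gt0 : 0 < normc q) (q_lt1 : normc q < 1).
Local Notation C := R[i].
Local Notation CC := (complexAlg R).
Local Notation NC := (complexNorm R).
Local Notation r := (normc q).

Let r01 : 0 <= r < 1. Proof. by rewrite ltW. Qed.
Let r0 : 0 <= r. Proof. exact: ltW. Qed.

Lemma q_neq0 : q != 0.
Proof. by apply: contraTneq q_gt0 => ->; rewrite normc0 ltxx. Qed.

Lemma q_powers_small x : tends NC \oo (fun k => x * q ^+ k) 0.
Proof.
move=> e e0; have [K hK] := @power_small _ r (normc x) e r01 (normc_ge0 x) e0.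
exists K => // k /hK /= h.
by rewrite subr0 normcM normcX mulrC.
Qed.

Lemma norm_q_powers (A : localAlg R) k : la_norm A (emb A q ^+ k) = r ^+ k.
Proof. by rewrite -rmorphXn norm_emb normcX. Qed.

(** 1 + t <= exp t for each factor. *)
Lemma qpoch_norm_le (A : localAlg R) (x : A) B d : la_norm A x <= B ->
  la_norm A (qpoch x (emb A q) d) <= expR (B / (1 - r)).
Proof.
move=> xB; have B0 : 0 <= B by apply: le_trans xB; apply: rn_ge0.
apply: le_trans (_ : expR (B * \sum_(k < d) r ^+ k) <= _); last first.
  by rewrite ler_expR; apply: ler_wpM2l => //; apply: geometric_sum_le.
elim: d => [|d IH]; first by rewrite qpoch0 norm1 big_ord0 mulr0 expR0.
rewrite big_ord_recr /= mulrDr expRD qpochS; apply: le_trans (rnM _ _ _) _.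
apply: ler_pM => //; rewrite ?rn_ge0 //.
apply: le_trans (expR_ge1Dx _); apply: le_trans (rnD _ _ _) _.
rewrite norm1 rnN lerD2l; apply: le_trans (rnM _ _ _) _.
by rewrite norm_q_powers; apply: ler_wpM2r => //; apply: exprn_ge0.
Qed.

(** A product of factors 1 - t_k is at least 1 minus the sum of the t_k. *)
Lemma qpoch_lower_small (a : C) d : normc a / (1 - r) <= 1/2 ->
  1/2 <= normc (qpoch a q d).
Proof.
move=> ha; pose s d := normc a * \sum_(k < d) r ^+ k.
have hs d' : s d' <= 1/2.
  by apply: le_trans ha; apply: ler_wpM2l; rewrite ?normc_ge0 ?geometric_sum_le.
suff h : 1 - s d <= normc (qpoch a q d) by apply: le_trans h; have := hs d; lra.
elim: d => [|d IH].
  by rewrite qpoch0 /s big_ord0 mulr0 subr0; have := normc1 R => ->.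
rewrite qpochS normcM.
have h1 : 1 - normc a * r ^+ d <= normc (1 - a * q ^+ d).
  have := normcB_ge 1 (a * q ^+ d); rewrite normcM normcX.
  by have := normc1 R => ->.
have hsS : s d.+1 = s d + normc a * r ^+ d by rewrite /s big_ord_recr /= mulrDr.
have t0 : 0 <= normc a * r ^+ d by rewrite mulr_ge0 ?normc_ge0 ?exprn_ge0.
have s0 : 0 <= s d by rewrite mulr_ge0 ?normc_ge0 ?sumr_ge0 // => *; apply: exprn_ge0.
have := hs d.+1; rewrite hsS => h2.
apply: le_trans (_ : (1 - s d) * (1 - normc a * r ^+ d) <= _); first by nra.
by apply: ler_pM => //; lra.
Qed.

Lemma qpoch_neq0 (a : C) d : (forall k, a * q ^+ k != 1) -> qpoch a q d != 0.
Proof.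
move=> ha; rewrite /qpoch; apply/prodf_neq0 => k _.
by rewrite subr_eq0 eq_sym.
Qed.

(** The partial products stay away from 0: past some K the remaining product
   is at least 1/2 by [qpoch_lower_small], and the first K of them are
   finitely many nonzero numbers. *)
Lemma qpoch_lower (a : C) : (forall k, a * q ^+ k != 1) ->
  exists2 c, 0 < c & forall d, c <= normc (qpoch a q d).
Proof.
move=> ha.
have pos d : 0 < normc (qpoch a q d).
  rewrite lt_neqAle normc_ge0 andbT eq_sym.
  by apply: contraNneq (qpoch_neq0 d ha) => /eq0_normc ->.
have [||K hK] := @power_small _ r (normc a / (1 - r)) (1/2) r01.
- by apply: divr_ge0; [exact: normc_ge0|have := q_lt1; lra].
- by lra.
have tail d : 1/2 * normc (qpoch a q K) <= normc (qpoch a q (K + d)).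
  rewrite qpochD normcM mulrC; apply: ler_wpM2l; first exact: normc_ge0.
  apply: qpoch_lower_small; rewrite normcM normcX mulrAC mulrC.
  by apply: hK.
have [c c0 hc] : exists2 c, 0 < c & forall d, (d <= K)%N -> c <= normc (qpoch a q d).
  elim: (K) => [|k [c c0 IH]].
    by exists (normc (qpoch a q 0)) => // d; rewrite leqn0 => /eqP ->.
  exists (Num.min c (normc (qpoch a q k.+1))); first by rewrite lt_min c0 pos.
  move=> d; rewrite leq_eqVlt ltnS => /orP [/eqP ->|/IH h].
    by rewrite ge_min lexx orbT.
  by rewrite ge_min h.
exists (1/2 * c) => [|d]; first by lra.
case: (leqP d K) => [/hc h|/ltnW dK]; first by lra.
by rewrite -(subnKC dK); apply: le_trans (tail _); apply: ler_wpM2l; rewrite ?hc //; lra.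
Qed.

Lemma qk_neq1 k : q ^+ k.+1 != 1.
Proof.
apply: contraTneq (exprn_ilt1 k.+1 r0 q_lt1) => h.
by rewrite -normcX h; have := normc1 R => ->; rewrite ltxx.
Qed.

Lemma qq_no_zero k : q * q ^+ k != 1.
Proof. by rewrite -exprS qk_neq1. Qed.

Lemma qq_neq0 k : qpoch q q k != 0.
Proof. exact: qpoch_neq0 qq_no_zero. Qed.

(** The Gaussian binomial coefficient, defined by its quotient formula since q
   is not a root of unity. *)
Definition gauss (M k : nat) : C :=
  if (k <= M)%N then qpoch q q M / (qpoch q q k * qpoch q q (M - k)) else 0.

Lemma gauss_bound : exists2 B, 0 <= B & forall M k, normc (gauss M k) <= B.
Proof.
have [c c0 hc] := qpoch_lower qq_no_zero.
exists (expR (r / (1 - r)) * (c^-1 * c^-1)).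
  by rewrite !mulr_ge0 ?expR_ge0 ?invr_ge0 ?ltW.
move=> M k; rewrite /gauss; case: ifP => kM; last first.
  by rewrite normc0 !mulr_ge0 ?expR_ge0 ?invr_ge0 ?ltW.
rewrite normcM normcV normcM invfM.
have hinv d : (normc (qpoch q q d))^-1 <= c^-1.
  by rewrite lef_pV2 // posrE (lt_le_trans c0).
apply: ler_pM; rewrite ?mulr_ge0 ?invr_ge0 ?normc_ge0 //.
  by apply: (@qpoch_norm_le CC).
by apply: ler_pM; rewrite ?invr_ge0 ?normc_ge0.
Qed.

Lemma gauss_tends k : tends NC \oo (fun M => gauss M k) (qpoch q q k)^-1.
Proof.
have h : tends NC \oo (fun M => (qpoch q q k)^-1 * qpoch (q * q ^+ M) q k) ((qpoch q q k)^-1 * 1).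
  apply: tendsZ.
  have -> : (1 : C) = \prod_(l < k) (1 - 0 * q ^+ l).
    by rewrite big1 // => l _; rewrite mul0r subr0.
  apply: tends_prod => l.
  apply: (@tendsD _ _ _ _ _ _ (fun=> 1) (fun M => - (q * q ^+ M * q ^+ l))); first exact: tends_cst.
  have h0 : tends NC \oo (fun M => -1 * (q * q ^+ l * q ^+ M)) (-1 * 0).
    by apply: tendsZ; apply: q_powers_small.
  rewrite mulr0 in h0; rewrite mul0r oppr0; apply: tends_near_eq h0.
  by apply: nearW => M; ring.
rewrite mulr1 in h; move=> e /h [M0 _ hM]; exists (M0 + k)%N => // M /= hMk.
have kM : (k <= M)%N by lia.
have := hM (M - k)%N; rewrite /= /gauss kM.
have -> : qpoch q q M = qpoch q q (M - k) * qpoch (q * q ^+ (M - k)) q k.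
  by rewrite -qpochD subnK.
rewrite (_ : _ / _ = (qpoch q q k)^-1 * qpoch (q * q ^+ (M - k)) q k).
  by apply; lia.
by field; rewrite !qq_neq0.
Qed.

(** The q-Pascal rule, multiplied by q^k to avoid the exponent M - k. *)
Lemma gaussS M k : (k <= M)%N ->
  gauss M.+1 k.+1 * q ^+ k = gauss M k.+1 * q ^+ k + q ^+ M * gauss M k.
Proof.
move=> kM; rewrite /gauss ltnS kM subSS.
have n1 := qq_neq0 k; have n2 := qq_neq0 (M - k).
case: ltnP => kM'.
  have -> : (M - k = (M - k.+1).+1)%N by lia.
  have n3 := qq_neq0 (M - k.+1).
  rewrite !qpochS -!exprS; have n4 := qk_neq1 k; have n5 := qk_neq1 (M - k.+1).
  have -> : q ^+ M.+1 = q ^+ (M - k.+1).+1 * q ^+ k.+1 by rewrite -exprD; congr (_ ^+ _); lia.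
  have -> : q ^+ M = q ^+ (M - k.+1).+1 * q ^+ k by rewrite -exprD; congr (_ ^+ _); lia.
  have n6 : 1 - q * q ^+ k != 0 by rewrite subr_eq0 eq_sym -exprS.
  have n7 : 1 - q * q ^+ (M - k.+1) != 0 by rewrite subr_eq0 eq_sym -exprS.
  rewrite [q ^+ k.+1]exprS [q ^+ (M - k.+1).+1]exprS.
  by field; rewrite n1 n3 n6 n7.
have -> : k = M by lia.
rewrite subnn qpoch0 !mulr1 mul0r add0r !divff ?qq_neq0 //.
by rewrite mul1r mulr1.
Qed.

Lemma gauss0 M : gauss M 0 = 1.
Proof. by rewrite /gauss leq0n qpoch0 mul1r subn0 divff // qq_neq0. Qed.

Lemma gauss_large M k : (M < k)%N -> gauss M k = 0.
Proof. by move=> h; rewrite /gauss [(k <= M)%N]leqNgt h. Qed.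

Lemma q_binomial (A : localAlg R) (x : A) M :
  qpoch x (emb A q) M =
  \sum_(k < M.+1) emb A ((-1) ^+ k * q ^+ 'C(k, 2) * gauss M k) * x ^+ k.
Proof.
elim: M => [|M IH].
  by rewrite qpoch0 big_ord1 /= gauss0 !mul1r rmorph1 expr0 mulr1.
rewrite qpochS IH [RHS]big_ord_recl.
pose c k := emb A ((-1) ^+ k * q ^+ 'C(k, 2) * gauss M k) * x ^+ k.
have hS : \sum_(k < M.+1) c k = c 0%N + \sum_(k < M.+1) c k.+1.
  rewrite big_ord_recl [in RHS]big_ord_recr /= [c M.+1]/c gauss_large //.
  by rewrite mulr0 rmorph0 mul0r addr0.
rewrite -/(c _); transitivity (c 0%N + \sum_(k < M.+1) c k.+1 - (\sum_(k < M.+1) c k) * (x * emb A q ^+ M)).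
  by rewrite -hS mulrBr mulr1.
rewrite -addrA /= {1}/c !gauss0; congr (_ + _); rewrite mulr_suml -sumrB.
apply: eq_bigr => k _; rewrite /bump /= add1n /c -!rmorphXn.
have := gaussS (ltn_ord k : (k <= M)%N) => hg.
rewrite binS bin1 !exprD !exprS.
transitivity (emb A (- ((-1) ^+ k * q ^+ 'C(k, 2) * (gauss M k.+1 * q ^+ k + q ^+ M * gauss M k))) * (x * x ^+ k)).
  by ring.
by rewrite -hg; ring.
Qed.

(** * Infinite q-Pochhammer symbols *)

Local Notation "x .q" := (emb x q) (at level 2, format "x .q").
Let q0 := q_neq0.

(** The coefficients in Euler's expansion of (x;q)_oo in powers of x. *)
Definition euler_coef (k : nat) : C := (-1) ^+ k * q ^+ 'C(k, 2) / qpoch q q k.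

Lemma normc_sign k : normc ((-1) ^+ k : C) = 1.
Proof. by rewrite normcX normcN; have := normc1 R => ->; rewrite expr1n. Qed.

Lemma gauss_term_bound B : 0 <= B -> exists2 D, 0 <= D & forall M k,
  normc ((-1) ^+ k * q ^+ 'C(k, 2) * gauss M k) * B ^+ k <= D * (1/2) ^+ k.
Proof.
move=> B0; have [D D0 hD] := superexponential r01 B0.
have [b b0 hb] := gauss_bound.
exists (b * D) => [|M k]; first exact: mulr_ge0.
rewrite !normcM normc_sign mul1r normcX -[leRHS]mulrA.
rewrite [_ * normc (gauss _ _)]mulrC -mulrA.
by apply: ler_pM; rewrite ?normc_ge0 ?mulr_ge0 ?exprn_ge0.
Qed.

Lemma euler_coef_tends k : tends NC \oo (fun M => (-1) ^+ k * q ^+ 'C(k, 2) * gauss M k) (euler_coef k).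
Proof. apply: tendsZ; exact: gauss_tends. Qed.

Lemma euler_coef_bound B : 0 <= B -> exists2 D, 0 <= D & forall k,
  normc (euler_coef k) * B ^+ k <= D * (1/2) ^+ k.
Proof.
move=> B0; have [D D0 hD] := gauss_term_bound B0; exists D => // k.
have h : tends NC \oo (fun M => (-1) ^+ k * q ^+ 'C(k, 2) * gauss M k * (B%:C)%C ^+ k) (euler_coef k * (B%:C)%C ^+ k).
  by apply: tendsM; [exact: euler_coef_tends|exact: tends_cst].
have nB : normc ((B%:C)%C ^+ k) = B ^+ k.
  by rewrite normcX /= expr0n /= addr0 sqrtr_sqr ger0_norm.
rewrite -nB -normcM; apply: tends_norm_le h _.
by apply: nearW => M /=; rewrite normcM nB.
Qed.

Section InAlgebra.
Variable A : localAlg R.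
Local Notation N := (la_norm A).
Implicit Types x y : A.

Lemma euler_coef_sums x : bounded_sums (fun k => N (emb A (euler_coef k) * x ^+ k)).
Proof.
have [D D0 hD] := euler_coef_bound (rn_ge0 N x).
apply: (@bounded_sums_half _ D) => k; apply: le_trans (hD k).
apply: le_trans (norm_embM _ _) _.
by apply: ler_wpM2l; rewrite ?normc_ge0 ?normX.
Qed.

(** The q-binomial theorem passes to the limit term by term, because the
   Gaussian coefficients are uniformly bounded and q^(k(k-1)/2) beats any
   power. *)
Lemma euler_limit x s : has_sum N (fun k => emb A (euler_coef k) * x ^+ k) s ->
  tends N \oo (qpoch x A.q) s.
Proof.
move=> hs; have [D D0 hD] := gauss_term_bound (rn_ge0 N x).
pose u M k := emb A ((-1) ^+ k * q ^+ 'C(k, 2) * gauss M k) * x ^+ k.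
apply: (tannery (u := u) (b := fun k => D * (1/2) ^+ k) _ _ _ _ hs).
- move=> k; apply: tendsM; last exact: tends_cst.
  exact: tends_emb (euler_coef_tends k).
- exact: (@bounded_sums_half _ D).
- apply: nearW => M k; apply: le_trans (hD M k).
  apply: le_trans (norm_embM _ _) _.
  by apply: ler_wpM2l; rewrite ?normc_ge0 ?normX.
- apply: nearW => M; rewrite q_binomial //; apply: has_sum_nat_fin => k hk.
  by rewrite /u gauss_large // mulr0 rmorph0 mul0r.
Qed.

(** (x;q)_oo in A. *)
Definition qlim x : A := xget 0 [set s | tends N \oo (qpoch x A.q) s].

Lemma qlim_tends x : tends N \oo (qpoch x A.q) (qlim x).
Proof.
have [s /euler_limit hs] := rn_complete (euler_coef_sums x).
by apply: (@xgetPex _ 0 [set s | tends N \oo (qpoch x A.q) s]); exists s.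
Qed.

Lemma qlim_unique x s : tends N \oo (qpoch x A.q) s -> qlim x = s.
Proof. exact: tends_uniq (qlim_tends x). Qed.

Lemma euler x : has_sum N (fun k => emb A (euler_coef k) * x ^+ k) (qlim x).
Proof.
have [s hs] := rn_complete (euler_coef_sums x).
by rewrite (qlim_unique (euler_limit hs)).
Qed.

Lemma qlim_shift x d : qlim x = qpoch x A.q d * qlim (x * A.q ^+ d).
Proof.
apply: qlim_unique.
have h : tends N \oo (fun M => qpoch x A.q d * qpoch (x * A.q ^+ d) A.q M)
    (qpoch x A.q d * qlim (x * A.q ^+ d)).
  by apply: tendsZ; apply: qlim_tends.
move=> e /h [M0 _ hM]; exists (M0 + d)%N => // M /= hMd.
have -> : M = (d + (M - d))%N by lia.
by rewrite qpochD; apply: hM => /=; lia.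
Qed.

Lemma qlim_norm_le x B : N x <= B -> N (qlim x) <= expR (B / (1 - r)).
Proof.
move=> xB; apply: tends_norm_le (qlim_tends x) _.
by apply: nearW => d; apply: qpoch_norm_le.
Qed.

(** Apply dominated convergence to the Euler expansions: only the constant term
   survives. *)
Lemma qlim_tail x : tends N \oo (fun M => qlim (x * A.q ^+ M)) 1.
Proof.
have [D D0 hD] := euler_coef_bound (rn_ge0 N x).
have h : has_sum N (fun k => if k == 0%N then 1 else 0 : A) 1.
  have := @has_sum_nat_fin _ _ N (fun k => if k == 0%N then 1 else 0 : A) 1.
  by rewrite big_ord1 => h; apply: h => -[].
pose u M k := emb A (euler_coef k) * (x * A.q ^+ M) ^+ k.
apply: (tannery (u := u) (b := fun k => D * (1/2) ^+ k) _ _ _ _ h).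
- case=> [|k] /=.
    apply: (tends_near_eq _ (tends_cst N 1)); apply: nearW => M.
    by rewrite /u /euler_coef expr0 !mul1r ?bin0n ?expr0 ?mul1r qpoch0 invr1 rmorph1 mulr1.
  have h1 : tends N \oo (fun M => A.q ^+ M) 0.
    have h1 : tends N \oo (fun M => emb A (1 * q ^+ M)) (emb A 0).
      by apply: tends_emb; apply: q_powers_small.
    rewrite rmorph0 in h1; apply: tends_near_eq h1.
    by apply: nearW => M; rewrite mul1r rmorphXn.
  have h2 : tends N \oo (u^~ k.+1) (emb A (euler_coef k.+1) * (x * 0) ^+ k.+1).
    by apply: tendsZ; apply: tendsX; apply: tendsZ.
  by move: h2; rewrite mulr0 expr0n mulr0.
- exact: (@bounded_sums_half _ D).
- apply: nearW => M k; apply: le_trans (hD k).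
  apply: le_trans (norm_embM _ _) _; apply: ler_wpM2l; rewrite ?normc_ge0 //.
  apply: le_trans (normX _ _) _; apply: lerXn2r; rewrite ?nnegrE ?rn_ge0 //.
  apply: le_trans (rnM _ _ _) _; rewrite norm_q_powers.
  by rewrite ler_piMr ?rn_ge0 // exprn_ile1 // ltW.
- by apply: nearW => M; apply: euler.
Qed.

End InAlgebra.

(** * Theta coefficients and the triple product *)

(** (-1)^l q^(l(l-1)/2), the coefficients of theta_q(-Q).  The two branches
   keep a natural number in the exponent of q. *)
Definition theta_coef (l : int) : C :=
  match l with
  | Posz k => (-1) ^+ k * q ^+ 'C(k, 2)
  | Negz k => (-1) ^+ k.+1 * q ^+ 'C(k.+2, 2)
  end.

Lemma theta_coef0 : theta_coef 0 = 1.
Proof. by rewrite /= bin0n expr0 mulr1. Qed.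

Lemma theta_coef_opp k : theta_coef (- k%:Z) = (-1) ^+ k * q ^+ 'C(k.+1, 2).
Proof. by case: k => [|k]; rewrite ?NegzE //= binn expr0. Qed.

Lemma theta_coefS l : theta_coef (l + 1) = - q ^ l * theta_coef l.
Proof.
case: l => k.
  rewrite -PoszD addn1 /= binS bin1 exprD exprS -exprnP; ring.
rewrite NegzE; case: k => [|k].
  rewrite addrC subrr theta_coef0 /= binn !expr1 exprN1.
  by field.
have -> : - k.+2%:Z + 1 = - k.+1%:Z by lia.
rewrite !theta_coef_opp [in RHS]binS bin1 exprD [(-1) ^+ k.+2]exprS -exprnN.
by field; rewrite expf_neq0.
Qed.

Lemma theta_coef_pred l : theta_coef (l - 1) = - q ^ (1 - l) * theta_coef l.
Proof.
rewrite -{3}[l](subrK 1) theta_coefS mulrA mulrNN -expfzDr ?q0 //.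
rewrite (_ : 1 - l + (l - 1) = 0); last by lia.
by rewrite expr0z mul1r.
Qed.

Lemma theta_coefD a b : theta_coef (a + b) = theta_coef a * theta_coef b * q ^ (a * b).
Proof.
elim/int_rect: b => [|k IH|k IH].
- by rewrite addr0 mulr0 theta_coef0 expr0z !mulr1.
- rewrite (_ : k.+1%:Z = k%:Z + 1); last by lia.
  rewrite addrA !theta_coefS IH mulrDr mulr1 !expfzDr //; ring.
- rewrite (_ : - k.+1%:Z = - k%:Z - 1); last by lia.
  rewrite addrA !theta_coef_pred IH mulrBr mulr1 [q ^ (_ - a)]expfzDr //.
  rewrite (_ : 1 - (a - k%:Z) = (1 - - k%:Z) + - a); last by lia.
  by rewrite [q ^ (_ + - a)]expfzDr //; ring.
Qed.

Lemma theta_coef_flip l : theta_coef (1 - l) = - theta_coef l.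
Proof.
case: l => [[|[|k]]|k].
- by rewrite subr0 /= bin0n expr0 mulN1r mulr1.
- by rewrite subrr /= !bin0n !expr0 !expr1 !mulr1 opprK.
- rewrite (_ : 1 - k.+2%:Z = - k.+1%:Z); last by lia.
  by rewrite theta_coef_opp /= [in RHS]exprS mulN1r mulNr opprK.
- rewrite NegzE opprK (_ : 1 + k.+1%:Z = k.+2%:Z) //.
  by rewrite theta_coef_opp /= exprS mulN1r mulNr.
Qed.

Lemma norm_theta_coef_nat (k : nat) : normc (theta_coef k) = r ^+ 'C(k, 2).
Proof. by rewrite /= normcM normc_sign mul1r normcX. Qed.

Lemma norm_theta_coef_opp (k : nat) : normc (theta_coef (- k%:Z)) = r ^+ 'C(k.+1, 2).
Proof. by rewrite theta_coef_opp normcM normc_sign mul1r normcX. Qed.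

Lemma theta_coef_sums B : 0 <= B -> bounded_sums (fun l : int => normc (theta_coef l) * B ^+ `|l|%N).
Proof.
move=> B0; have [D D0 hD] := superexponential r01 B0.
apply: bounded_sums_int => [l||].
- by rewrite mulr_ge0 ?normc_ge0 ?exprn_ge0.
- by apply: (@bounded_sums_half _ D) => k; rewrite norm_theta_coef_nat.
apply: (@bounded_sums_half _ D) => k; apply: le_trans (hD k).
rewrite norm_theta_coef_opp abszN; apply: ler_wpM2r; first exact: exprn_ge0.
by rewrite ler_wiXn2l // ?ltW // binS bin1 leq_addr.
Qed.

Lemma normc_exprz (x : C) (z : int) : normc (x ^ z) = normc x ^ z.
Proof. by case: z => k; rewrite ?NegzE -?exprnP ?exprnN ?normcV normcX. Qed.

Lemma norm_q_exprz (z : int) : normc (q ^ z) <= r^-1 ^+ `|z|%N.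
Proof.
have r1 : 1 <= r^-1 by rewrite invr_ge1 ?inE ?unitfE ?gt_eqF ?ltW.
rewrite normc_exprz; case: z => k.
  apply: le_trans (_ : 1 <= _); first by apply: exprn_ile1 => //; apply: ltW.
  exact: exprn_ege1.
by rewrite NegzE -exprnN exprVn.
Qed.

Lemma theta_coef_shift_sums n0 B : 0 <= B ->
  bounded_sums (fun l : int => normc (theta_coef (n0 + l)) * B ^+ `|l|%N).
Proof.
move=> B0; have rV : 0 <= r^-1 ^+ `|n0|%N by rewrite exprn_ge0 ?invr_ge0.
have h := theta_coef_sums (mulr_ge0 rV B0).
apply: bounded_sums_le (bounded_sumsZ (normc_ge0 (theta_coef n0)) h) => l.
rewrite theta_coefD !normcM exprMn -exprM -!mulrA; do 2!(apply: ler_wpM2l; first exact: normc_ge0).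
apply: ler_wpM2r; first exact: exprn_ge0.
by apply: le_trans (norm_q_exprz _) _; rewrite abszM.
Qed.

Section InAlgebra.
Variable A : localAlg R.
Local Notation N := (la_norm A).
Implicit Types x y : A.

Lemma qA_unit : A.q \is a GRing.unit.
Proof. by rewrite unit_res embK. Qed.

Lemma emb_exprz (z : int) : emb A (q ^ z) = A.q ^ z.
Proof. by case: z => k; rewrite ?NegzE -?exprnP -?exprnN ?fmorphV ?rmorphXn //. Qed.

Lemma emb_qlim (a : C) : emb A (qlim (a : CC)) = qlim (emb A a).
Proof.
apply/esym/qlim_unique => //.
have h : tends N \oo (fun d => emb A (qpoch a q d)) (emb A (qlim (a : CC))).
  by apply: tends_emb; apply: (@qlim_tends CC).
by apply: (tends_near_eq _ h); apply: nearW => d; rewrite rmorph_qpoch.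
Qed.

Lemma res_qlim x : res A (qlim x) = qlim (res A x : CC).
Proof.
apply/esym/(@qlim_unique CC) => //.
have h : tends NC \oo (fun d => res A (qpoch x A.q d)) (res A (qlim x)).
  by apply: tends_res; apply: qlim_tends.
by apply: (tends_near_eq _ h); apply: nearW => d; rewrite rmorph_qpoch /= embK.
Qed.

(** The residue is a limit of numbers bounded away from 0. *)
Lemma qlim_unit x : (forall k, res A x * q ^+ k != 1) -> qlim x \is a GRing.unit.
Proof.
move=> hx; rewrite unit_res res_qlim.
have [c c0 hc] := qpoch_lower hx.
apply: contraTneq c0 => h; rewrite -leNgt; apply/ler_addgt0Pr => e e0.
have := @qlim_tends CC (res A x) e e0; rewrite h => -[M _ /(_ M (leqnn M)) /=].
by rewrite subr0 add0r; apply: le_trans.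
Qed.

Lemma norm_exprz_le x B (z : int) : x \is a GRing.unit -> N x <= B -> N x^-1 <= B ->
  N (x ^ z) <= B ^+ `|z|%N.
Proof.
move=> ux h1 h2; have B0 : 0 <= B by apply: le_trans h1; apply: rn_ge0.
case: z => k.
  by apply: le_trans (normX _ _) _; apply: lerXn2r; rewrite ?nnegrE ?rn_ge0.
rewrite NegzE -exprnN -exprVn abszN.
by apply: le_trans (normX _ _) _; apply: lerXn2r; rewrite ?nnegrE ?rn_ge0.
Qed.

Lemma theta_coef_power_sums y : y \is a GRing.unit ->
  bounded_sums (fun l : int => N (emb A (theta_coef l) * y ^ l)).
Proof.
move=> uy; have B0 : 0 <= N y + N y^-1 by rewrite addr_ge0 ?rn_ge0.
apply: bounded_sums_le (theta_coef_sums B0) => l.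
apply: le_trans (norm_embM _ _) _; apply: ler_wpM2l; first exact: normc_ge0.
by apply: norm_exprz_le; rewrite ?lerDl ?lerDr ?rn_ge0.
Qed.

(** Each of the M factors 1 - y q^(-k) is turned into -y q^(-k) (1 - q^k / y). *)
Lemma qpoch_flip y M : y \is a GRing.unit ->
  qpoch (y * A.q ^- M) A.q M =
  emb A ((-1) ^+ M * q ^- 'C(M.+1, 2)) * y ^+ M * qpoch (A.q / y) A.q M.
Proof.
move=> uy; have uq := qA_unit; elim: M => [|M IH].
  by rewrite !qpoch0 (_ : 'C(1, 2) = 0%N) // !expr0 invr1 !mulr1 rmorph1.
rewrite qpochSl.
have -> : y * A.q ^- M.+1 * A.q = y * A.q ^- M.
  by rewrite exprS invrM ?unitrX // -!mulrA mulVr ?mulr1.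
rewrite IH qpochS.
have -> : 1 - y * A.q ^- M.+1 = emb A (- q ^- M.+1) * y * (1 - A.q / y * A.q ^+ M).
  have h : A.q ^- M.+1 * y * (A.q / y * A.q ^+ M) = 1.
    rewrite (_ : _ * _ = A.q ^- M.+1 * A.q ^+ M.+1 * (y / y)); last by rewrite exprS; ring.
    by rewrite mulVr ?unitrX // divrr // mulr1.
  rewrite rmorphN fmorphV rmorphXn /= mulrBr mulr1 mulNr [- _ * (_ / _ * _)]mulNr h.
  by rewrite opprK addrC mulrC.
have -> : emb A ((-1) ^+ M.+1 * q ^- 'C(M.+2, 2)) =
   emb A (- q ^- M.+1) * emb A ((-1) ^+ M * q ^- 'C(M.+1, 2)).
  by rewrite -rmorphM binS bin1 exprD invfM [(-1) ^+ M.+1]exprS; congr (emb A _); ring.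
by rewrite [y ^+ M.+1]exprS; ring.
Qed.

End InAlgebra.

Local Notation qq := (qlim (q : CC)).

(** The Gaussian coefficient of 2M at M + l; both M + l and M - l go to
   infinity, so the limit in M does not depend on l. *)
Definition central_gauss M (l : int) : C :=
  if 0 <= M%:Z + l then gauss (M + M) `|(M%:Z + l)%R|%N else 0.

Lemma qq_unit : qq != 0.
Proof.
by rewrite -unitfE; apply: (@qlim_unit CC) => // k; exact: qq_no_zero.
Qed.

Lemma qpoch_subseq_tends (a : C) (f : nat -> nat) : f @ \oo --> \oo ->
  tends NC \oo (fun M => qpoch a q (f M)) (qlim (a : CC)).
Proof. by move=> hf; apply: tends_comp hf _; apply: (@qlim_tends CC). Qed.

Lemma central_qpoch_tends l : tends NC \oo (fun M =>
  (qpoch q q `|(M%:Z + l)%R|%N)^-1 * (qpoch q q `|(M%:Z - l)%R|%N)^-1) (qq^-1 * qq^-1).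
Proof.
apply: tendsM; apply: (@tendsV _ CC); rewrite ?unitfE ?qq_unit //;
  by apply: qpoch_subseq_tends; apply: cvg_infty => n; exists (n + `|l|)%N => M; lia.
Qed.

Lemma central_gauss_tends l : tends NC \oo (central_gauss^~ l) qq^-1.
Proof.
have h0 : tends NC \oo (fun M => qpoch q q (M + M)) qq.
  by apply: qpoch_subseq_tends; apply: cvg_infty => n; exists n => M; lia.
have h : tends NC \oo (fun M => qpoch q q (M + M) * ((qpoch q q `|(M%:Z + l)%R|%N)^-1 *
    (qpoch q q `|(M%:Z - l)%R|%N)^-1)) (qq * (qq^-1 * qq^-1)).
  exact: tendsM h0 (central_qpoch_tends l).
rewrite mulrA divff ?qq_unit // mul1r in h; apply: (tends_near_eq _ h).
exists `|l|%N => // M /= hM; rewrite /central_gauss /gauss ifT; last by lia.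
rewrite ifT; last by lia.
rewrite (_ : (M + M - `|(M%:Z + l)%R|)%N = `|(M%:Z - l)%R|%N); last by lia.
by rewrite invfM.
Qed.

Lemma central_gauss_bound : exists2 B, 0 <= B & forall M l, normc (central_gauss M l) <= B.
Proof.
have [B B0 hB] := gauss_bound; exists B => // M l.
by rewrite /central_gauss; case: ifP => // _; rewrite normc0.
Qed.

Variable A : localAlg R.
Local Notation N := (la_norm A).
Implicit Types x y : A.

(** The q-binomial theorem for (y q^(-M))_(2M), whose first half is turned into
   (q/y)_M by [qpoch_flip]. *)
Lemma finite_triple_product y M : y \is a GRing.unit ->
  has_sum N (fun l => emb A (theta_coef l * central_gauss M l) * y ^ l)
    (qpoch y A.q M * qpoch (A.q / y) A.q M).
Proof.
move=> uy; have uq : A.q \is a GRing.unit by exact: qA_unit.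
have -> : qpoch y A.q M * qpoch (A.q / y) A.q M =
    \sum_(k < (M + M).+1) emb A (theta_coef (k%:Z - M%:Z) * central_gauss M (k%:Z - M%:Z)) * y ^ (k%:Z - M%:Z).
  have := q_binomial (y * A.q ^- M) (M + M).
  rewrite qpochD qpoch_flip // divrK ?unitrX // => h.
  transitivity (emb A (theta_coef (- M%:Z)) * y ^- M *
    (emb A ((-1) ^+ M / q ^+ 'C(M.+1, 2)) * y ^+ M * qpoch (A.q / y) A.q M * qpoch y A.q M)).
    rewrite (_ : emb A (theta_coef (- M%:Z)) * y ^- M * _ =
      emb A (theta_coef (- M%:Z) * ((-1) ^+ M / q ^+ 'C(M.+1, 2))) * (y ^- M * y ^+ M) *
      (qpoch y A.q M * qpoch (A.q / y) A.q M)); last by rewrite rmorphM; ring.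
    rewrite (_ : theta_coef (- M%:Z) * _ = 1); first by rewrite mulVr ?unitrX // rmorph1 !mul1r.
    by rewrite theta_coef_opp mulrACA -expr2 sqrr_sign mul1r divff // expf_neq0.
  rewrite h mulr_sumr; apply: eq_bigr => k _.
  rewrite theta_coefD // /central_gauss ifT; last by lia.
  rewrite (_ : `|(M%:Z + (k%:Z - M%:Z))%R|%N = k); last by lia.
  have -> : q ^ (k%:Z * - M%:Z) = q ^- (k * M) by rewrite mulrN -PoszM exprnN.
  rewrite exprzDr // -exprnP -exprnN exprMn.
  have -> : A.q ^- M ^+ k = emb A (q ^- (k * M)) by rewrite -exprVn -exprM -fmorphV -rmorphXn exprVn mulnC.
  by rewrite !rmorphM; ring.
apply: (@has_sum_centered _ _ N (fun l => emb A (theta_coef l * central_gauss M l) * y ^ l)) => l hl.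
  by rewrite /central_gauss leNgt hl mulr0 rmorph0 mul0r.
rewrite /central_gauss; case: ifP => // h; last by rewrite mulr0 rmorph0 mul0r.
by rewrite gauss_large ?mulr0 ?rmorph0 ?mul0r //; lia.
Qed.

(** Limit of [finite_triple_product] by dominated convergence. *)
Lemma jacobi_triple_product y : y \is a GRing.unit ->
  has_sum N (fun l => emb A (theta_coef l) * y ^ l) (qlim A.q * qlim y * qlim (A.q / y)).
Proof.
move=> uy; have [s hs] := rn_complete (theta_coef_power_sums uy).
suff : emb A qq^-1 * s = qlim y * qlim (A.q / y).
  move=> h; rewrite -mulrA -h mulrA -emb_qlim // -rmorphM divff ?qq_unit //.
  by rewrite rmorph1 mul1r.
have [B B0 hB] := central_gauss_bound.
have hb := bounded_sumsZ B0 (theta_coef_power_sums uy).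
apply: (@tends_uniq _ _ N _ \oo _ (fun M => qpoch y A.q M * qpoch (A.q / y) A.q M)); last first.
  by apply: tendsM; apply: qlim_tends.
apply: (tannery (u := fun M l => emb A (theta_coef l * central_gauss M l) * y ^ l) _ hb _ _ (has_sumZ (emb A qq^-1) hs)).
- move=> l; rewrite mulrA -rmorphM mulrC [qq^-1 * _]mulrC.
  have h : tends N \oo (fun M => y ^ l * emb A (theta_coef l * central_gauss M l)) (y ^ l * emb A (theta_coef l * qq^-1)).
    by apply: tendsZ; apply: tends_emb; apply: tendsZ; exact: central_gauss_tends.
  by apply: (tends_near_eq _ h); apply: nearW => M; rewrite mulrC.
- apply: nearW => M l; rewrite rmorphM mulrAC mulrC.
  by apply: le_trans (norm_embM _ _) _; apply: ler_wpM2r; rewrite ?rn_ge0.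
- by apply: nearW => M; apply: finite_triple_product.
Qed.


(** * Infinite products with one factor removed *)

Let uq : A.q \is a GRing.unit. Proof. exact: qA_unit. Qed.

(** (x;q)_D for every integer D, formally (x;q)_oo / (x q^D;q)_oo. *)
Definition qpochz x (D : int) : A :=
  match D with
  | Posz d => qpoch x A.q d
  | Negz d => (\prod_(s < d.+1) (1 - x * A.q ^- s.+1))^-1
  end.

(** (x;q)_D has no zero in its denominator for D < 0. *)
Definition nopole x := forall s : nat, res A x != q ^+ s.+1.

Lemma nopole_factor_unit x s : nopole x -> 1 - x * A.q ^- s.+1 \is a GRing.unit.
Proof.
move=> hx; rewrite unit_res rmorphB rmorph1 rmorphM rmorphV ?unitrX // rmorphXn /= embK.
rewrite subr_eq0 eq_sym; apply: contra (hx s) => /eqP h.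
by rewrite -[res A x](mulfVK (expf_neq0 s.+1 q0)) h mul1r.
Qed.

Lemma qpochzS x D : nopole x -> qpochz x (D + 1) = qpochz x D * (1 - x * A.q ^ D).
Proof.
move=> hx; case: D => d; first by rewrite -PoszD addn1 /= qpochS -exprnP.
rewrite NegzE -exprnN; case: d => [|d].
  rewrite addrC subrr /= qpoch0 big_ord1 mulVr //; exact: nopole_factor_unit.
have -> : - d.+2%:Z + 1 = Negz d by rewrite NegzE; lia.
rewrite -NegzE /= [in RHS]big_ord_recr /= invrM.
- by rewrite mulrAC mulVr ?mul1r //; apply: nopole_factor_unit.
- by apply: (big_rec (fun z => z \is a GRing.unit)) => [|i z _ uz]; rewrite ?unitr1 // unitrM uz nopole_factor_unit.
- exact: nopole_factor_unit.
Qed.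

Lemma qlimS x : qlim x = (1 - x) * qlim (x * A.q).
Proof. by rewrite (qlim_shift x 1) qpochS qpoch0 mul1r expr0 mulr1 expr1. Qed.

Lemma qA_expzS (D : int) : A.q ^ (D + 1) = A.q ^ D * A.q.
Proof. by rewrite exprzDr // expr1z. Qed.

Lemma qpochz_qlim x D : nopole x -> qpochz x D * qlim (x * A.q ^ D) = qlim x.
Proof.
move=> hx.
have step E : qpochz x (E + 1) * qlim (x * A.q ^ (E + 1)) = qpochz x E * qlim (x * A.q ^ E).
  by rewrite qpochzS // [in RHS]qlimS qA_expzS mulrA -mulrA.
elim/int_rect: D => [|k IH|k IH].
- by rewrite /= qpoch0 expr0z mulr1 mul1r.
- by rewrite (_ : k.+1%:Z = k%:Z + 1) ?step ?IH //; lia.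
- by rewrite -IH -step (_ : - k.+1%:Z + 1 = - k%:Z) //; lia.
Qed.

Lemma qpochz_add x D k : nopole x ->
  qpochz x D * qpoch (x * A.q ^ D) A.q k = qpochz x (D + k%:Z).
Proof.
move=> hx; elim: k => [|k IH]; first by rewrite qpoch0 addr0 mulr1.
rewrite qpochS mulrA IH -mulrA exprnP -exprzDr // -qpochzS //; congr qpochz; lia.
Qed.

(** (x;q)_oo with its factor 1 - x q^D removed if D >= 0, and
   (x;q)_oo / (1 - x q^D) if D < 0.  As a function of D these are the simple
   fractions of the partial-fraction expansion.  The definition avoids a
   division, since 1 - x q^D may fail to be invertible for D >= 0. *)
Definition punctured x (D : int) : A := qpochz x D * qlim (x * A.q ^ (D + 1)).

Lemma punctured_factor x D : nopole x -> punctured x D * (1 - x * A.q ^ D) = qlim x.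
Proof.
by move=> hx; rewrite -(qpochz_qlim D hx) [in RHS]qlimS /punctured qA_expzS mulrA mulrAC -mulrA.
Qed.

(** A finite range of factors without its k-th one, completed by the factors
   before and after the range. *)
Lemma punctured_omit x D L k : nopole x -> (k < L)%N ->
  qpochz x D * (\prod_(l < L | val l != k) (1 - x * A.q ^ (D + l%:Z))) *
    qlim (x * A.q ^ (D + L%:Z)) = punctured x (D + k%:Z).
Proof.
move=> hx kL; rewrite (prod_ord_neq (fun l => 1 - x * A.q ^ (D + l%:Z)) kL).
have -> : \prod_(l < k) (1 - x * A.q ^ (D + l%:Z)) = qpoch (x * A.q ^ D) A.q k.
  by apply: eq_bigr => l _; rewrite exprzDr // mulrA.
have -> : \prod_(l < L - k.+1) (1 - x * A.q ^ (D + (k.+1 + l)%N%:Z)) =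
    qpoch (x * A.q ^ (D + k%:Z + 1)) A.q (L - k.+1).
  apply: eq_bigr => l _; rewrite -mulrA exprnP -exprzDr //.
  by congr (1 - x * A.q ^ _); lia.
rewrite mulrA qpochz_add // /punctured -mulrA; congr (_ * _).
rewrite [RHS](qlim_shift _ (L - k.+1)); congr (_ * qlim _).
by rewrite -mulrA exprnP -exprzDr //; congr (x * A.q ^ _); lia.
Qed.

(** A factor is the quotient of two partial products, which are bounded from
   both sides. *)
Lemma factor_lower (a : C) : (forall k, a * q ^+ k != 1) ->
  exists2 c, 0 < c & forall s, c <= normc (1 - a * q ^+ s).
Proof.
move=> ha; have [c c0 hc] := qpoch_lower ha.
pose E := expR (normc a / (1 - r)); have E0 : 0 < E by apply: expR_gt0.
exists (c / E) => [|s]; first exact: divr_gt0.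
rewrite ler_pdivrMr //; apply: le_trans (hc s.+1) _; rewrite qpochS normcM mulrC.
apply: ler_wpM2l; first exact: normc_ge0.
by apply: (@qpoch_norm_le CC).
Qed.

(** 1 - x q^(-s) = - x q^(-s) (1 - q^s / x), where the last factor has a
   uniformly bounded inverse. *)
Lemma pole_factor_bound x : x \is a GRing.unit -> nopole x ->
  exists2 B, 0 <= B & forall s, N (1 - x * A.q ^- s.+1)^-1 <= B * r ^+ s.+1.
Proof.
move=> ux hx; have rx : res A x != 0 by rewrite -unit_res.
have [c c0 hc] : exists2 c, 0 < c & forall s, c <= normc (1 - (res A x)^-1 * q * q ^+ s).
  apply: factor_lower => k; rewrite -mulrA -exprS.
  apply: contra (hx k) => /eqP h; apply/eqP.
  by rewrite -[RHS](mulVKf rx) h mulr1.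
have [B B0 hB] := inv_bound A (1 + N x^-1) c0.
exists (B * N x^-1) => [|s]; first by rewrite mulr_ge0 ?rn_ge0.
have h : 1 - x * A.q ^- s.+1 = - (x * A.q ^- s.+1) * (1 - x^-1 * A.q ^+ s.+1).
  rewrite mulrBr mulr1 mulNr (_ : x * A.q ^- s.+1 * (x^-1 * A.q ^+ s.+1) = 1).
    by rewrite opprK addrC.
  by rewrite mulrACA divrr // mulVr ?unitrX // mulr1.
have u1 : 1 - x^-1 * A.q ^+ s.+1 \is a GRing.unit.
  rewrite unit_res rmorphB rmorph1 rmorphM rmorphV // rmorphXn /= embK.
  have := hc s; rewrite -mulrA -exprS; apply: contraTneq => ->.
  by have := normc0 R => ->; rewrite -ltNge.
have -> : (1 - x * A.q ^- s.+1)^-1 = (1 - x^-1 * A.q ^+ s.+1)^-1 * (- (x^-1 * A.q ^+ s.+1)).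
  rewrite h invrM //; last by rewrite unitrN unitrM ux unitrV unitrX.
  by rewrite invrN invrM ?unitrV ?unitrX // invrK [A.q ^+ _ * _]mulrC.
apply: le_trans (rnM _ _ _) _; rewrite rnN -mulrA; apply: ler_pM; rewrite ?rn_ge0 //.
  apply: hB.
    apply: le_trans (rnD _ _ _) _; rewrite norm1 rnN lerD2l.
    apply: le_trans (rnM _ _ _) _; rewrite norm_q_powers.
    by rewrite ler_piMr ?rn_ge0 // exprn_ile1 // ltW.
  by rewrite rmorphB rmorph1 rmorphM rmorphV // rmorphXn /= embK exprS mulrA.
by apply: le_trans (rnM _ _ _) _; rewrite norm_q_powers.
Qed.

Lemma punctured_bound x : x \is a GRing.unit -> nopole x ->
  exists2 B, 0 <= B & forall D, N (punctured x D) <= B.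
Proof.
move=> ux hx; have [B B0 hB] := pole_factor_bound ux hx.
pose E := expR (N x / (1 - r)); have E0 : 0 <= E by apply: expR_ge0.
exists (E * E + E * B) => [|D]; first by rewrite addr_ge0 ?mulr_ge0.
case: D => d.
  apply: le_trans (_ : E * E <= _); last by rewrite lerDl mulr_ge0.
  apply: le_trans (rnM _ _ _) _; apply: ler_pM; rewrite ?rn_ge0 //.
    exact: qpoch_norm_le.
  apply: qlim_norm_le => //; rewrite -PoszD -exprnP.
  apply: le_trans (rnM _ _ _) _; rewrite norm_q_powers.
  by rewrite ler_piMr ?rn_ge0 // exprn_ile1 // ltW.
apply: le_trans (_ : E * B <= _); last by rewrite lerDr mulr_ge0.
have u1 := nopole_factor_unit d hx.
have -> : punctured x (Negz d) = qlim x * (1 - x * A.q ^- d.+1)^-1.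
  by rewrite -(punctured_factor (Negz d) hx) NegzE -exprnN mulrK.
apply: le_trans (rnM _ _ _) _; apply: ler_pM; rewrite ?rn_ge0 //.
  exact: qlim_norm_le.
by apply: le_trans (hB d) _; rewrite ler_piMr // exprn_ile1 // ltW.
Qed.

(** * Summing a simple fraction against theta coefficients *)

Lemma bijective_subz (a : int) : bijective (fun l : int => a - l).
Proof. by exists (fun l => a - l) => l; rewrite subKr. Qed.

(** theta vanishes at 1: the reflection l |-> 1 - l changes the sign of every
   term. *)
Lemma sum_theta_coef : has_sum N (fun l => emb A (theta_coef l)) 0.
Proof.
have hb : bounded_sums (fun l => N (emb A (theta_coef l))).
  apply: bounded_sums_le (theta_coef_sums ler01) => l.
  by rewrite norm_emb expr1n mulr1.
have [s hs] := rn_complete hb.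
suff -> : 0 = s by [].
have h : has_sum N (fun l => -1 * emb A (theta_coef l)) s.
  apply: eq_has_sum (has_sum_reindex (bijective_subz 1) hs) => l.
  by rewrite /= theta_coef_flip // rmorphN mulN1r.
have := has_sum_uniq h (has_sumZ (-1) hs); rewrite mulN1r => /eqP.
rewrite -subr_eq0 opprK -mulr2n => /eqP h2.
have -> : s = emb A (2%:R^-1) * (s *+ 2).
  rewrite -[s *+ 2]mulr_natl -(rmorph_nat (emb A)) mulrA -rmorphM mulVf ?rmorph1 ?mul1r //.
by rewrite h2 mulr0.
Qed.

Lemma kernel_sums x n0 : x \is a GRing.unit -> nopole x ->
  bounded_sums (fun D => N (emb A (theta_coef (n0 - D)) * punctured x D)).
Proof.
move=> ux hx; have [B B0 hB] := punctured_bound ux hx.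
have h : bounded_sums (fun D => normc (theta_coef (n0 - D))).
  have := bounded_sums_inj (f := fun D : int => - D) oppr_inj (theta_coef_shift_sums n0 ler01).
  by apply: bounded_sums_le => D /=; rewrite expr1n mulr1.
apply: bounded_sums_le (bounded_sumsZ B0 h) => D.
apply: le_trans (norm_embM _ _) _; rewrite mulrC.
by apply: ler_wpM2r; rewrite ?normc_ge0.
Qed.

(** Combine theta_(l+1) = - q^l theta_l with
   punctured(D) (1 - x q^D) = (x)_oo: the difference of the two sums is a
   multiple of the sum of all the theta coefficients, which is zero. *)
Lemma kernel_step x n0 g h : x \is a GRing.unit -> nopole x ->
  has_sum N (fun D => emb A (theta_coef (n0 + 1 - D)) * punctured x D) g ->
  has_sum N (fun D => emb A (theta_coef (n0 - D)) * punctured x D) h ->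
  g = emb A (- q ^ n0) * x * h.
Proof.
move=> ux hx hg hh; apply/eqP; rewrite -subr_eq0; apply/eqP.
have h1 := has_sumD hg (has_sumZ (- (emb A (- q ^ n0) * x)) hh).
rewrite mulNr in h1; apply: has_sum_uniq h1 _.
have h2 := has_sumZ (qlim x) (has_sum_reindex (bijective_subz (n0 + 1)) sum_theta_coef).
rewrite mulr0 in h2; apply: eq_has_sum h2 => D.
rewrite -(punctured_factor D hx).
rewrite (_ : n0 + 1 - D = n0 - D + 1); last by lia.
rewrite theta_coefS // -emb_exprz; rewrite [q ^ (n0 - D)]expfzDr //.
have e : q ^ (- D) * q ^ D = 1 by rewrite -expfzDr // addrC subrr expr0z.
rewrite (_ : - (q ^ n0 * q ^ (- D)) * _ = - q ^ n0 * (q ^ (- D) * theta_coef (n0 - D))); last by ring.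
rewrite !rmorphM.
have e' : emb A (q ^ (- D)) * emb A (q ^ D) = 1 by rewrite -rmorphM e rmorph1.
rewrite mulrBr mulr1 mulrBl.
rewrite [X in _ - X](_ : _ = emb A (- q ^ n0) * emb A (theta_coef (n0 - D)) * x * punctured x D *
  (emb A (q ^ (- D)) * emb A (q ^ D))); last by ring.
by rewrite e'; ring.
Qed.

(** The recursion [kernel_step] in both directions determines the sums from the
   one at 0. *)
Lemma kernel_all x g0 : x \is a GRing.unit -> nopole x ->
  has_sum N (fun D => emb A (theta_coef (0 - D)) * punctured x D) g0 ->
  forall n0, has_sum N (fun D => emb A (theta_coef (n0 - D)) * punctured x D)
     (emb A (theta_coef n0) * x ^ n0 * g0).
Proof.
move=> ux hx h0; elim/int_rect => [|k IH|k IH].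
- by rewrite theta_coef0 rmorph1 expr0z !mul1r.
- have [g hg] := rn_complete (kernel_sums (k%:Z + 1) ux hx).
  rewrite (_ : k.+1%:Z = k%:Z + 1); last by lia.
  suff <- : g = emb A (theta_coef (k%:Z + 1)) * x ^ (k%:Z + 1) * g0 by [].
  rewrite (kernel_step ux hx hg IH) theta_coefS //; move: (theta_coef k%:Z) => v.
  by rewrite rmorphM exprzDr // expr1z; ring.
- have [g hg] := rn_complete (kernel_sums (- k%:Z - 1) ux hx).
  rewrite (_ : - k.+1%:Z = - k%:Z - 1); last by lia.
  suff <- : g = emb A (theta_coef (- k%:Z - 1)) * x ^ (- k%:Z - 1) * g0 by [].
  have IH' : has_sum N (fun D => emb A (theta_coef ((- k%:Z - 1) + 1 - D)) * punctured x D)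
      (emb A (theta_coef (- k%:Z)) * x ^ (- k%:Z) * g0) by rewrite subrK.
  have := kernel_step ux hx IH' hg.
  set a := - k%:Z - 1 => h.
  have ua : emb A (- q ^ a) * x \is a GRing.unit.
    by rewrite unitrM ux andbT unit_res embK oppr_eq0 expfz_neq0.
  apply: (mulrI ua); rewrite -h.
  rewrite (_ : - k%:Z = a + 1); last by rewrite /a; lia.
  by rewrite theta_coefS // rmorphM [x ^ (a + 1)]exprzDr // expr1z; ring.
Qed.

(** The coefficient at D = l of the finite expansion below, up to a theta
   coefficient; as for [central_gauss], its limit does not depend on l. *)
Definition central_coef M (l : int) : C :=
  if (0 <= M%:Z + l) && (0 <= M%:Z - l) then
    (qpoch q q `|(M%:Z + l)%R|%N)^-1 * (qpoch q q `|(M%:Z - l)%R|%N)^-1 else 0.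

Lemma central_coef_tends l : tends NC \oo (central_coef^~ l) (qq^-1 * qq^-1).
Proof.
apply: (tends_near_eq _ (central_qpoch_tends l)).
by exists `|l|%N => // M /= hM; rewrite /central_coef ifT //; lia.
Qed.

Lemma central_coef_bound : exists2 B, 0 <= B & forall M l, normc (central_coef M l) <= B.
Proof.
have [c c0 hc] := qpoch_lower (qq_no_zero).
have ci : 0 <= c^-1 by rewrite invr_ge0 ltW.
exists (c^-1 * c^-1) => [|M l]; first exact: mulr_ge0.
rewrite /central_coef; case: ifP => _; last by have := normc0 R => ->; rewrite mulr_ge0.
have hinv d : (normc (qpoch q q d))^-1 <= c^-1.
  by rewrite lef_pV2 // posrE (lt_le_trans c0).
by rewrite normcM !normcV; apply: ler_pM; rewrite ?invr_ge0 ?normc_ge0.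
Qed.

Lemma lagrange_node_product M a : (a < (M + M).+1)%N ->
  \prod_(b < (M + M).+1 | val b != a) (1 - q ^+ b / q ^+ a) =
  (theta_coef (- a%:Z))^-1 * qpoch q q a * qpoch q q (M + M - a).
Proof.
move=> ha; rewrite (prod_ord_neq (fun b => 1 - q ^+ b / q ^+ a) ha).
have -> : \prod_(b < a) (1 - q ^+ b / q ^+ a) = qpoch (1 * q ^- a) q a.
  by apply: eq_bigr => b _; rewrite mul1r mulrC.
have := @qpoch_flip CC 1 a (unitr1 _); rewrite /= => ->.
have e : ((-1) ^+ a)^-1 = (-1) ^+ a :> C by rewrite -exprVn invrN1.
rewrite expr1n mulr1 divr1 theta_coef_opp invfM e subSS; congr (_ * _).
by apply: eq_bigr => l _; rewrite exprD exprS; field; rewrite expf_neq0.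
Qed.

(** Interpolate X^M at the 2M + 1 points q^(-a), 0 <= a <= 2M, evaluate at
   x q^(-M) and multiply by the complementary infinite product: a finite form
   of the expansion of 1 / ((x)_oo (q/x)_oo) into simple fractions. *)
Lemma finite_theta_fractions x M : x \is a GRing.unit -> nopole x ->
  qlim (x * A.q ^+ M.+1) = qpoch (A.q / x) A.q M *
    \sum_(a < (M + M).+1) emb A (theta_coef (0 - (a%:Z - M%:Z)) * central_coef M (a%:Z - M%:Z)) * punctured x (a%:Z - M%:Z).
Proof.
move=> ux hx.
pose nd (a : 'I_(M + M).+1) : C := q ^+ a.
have nd_inj : injective nd.
  have key (b c : nat) : (b < c)%N -> q ^+ b != q ^+ c.
    move=> bc; rewrite -(subnKC (ltnW bc)) exprD -[X in X != _]mulr1.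
    apply: contraNneq (qk_neq1 (c - b).-1) => /(mulfI (expf_neq0 _ q0)) h.
    by rewrite prednK ?subn_gt0 // -h.
  move=> a b /eqP ab; apply: val_inj; apply/eqP; move: ab; apply: contraLR.
  by rewrite neq_ltn => /orP [] /key // ; rewrite eq_sym.
have nd0 a : nd a != 0 by exact: expf_neq0.
pose y := x * A.q ^ (- M%:Z).
have := lagrange_eval nd_inj nd0 (emb A) (p := 'X^M) y.
rewrite size_polyXn card_ord map_polyXn hornerXn => /(_ ltac:(lia)) hy.
(* The interpolation formula, multiplied by the product of the factors outside the range. *)
have h1 : y ^+ M * (qpochz x (- M%:Z) * qlim (x * A.q ^+ M.+1)) =
  \sum_(a < (M + M).+1) emb A (q ^- (a * M) / ((theta_coef (- a%:Z))^-1 * qpoch q q a * qpoch q q (M + M - a)))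
     * punctured x (a%:Z - M%:Z).
  rewrite hy mulr_suml; apply: eq_bigr => a _.
  rewrite -[LHS]mulrA hornerXn exprVn -exprM (lagrange_node_product (ltn_ord a)); congr (_ * _).
    rewrite addrC -(punctured_omit (- M%:Z) (L := (M + M).+1)) // mulrCA mulrA.
  congr (_ * _ * _); last by congr (qlim (x * _)); rewrite exprnP; congr (_ ^ _); lia.
  apply: eq_bigr => b _; rewrite rmorphXn /= exprzDr // /y -exprnP; congr (1 - _); ring.
(* (x)_(-M) is the inverse of M factors, which turn into (q/x)_M. *)
have h2 : x ^+ M * qpochz x (- M%:Z) * qpoch (A.q / x) A.q M = emb A (theta_coef (- M%:Z)).
  have := qpochz_add (- M%:Z) M hx; rewrite addNr -exprnN qpoch_flip // [RHS]/= qpoch0 => h.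
  apply: (mulIr (x := emb A ((-1) ^+ M / q ^+ 'C(M.+1, 2)))).
    by rewrite unit_res embK mulf_neq0 ?signr_eq0 ?invr_eq0 ?expf_neq0.
  rewrite -rmorphM theta_coef_opp mulrACA -expr2 sqrr_sign mul1r divff ?expf_neq0 // rmorph1 -h; ring.
have h3 : emb A (q ^- (M * M) * theta_coef (- M%:Z)) * qlim (x * A.q ^+ M.+1) =
   qpoch (A.q / x) A.q M * (y ^+ M * (qpochz x (- M%:Z) * qlim (x * A.q ^+ M.+1))).
  rewrite rmorphM -h2 /y exprMn -exprnN -exprVn -exprM rmorphV ?unitfE ?expf_neq0 // rmorphXn exprVn /=; ring.
have u1 : emb A (q ^- (M * M) * theta_coef (- M%:Z)) \is a GRing.unit.
  by rewrite unit_res embK theta_coef_opp !mulf_neq0 ?signr_eq0 ?invr_eq0 ?expf_neq0.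
apply: (mulrI u1); rewrite h3 h1 [RHS]mulrCA; congr (_ * _).
rewrite mulr_sumr; apply: eq_bigr => a _; rewrite [RHS]mulrA -[in RHS]rmorphM; congr (emb A _ * _).
have ha := ltn_ord a; rewrite /central_coef ifT; last by lia.
rewrite (_ : `|(M%:Z + (a%:Z - M%:Z))%R|%N = a); last by lia.
rewrite (_ : `|(M%:Z - (a%:Z - M%:Z))%R|%N = (M + M - a)%N); last by lia.
rewrite (_ : - a%:Z = (0 - (a%:Z - M%:Z)) + - M%:Z); last by lia.
rewrite theta_coefD // !invfM invrK.
rewrite (_ : q ^ _ = q ^+ (a * M) / q ^+ (M * M)); last first.
  by rewrite exprnP exprnN -expfzDr //; congr (q ^ _); lia.
have n1 : q ^+ (a * M) != 0 by rewrite expf_neq0.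
by field; rewrite !qq_neq0 ?expf_neq0 //= theta_coef_opp mulf_neq0 ?signr_eq0 ?expf_neq0.
Qed.

(** By [kernel_all] only n0 = 0 is left, where the sum is the limit of
   [finite_theta_fractions]. *)
Lemma theta_kernel x : x \is a GRing.unit -> nopole x -> forall n0,
  has_sum N (fun D => emb A (theta_coef (n0 - D)) * punctured x D)
    (emb A (theta_coef n0) * x ^ n0 * (emb A (qq * qq) / qlim (A.q / x))).
Proof.
move=> ux hx; apply: kernel_all => //.
have [g hg] := rn_complete (kernel_sums 0 ux hx).
have uqx : qlim (A.q / x) \is a GRing.unit.
  apply: qlim_unit => // k; rewrite rmorphM rmorphV // /= embK mulrAC -exprS.
  have rx : res A x != 0 by rewrite -unit_res.
  by apply: contra (hx k) => /eqP h; rewrite -[q ^+ _](divfK rx) h mul1r.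
suff h : 1 = qlim (A.q / x) * (emb A (qq^-1 * qq^-1) * g).
  suff <- : g = emb A (qq * qq) / qlim (A.q / x) by [].
  apply: (mulrI uqx); rewrite [RHS]mulrC divrK //.
  rewrite -[RHS]mulr1 h mulrCA; congr (_ * _); rewrite mulrA -rmorphM.
  rewrite (_ : qq * qq * _ = 1) ?rmorph1 ?mul1r // mulrACA divff ?mulr1 //; exact: qq_unit.
have [B B0 hB] := central_coef_bound.
have hb := bounded_sumsZ B0 (kernel_sums 0 ux hx).
pose u M D := emb A (theta_coef (0 - D) * central_coef M D) * punctured x D.
have hu : tends N \oo (fun M => \sum_(a < (M + M).+1) u M (a%:Z - M%:Z)) (emb A (qq^-1 * qq^-1) * g).
  apply: (tannery (u := u) _ hb _ _ (has_sumZ (emb A (qq^-1 * qq^-1)) hg)).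
  - move=> l.
    have h : tends N \oo (fun M => emb A (theta_coef (0 - l)) * punctured x l * emb A (central_coef M l))
        (emb A (theta_coef (0 - l)) * punctured x l * emb A (qq^-1 * qq^-1)).
      by apply: tendsZ; apply: tends_emb; exact: central_coef_tends.
    rewrite mulrC; apply: (tends_near_eq _ h); apply: nearW => M.
    by rewrite /u rmorphM; ring.
  - apply: nearW => M l; rewrite /u rmorphM mulrAC mulrC.
    by apply: le_trans (norm_embM _ _) _; apply: ler_wpM2r; rewrite ?rn_ge0.
  - apply: nearW => M; apply: has_sum_centered => l hl; rewrite /u /central_coef ifF ?mulr0 ?rmorph0 ?mul0r //; lia.
have h1 : tends N \oo (fun M => qpoch (A.q / x) A.q M * \sum_(a < (M + M).+1) u M (a%:Z - M%:Z))
    (qlim (A.q / x) * (emb A (qq^-1 * qq^-1) * g)).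
  by apply: tendsM => //; apply: qlim_tends.
apply: tends_uniq _ h1.
have h2 : tends N \oo (fun M => qlim (x * A.q * A.q ^+ M)) 1 by apply: qlim_tail.
apply: (tends_near_eq _ h2); apply: nearW => M.
by rewrite -mulrA -exprS finite_theta_fractions.
Qed.

End QPochhammer.

(** * Coefficients of the partial fractions *)

Lemma prod_pair_neq (B : comNzRingType) (S T : finType) (F : S * T -> B) j k :
  \prod_(s | s != (j, k)) F s =
  (\prod_(i | i != j) \prod_l F (i, l)) * \prod_(l | l != k) F (j, l).
Proof.
rewrite (eq_bigl (fun s => predT s.1 && (s != (s.1, s.2) :> S * T) || (s != (j, k)))); last first.
  by case=> s t; rewrite /= eqxx.
transitivity (\prod_i \prod_(l | (i, l) != (j, k)) F (i, l)).
  rewrite pair_big_dep /=; apply: eq_big => [[s t]|[s t] _] //=.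
  by rewrite eqxx.
rewrite (bigD1 j) //= mulrC; congr (_ * _).
  apply: eq_bigr => i ij; apply: eq_bigl => l; rewrite xpair_eqE.
  by rewrite (negPf ij).
by apply: eq_bigl => l; rewrite xpair_eqE eqxx.
Qed.

Section FactorRatio.
Variables (R : realType) (q : R[i]).
Hypotheses (q_gt0 : 0 < normc q) (q_lt1 : normc q < 1).
Local Notation r := (normc q).
Local Notation "x .q" := (emb x q) (at level 2, format "x .q").
Let r0 : 0 <= r. Proof. exact: ltW. Qed.

(** The n factors of the numerator grow like q^(-s), and so do the m factors of
   the denominator, which leaves q^(s(m-n)). *)
Lemma factor_ratio_bound (A : localAlg R) (m n : nat) (x : 'I_m -> A) (y : A) :
  (n <= m)%N -> (forall i, x i \is a GRing.unit) -> (forall i, nopole q (x i)) ->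
  exists2 K, 1 <= K & forall s, la_norm A ((1 - y * A.q ^- s.+1) ^+ n *
     \prod_i (1 - x i * A.q ^- s.+1)^-1) <= K * r ^+ (s.+1 * (m - n)).
Proof.
move=> nm ux hx.
have /choice [B hB] : forall i, exists B, 0 <= B /\ forall s,
    la_norm A (1 - x i * A.q ^- s.+1)^-1 <= B * r ^+ s.+1.
  by move=> i; have [B B0 hB] := pole_factor_bound q_gt0 q_lt1 (ux i) (hx i); exists B.
have y0 := rn_ge0 (la_norm A) y.
have P0 : 0 <= \prod_i B i by apply: prodr_ge0 => i _; case: (hB i).
exists (1 + (1 + la_norm A y) ^+ n * \prod_i B i) => [|s].
  by rewrite lerDl mulr_ge0 ?exprn_ge0 // addr_ge0.
have rs : 0 < r ^+ s.+1 by rewrite exprn_gt0.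
have h1 : la_norm A (1 - y * A.q ^- s.+1) <= (1 + la_norm A y) * (r ^+ s.+1)^-1.
  apply: le_trans (rnD _ _ _) _; rewrite norm1 rnN mulrDl mul1r; apply: lerD.
    by rewrite invr_ge1 ?unitfE ?gt_eqF ?inE // exprn_ile1 // ltW.
  apply: le_trans (rnM _ _ _) _; apply: ler_wpM2l => //.
  by rewrite -rmorphXn -fmorphV norm_emb normcV normcX.
have h2 : la_norm A (\prod_i (1 - x i * A.q ^- s.+1)^-1) <= \prod_i (B i * r ^+ s.+1).
  by apply: norm_prod => i; case: (hB i).
apply: le_trans (rnM _ _ _) _.
apply: le_trans (ler_pM (rn_ge0 _ _) (rn_ge0 _ _) (normX _ _) h2) _.
apply: le_trans (_ : ((1 + la_norm A y) * (r ^+ s.+1)^-1) ^+ n * (\prod_i (B i * r ^+ s.+1)) <= _).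
  apply: ler_wpM2r; first by apply: prodr_ge0 => i _; apply: mulr_ge0; [by case: (hB i)|exact: ltW].
  by apply: lerXn2r; rewrite ?nnegrE ?rn_ge0 // (le_trans (rn_ge0 _ _) h1).
rewrite big_split /= prodr_const card_ord exprMn exprVn.
have -> : (r ^+ s.+1) ^+ m = r ^+ (s.+1 * (m - n)) * (r ^+ s.+1) ^+ n.
  by rewrite exprM -exprD subnK.
rewrite mulrACA [X in _ * X]mulrCA mulVf ?mulr1; last by rewrite expf_neq0 ?gt_eqF.
by apply: ler_wpM2r; rewrite ?exprn_ge0 // lerDr.
Qed.

End FactorRatio.

Section Coefficients.
Variables (R : realType) (q : R[i]) (m n : nat) (alpha : 'I_m -> R[i]).
Hypotheses (q_gt0 : 0 < normc q) (q_lt1 : normc q < 1).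
Hypotheses (alpha0 : forall j, alpha j != 0) (alpha_inj : injective alpha).
Hypothesis alpha_sep : forall (i j : 'I_m) (k : int), k != 0 -> alpha i != alpha j * q ^ k.
Local Notation C := R[i].
Local Notation CC := (complexAlg R).
Local Notation NC := (complexNorm R).
Local Notation r := (normc q).
Local Notation qq := (qlim q (q : CC)).
Local Notation w := (Wcoef q n alpha).
Let r0 : 0 <= r. Proof. exact: ltW. Qed.
Let q0 := q_neq0 q_gt0.

Lemma ratio_nopole i j : @nopole _ q CC (alpha i / alpha j).
Proof.
move=> s; have := alpha_sep i j (k := s.+1) isT; apply: contra => /eqP /= h.
by apply/eqP; rewrite -exprnP -h mulrCA divff ?mulr1.
Qed.

Lemma ratio_no_zero i j : i != j -> forall k, alpha i / alpha j * q ^+ k != 1.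
Proof.
move=> ij k; apply: contra ij => /eqP h.
have e : alpha i = alpha j * q ^ (- k%:Z).
  rewrite -exprnN; apply: (mulIf (expf_neq0 k q0)).
  by rewrite divfK ?expf_neq0 // -[RHS]mulr1 -h; field.
have [k0|k0] := eqVneq (- k%:Z) 0.
  by apply/eqP/alpha_inj; rewrite e k0 expr0z mulr1.
by move: (alpha_sep i j k0); rewrite -e eqxx.
Qed.

Lemma Wcoef0 j : w j 0 = 1.
Proof.
rewrite /Wcoef big_geq // big1 ?divr1 // => i _; exact: big_geq.
Qed.

Lemma WcoefS j k : w j k.+1 = w j k *
  ((1 - (alpha j)^-1 * q * q ^- k.+1) ^+ n * \prod_i (1 - alpha i / alpha j * q ^- k.+1)^-1).
Proof.
rewrite /Wcoef big_nat_recr //= (eq_bigr (fun i => \prod_(1 <= s < k.+1) (1 - alpha i / alpha j * q ^- s) * (1 - alpha i / alpha j * q ^- k.+1))); last first.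
  by move=> i _; rewrite big_nat_recr.
rewrite big_split /= prodfV invfM mulrACA; congr (_ * (_ * _)).
by rewrite exprS invfM mulrA mulfK.
Qed.

(** The product of the bounds of [factor_ratio_bound] for the successive
   ratios. *)
Lemma Wcoef_bound j : (n <= m)%N -> exists2 K, 1 <= K &
  forall k, normc (w j k) <= K ^+ k * r ^+ ((m - n) * 'C(k, 2)).
Proof.
move=> nm; have ux i : (alpha i / alpha j : CC) \is a GRing.unit by rewrite unitfE mulf_neq0 ?invr_eq0.
have [K K1 hK] := factor_ratio_bound q_gt0 q_lt1 ((alpha j)^-1 * q : CC) nm ux (ratio_nopole^~ j).
exists K => //; elim=> [|k IH].
  by rewrite Wcoef0 expr0 mul1r bin0n muln0 expr0; have := normc1 R => ->.
have K0 : 0 <= K by apply: le_trans K1.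
rewrite WcoefS normcM.
apply: le_trans (ler_pM (normc_ge0 _) (normc_ge0 _) IH (hK k)) _.
rewrite mulrACA -exprSr -exprD; apply: ler_wpM2l; first exact: exprn_ge0.
by rewrite ler_wiXn2l // ?ltW // binS bin1 mulnDr leq_add2l mulnC leq_mul2r leqnSn orbT.
Qed.

Lemma qpoch_neg (z : C) k : qpoch (z * q ^- k) q k = \prod_(1 <= s < k.+1) (1 - z * q ^- s).
Proof.
elim: k => [|k IH]; first by rewrite qpoch0 big_geq.
rewrite qpochSl big_nat_recr //= mulrC; congr (_ * _).
by rewrite -IH; congr (qpoch _ _ _); rewrite exprS; field; rewrite expf_neq0.
Qed.

(** The numerator of the truncated coefficient, as a polynomial in P q^d. *)
Definition numer_poly (M : nat) : {poly C} := \prod_(l < M) (1 - q ^+ l.+1 *: 'X) ^+ n.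

(** The truncated coefficient has its simple fractions at the reciprocals of
   these numbers. *)
Definition node M (s : 'I_m * 'I_M.+1) : C := alpha s.1 * q ^+ s.2.

(** The Lagrange coefficient of [numer_poly] at the node s. *)
Definition residue_coef M (s : 'I_m * 'I_M.+1) : C :=
  (numer_poly M).[(node s)^-1] / \prod_(t | t != s) (1 - node t / node s).

Definition residue_tail (j : 'I_m) d : C :=
  qpoch ((alpha j)^-1 * q) q d ^+ n /
  ((\prod_(i < m | i != j) qpoch (alpha i / alpha j) q d.+1) * qpoch q q d).

Lemma node_neq0 M (s : 'I_m * 'I_M.+1) : node s != 0.
Proof. by rewrite mulf_neq0 ?expf_neq0. Qed.

(** An equality of nodes reads alpha_i = alpha_j q^(l-k). *)
Lemma node_inj M : injective (@node M).
Proof.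
move=> [i k] [j l]; rewrite /node /= => h.
have e : alpha i = alpha j * q ^ (l%:Z - k%:Z).
  rewrite expfzDr // -exprnP -exprnN mulrA -h mulfK ?expf_neq0 //.
have [kl|kl] := eqVneq (l%:Z - k%:Z) 0; last first.
  by move: (alpha_sep i j kl); rewrite -e eqxx.
have -> : i = j by apply: alpha_inj; rewrite e kl expr0z mulr1.
by congr (_, _); apply: val_inj => /=; lia.
Qed.

(** The degree is at most M n, which is less than m (M + 1) since n <= m. *)
Lemma size_numer_poly M : (n <= m)%N -> (0 < m)%N -> (size (numer_poly M) <= #|{: 'I_m * 'I_M.+1}|)%N.
Proof.
move=> nm m_gt0; rewrite card_prod !card_ord /numer_poly.
apply: leq_trans (_ : (M * n).+1 <= _)%N; last first.
  by clear -nm m_gt0; nia.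
apply: leq_trans (size_prod_leq _ _) _; rewrite card_ord leq_subLR.
apply: leq_trans (_ : (\sum_(l < M) n.+1).+1 <= _)%N; last first.
  by rewrite sum_nat_const card_ord mulnS addnS.
rewrite ltnS; apply: leq_sum => l _.
apply: leq_trans (size_poly_exp_leq _ _) _; rewrite ltnS.
apply: leq_trans (leq_mul (_ : _ <= 1)%N (leqnn n)) _; last by rewrite mul1n.
rewrite -subn1 leq_subLR; apply: leq_trans (size_polyD _ _) _.
rewrite geq_max size_poly1 size_polyN /=.
by apply: leq_trans (size_scale_leq _ _) _; rewrite size_polyX.
Qed.

(** In numerator and denominator, the factors with a negative power of q give
   the coefficient of W_j, the others give [residue_tail]. *)
Lemma residue_coefE M j (k : 'I_M.+1) : residue_coef (j, k) = w j k * residue_tail j (M - k).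
Proof.
have kM : (k <= M)%N by rewrite -ltnS.
have qk := expf_neq0 k q0.
have hnum : (numer_poly M).[(node (j, k))^-1] =
   (\prod_(0 <= s < k) (1 - (alpha j)^-1 * q ^- s) ^+ n) * qpoch ((alpha j)^-1 * q) q (M - k) ^+ n.
  rewrite /numer_poly horner_prod.
  transitivity (qpoch ((alpha j)^-1 * q * q ^- k) q M ^+ n).
    rewrite /qpoch -prodrXl; apply: eq_bigr => l _.
    rewrite horner_exp hornerD hornerN hornerC hornerZ hornerX /node /= exprS invfM.
    by congr ((1 - _) ^+ n); ring.
  have -> : qpoch ((alpha j)^-1 * q * q ^- k) q M = qpoch ((alpha j)^-1 * q * q ^- k) q (k + (M - k)).
    by rewrite subnKC.
  rewrite qpochD divfK // exprMn qpoch_neg; congr (_ * _).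
  rewrite big_add1 /= -prodrXl; apply: eq_bigr => s _.
  by rewrite exprS invfM mulrA mulfK.
have hden : \prod_(t | t != (j, k)) (1 - node t / node (j, k)) =
  (\prod_i \prod_(1 <= s < k.+1) (1 - alpha i / alpha j * q ^- s)) *
  ((\prod_(i < m | i != j) qpoch (alpha i / alpha j) q (M - k).+1) * qpoch q q (M - k)).
  rewrite prod_pair_neq [X in _ = X * _](bigD1 j) //=.
  have e1 : \prod_(i | i != j) \prod_(l < M.+1) (1 - node (i, l) / node (j, k)) =
     (\prod_(i | i != j) \prod_(1 <= s < k.+1) (1 - alpha i / alpha j * q ^- s)) *
     \prod_(i | i != j) qpoch (alpha i / alpha j) q (M - k).+1.
    rewrite -big_split; apply: eq_bigr => i _ /=.
    rewrite -qpoch_neg -[X in _ = _ * qpoch X _ _](divfK qk) -qpochD.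
    rewrite addnS subnKC //; apply: eq_bigr => l _.
    by rewrite /node /=; congr (1 - _); field; rewrite qk alpha0.
  have e2 : \prod_(l < M.+1 | l != k) (1 - node (j, l) / node (j, k)) =
     \prod_(1 <= s < k.+1) (1 - alpha j / alpha j * q ^- s) * qpoch q q (M - k).
    transitivity (\prod_(l < M.+1 | val l != k) (1 - q ^+ l / q ^+ k)).
      by apply: eq_bigr => l _; rewrite /node /=; congr (1 - _); field; rewrite qk alpha0.
    rewrite (prod_ord_neq (fun l => 1 - q ^+ l / q ^+ k) (ltn_ord k)) subSS -qpoch_neg.
    congr (_ * _); apply: eq_bigr => l _.
      by rewrite divff // mul1r mulrC.
    by rewrite exprD exprS; congr (1 - _); field; rewrite qk.
  by rewrite e1 e2; ring.
rewrite /residue_coef hnum hden /Wcoef /residue_tail.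
by rewrite [in LHS]invfM; ring.
Qed.

(** The scalar coefficient of the j-th summand, up to its factor e_(q, alpha_j)^-1. *)
Definition residue_limit (j : 'I_m) : C :=
  qlim q ((alpha j)^-1 * q : CC) ^+ n /
  ((\prod_(i < m | i != j) qlim q (alpha i / alpha j : CC)) * qq).

Lemma residue_tail_tends j : tends NC \oo (residue_tail j) (residue_limit j).
Proof.
have hq (a : C) : tends NC \oo (fun d => qpoch a q d) (qlim q (a : CC)).
  exact: (@qlim_tends _ _ _ _ CC).
apply: tendsM; first exact: tendsX.
apply: (@tendsV _ CC).
  rewrite unitfE mulf_neq0 ?qq_unit //; apply/prodf_neq0 => i ij.
  rewrite -unitfE; apply: (@qlim_unit _ _ _ _ CC) => //; exact: ratio_no_zero.
apply: tendsM => //; apply: tends_prod => i.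
apply: tends_comp (hq _); apply: cvg_infty => d; exists d => M; lia.
Qed.

Lemma residue_tail_bound j : exists2 B, 0 <= B & forall d, normc (residue_tail j d) <= B.
Proof.
have /choice [c hc] : forall i, exists c, i != j -> 0 < c /\ forall d, c <= normc (qpoch (alpha i / alpha j) q d).
  move=> i; have [->|ij] := eqVneq i j; first by exists 0.
  by have [c c0 hc] := qpoch_lower q_gt0 q_lt1 (ratio_no_zero ij); exists c.
have [b b0 hb] := qpoch_lower q_gt0 q_lt1 (qq_no_zero q_gt0 q_lt1).
pose E := expR (normc ((alpha j)^-1 * q) / (1 - r)).
have P0 : 0 < \prod_(i < m | i != j) c i by apply: prodr_gt0 => i /(hc i) [].
exists (E ^+ n * ((\prod_(i < m | i != j) c i) * b)^-1) => [|d].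
  by rewrite mulr_ge0 ?invr_ge0 ?mulr_ge0 ?exprn_ge0 ?expR_ge0 // ltW.
rewrite /residue_tail normcM normcX normcV normcM; apply: ler_pM.
- by rewrite exprn_ge0 ?normc_ge0.
- by rewrite invr_ge0 mulr_ge0 ?normc_ge0.
- apply: lerXn2r; rewrite ?nnegrE ?normc_ge0 ?expR_ge0 //.
  by apply: (@qpoch_norm_le _ _ _ _ CC).
have nprod : normc (\prod_(i < m | i != j) qpoch (alpha i / alpha j) q d.+1) =
   \prod_(i < m | i != j) normc (qpoch (alpha i / alpha j) q d.+1).
  by elim/big_rec2: _ => [|i y x _ <-]; [exact: normc1|rewrite normcM].
have le1 : (\prod_(i < m | i != j) c i) * b <= normc (\prod_(i < m | i != j) qpoch (alpha i / alpha j) q d.+1) * normc (qpoch q q d).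
  rewrite nprod; apply: ler_pM; rewrite ?(ltW P0) ?(ltW b0) //.
  by apply: ler_prod => i ij; have [c0 ->] := hc i ij; rewrite ltW.
have pos : 0 < (\prod_(i < m | i != j) c i) * b by rewrite mulr_gt0.
by rewrite lef_pV2 // posrE (lt_le_trans pos).
Qed.

End Coefficients.

(** * The truncated left-hand side *)

Section TruncatedCoefficients.
Variables (R : realType) (q : R[i]) (m n : nat) (alpha : 'I_m -> R[i]).
Hypotheses (q_gt0 : 0 < normc q) (q_lt1 : normc q < 1).
Hypothesis (nm : (n <= m)%N).
Hypotheses (alpha0 : forall j, alpha j != 0) (alpha_inj : injective alpha).
Hypothesis alpha_sep : forall (i j : 'I_m) (k : int), k != 0 -> alpha i != alpha j * q ^ k.
Hypothesis alpha_nopole : forall (j : 'I_m) (k : nat), alpha j != q ^+ k.+1.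
Local Notation C := R[i].
Local Notation CC := (complexAlg R).
Local Notation NC := (complexNorm R).
Local Notation r := (normc q).
Local Notation qq := (qlim q (q : CC)).
Local Notation "x .q" := (emb x q) (at level 2, format "x .q").
Local Notation w := (Wcoef q n alpha).
Local Notation residue_coef M := (@residue_coef R q m n alpha M).
Local Notation residue_tail := (residue_tail q n alpha).
Local Notation residue_limit := (residue_limit q n alpha).
Let r0 : 0 <= r. Proof. exact: ltW. Qed.
Let q0 := q_neq0 q_gt0.

Variables (A : localAlg R) (P : A).
Hypotheses (resP : res A P = 1) (nilP : (1 - P) ^+ n = 0).
Local Notation N := (la_norm A).
Let uq : A.q \is a GRing.unit. Proof. exact: qA_unit. Qed.

Definition Palpha (i : 'I_m) : A := P * emb A (alpha i).

Lemma res_Palpha i : res A (Palpha i) = alpha i.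
Proof. by rewrite rmorphM resP mul1r embK. Qed.

Lemma Palpha_unit i : Palpha i \is a GRing.unit.
Proof. by rewrite unit_res res_Palpha. Qed.

Lemma Palpha_nopole i : nopole q (Palpha i).
Proof. by move=> s; rewrite res_Palpha. Qed.

Definition other_prods (j : 'I_m) : A := \prod_(i < m | i != j) qlim q (Palpha i).

(** a_d (Pq)_oo^n = (P q^(d+1))_oo^n prod_i (x_i)_oo / (x_i q^d)_oo, with the
   first infinite product cut to M factors and the denominators to M + 1
   factors.  This makes sense for every integer d. *)
Definition trunc_coef (M : nat) (d : int) : A :=
  (\prod_(l < M) (1 - P * A.q ^ (d + l.+1%:Z)) ^+ n) *
  \prod_i (qpochz q (Palpha i) d * qlim q (Palpha i * A.q ^ (d + M.+1%:Z))).

(** Lagrange interpolation of [numer_poly], evaluated at P q^d.  In the term of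
   the node (j, k), the products over the nodes (i, l) with i != j complete to
   (x_i)_oo, and the one with i = j to (x_j)_oo without its factor d + k. *)
Lemma trunc_coef_fractions M d : (0 < m)%N -> trunc_coef M d =
  \sum_j \sum_(k < M.+1) emb A (residue_coef M (j, k)) * other_prods j * punctured q (Palpha j) (d + k%:Z).
Proof.
move=> m_gt0; have inj : injective (@node R q m alpha M) by apply: node_inj.
have nz (s : 'I_m * 'I_M.+1) : node q alpha s != 0 by apply: node_neq0.
have := lagrange_eval inj nz (emb A) (P * A.q ^ d) (size_numer_poly q M nm m_gt0).
rewrite /numer_poly rmorph_prod horner_prod => h.
rewrite /trunc_coef (eq_bigr (fun l : 'I_M => (map_poly (emb A) ((1 - q ^+ l.+1 *: 'X) ^+ n)).[P * A.q ^ d])); last first.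
  move=> l _; rewrite rmorphXn horner_exp rmorphB rmorph1 /= map_polyZ map_polyX.
  rewrite hornerD hornerN hornerC hornerZ hornerX rmorphXn exprzDr // -exprnP.
  by congr ((1 - _) ^+ n); ring.
rewrite h mulr_suml pair_big /=; apply: eq_bigr => -[j k] _ /=.
rewrite -[LHS]mulrA -[RHS]mulrA; congr (_ * _).
rewrite prod_pair_neq mulrC (bigD1 j) //= mulrACA mulrC.
have Zk : qpochz q (Palpha j) d * qlim q (Palpha j * A.q ^ (d + M.+1%:Z)) *
   \prod_(l < M.+1 | l != k) (1 - emb A (node q alpha (j, l)) * (P * A.q ^ d)) = punctured q (Palpha j) (d + k%:Z).
  rewrite -(punctured_omit q_gt0 q_lt1 d (L := M.+1) (Palpha_nopole j) (ltn_ord k)) mulrAC; congr (_ * _ * _).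
  apply: eq_bigr => l _; rewrite /node /= /Palpha exprzDr // -exprnP rmorphM rmorphXn.
  by congr (1 - _); ring.
rewrite -Zk /other_prods.
rewrite (_ : \prod_(i < m | i != j) qlim q (Palpha i) = \prod_(i < m | i != j)
  ((qpochz q (Palpha i) d * qlim q (Palpha i * A.q ^ (d + M.+1%:Z))) *
   \prod_(l < M.+1) (1 - emb A (node q alpha (i, l)) * (P * A.q ^ d)))).
  rewrite [in RHS]big_split /=; ring.
apply: eq_bigr => i _; rewrite -[LHS](qpochz_qlim q_gt0 q_lt1 (d + M.+1%:Z) (Palpha_nopole i)).
rewrite [RHS]mulrAC; congr (_ * _).
rewrite -(qpochz_add q_gt0 q_lt1 d M.+1 (Palpha_nopole i)); congr (_ * _).
apply: eq_bigr => l _; rewrite /node /= /Palpha rmorphM rmorphXn.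
by congr (1 - _); ring.
Qed.

(** a_d. *)
Definition lhs_coef (d : nat) : A :=
  \prod_i qpoch (Palpha i) A.q d / qpoch (P * A.q) A.q d ^+ n.

(** a_d (Pq)_oo^n, continued by zero to d < 0. *)
Definition lhs_coefz (d : int) : A :=
  if d is Posz d' then lhs_coef d' * qlim q (P * A.q) ^+ n else 0.

Lemma qpoch_Pq_unit d : qpoch (P * A.q) A.q d \is a GRing.unit.
Proof.
rewrite unit_res (rmorph_qpoch (res A)) rmorphM resP mul1r embK.
exact: qq_neq0.
Qed.

(** For -M <= d < 0 the numerator contains (1 - P)^n. *)
Lemma trunc_coef_neg M s : (s < M)%N -> (0 < n)%N -> trunc_coef M (Negz s) = 0.
Proof.
move=> sM n0; rewrite /trunc_coef (bigD1 (Ordinal sM)) //= NegzE addNr expr0z mulr1 nilP.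
by rewrite !mul0r.
Qed.

Lemma trunc_coef_tends d : (0 < n)%N -> tends N \oo (trunc_coef^~ d) (lhs_coefz d).
Proof.
move=> n0; case: d => d; last first.
  apply: (tends_near_eq _ (tends_cst N 0)).
  by exists d.+1 => // M /= hM; rewrite trunc_coef_neg.
have h : tends N \oo (fun M => qpoch (P * A.q ^+ d * A.q) A.q M ^+ n *
   \prod_i (qpoch (Palpha i) A.q d * qlim q (Palpha i * A.q ^+ d.+1 * A.q ^+ M)))
   (qlim q (P * A.q ^+ d * A.q) ^+ n * \prod_i (qpoch (Palpha i) A.q d * 1)).
  apply: tendsM; first by apply: tendsX; apply: qlim_tends.
  by apply: tends_prod => i; apply: tendsZ; apply: qlim_tail.
have -> : lhs_coefz d = qlim q (P * A.q ^+ d * A.q) ^+ n * \prod_i (qpoch (Palpha i) A.q d * 1).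
  rewrite /lhs_coefz /lhs_coef (qlim_shift q_gt0 q_lt1 (P * A.q) d) exprMn.
  rewrite (eq_bigr _ (fun i _ => mulr1 (qpoch (Palpha i) A.q d))).
  rewrite mulrA divrK ?unitrX ?qpoch_Pq_unit // mulrC; congr (qlim q _ ^+ n * _); ring.
apply: (tends_near_eq _ h); apply: nearW => M; rewrite /trunc_coef; congr (_ * _).
  rewrite /qpoch -prodrXl; apply: eq_bigr => l _.
  rewrite -PoszD -exprnP addnS exprS exprD.
  by congr ((1 - _) ^+ n); ring.
apply: eq_bigr => i _; congr (_ * qlim q _); rewrite -PoszD -exprnP addnS -addSn exprD; ring.
Qed.

(** For d >= 0 all the products are uniformly bounded.  For d < -M, pair the M
   factors of the numerator with M factors of the denominators; each quotient
   is at most K, and M <= |d|.  The range in between is [trunc_coef_neg]. *)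
Lemma trunc_coef_bound : (0 < n)%N -> exists E, exists2 K, 1 <= K &
  0 <= E /\ forall M d, N (trunc_coef M d) <= E * K ^+ `|d|%N.
Proof.
move=> n0.
have [K K1 hK] := factor_ratio_bound q_gt0 q_lt1 P nm Palpha_unit Palpha_nopole.
have K0 : 0 <= K by apply: le_trans K1.
have /choice [B hB] : forall i, exists B, 0 <= B /\ forall D, N (punctured q (Palpha i) D) <= B.
  by move=> i; have [B B0 hB] := punctured_bound q_gt0 q_lt1 (Palpha_unit i) (Palpha_nopole i); exists B.
pose E1 := expR (N P / (1 - r)) ^+ n * \prod_i (expR (N (Palpha i) / (1 - r)) * expR (N (Palpha i) / (1 - r))).
pose E2 := \prod_i B i.
have E10 : 0 <= E1.
  by rewrite mulr_ge0 ?exprn_ge0 ?expR_ge0 ?prodr_ge0 // => i _; rewrite mulr_ge0 ?expR_ge0.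
have E20 : 0 <= E2 by apply: prodr_ge0 => i _; case: (hB i).
have small x k : N (x * A.q ^+ k) <= N x.
  apply: le_trans (rnM _ _ _) _; rewrite norm_q_powers.
  by rewrite ler_piMr ?rn_ge0 // exprn_ile1 // ltW.
exists (E1 + E2); exists K => //; split; first exact: addr_ge0.
move=> M [d|s].
  apply: le_trans (_ : E1 <= _); last first.
    apply: le_trans (_ : E1 * 1 <= _); first by rewrite mulr1.
    apply: ler_pM => //; first by rewrite lerDl.
    exact: exprn_ege1.
  apply: le_trans (rnM _ _ _) _; apply: ler_pM; rewrite ?rn_ge0 //.
    rewrite prodrXl; apply: le_trans (normX _ _) _.
    apply: lerXn2r; rewrite ?nnegrE ?rn_ge0 ?expR_ge0 //.
    rewrite (_ : \prod_(l < M) _ = qpoch (P * A.q ^+ d.+1) A.q M).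
      exact: qpoch_norm_le.
    apply: eq_bigr => l _; rewrite -PoszD -exprnP addnS -addSn exprD.
    by congr (1 - _); ring.
  apply: norm_prod => i; apply: le_trans (rnM _ _ _) _; apply: ler_pM; rewrite ?rn_ge0 //.
    exact: qpoch_norm_le.
  by apply: qlim_norm_le => //; rewrite -PoszD -exprnP.
case: (ltnP s M) => sM.
  by rewrite trunc_coef_neg // rn0 mulr_ge0 ?addr_ge0 ?exprn_ge0.
have -> : trunc_coef M (Negz s) = (\prod_(l < M) ((1 - P * A.q ^- (s - l.+1).+1) ^+ n *
   \prod_i (1 - Palpha i * A.q ^- (s - l.+1).+1)^-1)) * \prod_i punctured q (Palpha i) (Negz s).
  have e (l : 'I_M) : A.q ^ (Negz s + l.+1%:Z) = A.q ^- (s - l.+1).+1.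
    rewrite NegzE exprnN; congr (A.q ^ _); have := ltn_ord l; lia.
  rewrite big_split /= -mulrA; congr (_ * _).
    by apply: eq_bigr => l _; rewrite e.
  rewrite exchange_big -big_split; apply: eq_bigr => i _.
  have := punctured_omit q_gt0 q_lt1 (Negz s) (Palpha_nopole i) (ltn0Sn M); rewrite addr0 => <-.
  rewrite (prod_ord_neq (fun l => 1 - Palpha i * A.q ^ (Negz s + l%:Z)) (ltn0Sn M)) big_ord0 mul1r.
  rewrite (_ : \prod_(l < M.+1 - 1) _ = \prod_(l < M) (1 - Palpha i * A.q ^- (s - l.+1).+1)); last first.
    by rewrite subn1; apply: eq_bigr => l _; rewrite -e.
  rewrite [qpochz _ _ _ * \prod_(l < M) _]mulrC -[X in _ = _ * X]mulrA [RHS]mulrA.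
  rewrite -[X in _ = X * _]big_split big1 ?mul1r // => l _.
  by rewrite /= mulVr //; apply: nopole_factor_unit => //; apply: Palpha_nopole.
apply: le_trans (rnM _ _ _) _; rewrite mulrC; apply: ler_pM; rewrite ?rn_ge0 //.
  apply: le_trans (_ : E2 <= _); last by rewrite lerDr.
  by apply: norm_prod => i; case: (hB i).
apply: le_trans (_ : K ^+ M <= _); last by apply: ler_weXn2l => //; rewrite NegzE abszN /=; lia.
rewrite -[M in K ^+ M]card_ord -prodr_const; apply: norm_prod => l.
apply: le_trans (hK _) _; rewrite -[leRHS]mulr1; apply: ler_wpM2l => //.
by rewrite exprn_ile1 // ltW.
Qed.

(** * Letting the truncation go to infinity *)

Hypothesis n_gt0 : (0 < n)%N.
Let ux j : Palpha j \is a GRing.unit. Proof. exact: Palpha_unit. Qed.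
Let hx j : nopole q (Palpha j). Proof. exact: Palpha_nopole. Qed.

(** The constant of [theta_kernel] at x_j. *)
Definition kernel_const (j : 'I_m) : A := emb A (qq * qq) / qlim q (A.q / Palpha j).

Lemma Wterm_sums j n0 : bounded_sums (fun k : nat =>
  normc (w j k) * (normc (theta_coef q (n0 + k%:Z)) * N (Palpha j ^ (n0 + k%:Z)))).
Proof.
have [K K1 hK] := Wcoef_bound q_gt0 q_lt1 alpha0 alpha_sep j nm.
have K0 : 0 <= K by apply: le_trans K1.
pose B := N (Palpha j) + N (Palpha j)^-1.
have B0 : 0 <= B by rewrite addr_ge0 ?rn_ge0.
have h := bounded_sums_inj (f := Posz) (fun a b => fun e : Posz a = Posz b => let: erefl := e in erefl)
  (theta_coef_shift_sums q_gt0 q_lt1 n0 (mulr_ge0 K0 B0)).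
apply: bounded_sums_le (bounded_sumsZ (rn_ge0 N (Palpha j ^ n0)) h) => k /=.
rewrite exprzDr // -exprnP [(K * B) ^+ _]exprMn.
have h1 : normc (w j k) <= K ^+ k.
  apply: le_trans (hK k) _; rewrite ler_piMr ?exprn_ge0 //.
  by apply: exprn_ile1 => //; apply: ltW.
have h2 : N (Palpha j ^ n0 * Palpha j ^+ k) <= N (Palpha j ^ n0) * B ^+ k.
  apply: le_trans (rnM _ _ _) _; apply: ler_wpM2l; first exact: rn_ge0.
  apply: le_trans (normX _ _) _; apply: lerXn2r; rewrite ?nnegrE ?rn_ge0 //.
  by rewrite lerDl rn_ge0.
apply: (@le_trans _ _ (K ^+ k * (normc (theta_coef q (n0 + k%:Z)) * (N (Palpha j ^ n0) * B ^+ k)))).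
  apply: ler_pM => //; first exact: normc_ge0.
    by rewrite mulr_ge0 ?normc_ge0 ?rn_ge0.
  apply: ler_wpM2l; first exact: normc_ge0.
  exact: h2.
by rewrite le_eqVlt; apply/orP; left; apply/eqP; ring.
Qed.

Lemma has_sum_trunc_coef M n0 : has_sum N (fun d => emb A (theta_coef q (n0 - d)) * trunc_coef M d)
  (\sum_j \sum_(k < M.+1) emb A (residue_coef M (j, k)) * other_prods j *
     (emb A (theta_coef q (n0 + k%:Z)) * Palpha j ^ (n0 + k%:Z) * kernel_const j)).
Proof.
have h j (k : 'I_M.+1) : has_sum N (fun d => emb A (residue_coef M (j, k)) * other_prods j *
      (emb A (theta_coef q (n0 - d)) * punctured q (Palpha j) (d + k%:Z)))
   (emb A (residue_coef M (j, k)) * other_prods j * (emb A (theta_coef q (n0 + k%:Z)) * Palpha j ^ (n0 + k%:Z) * kernel_const j)).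
  apply: has_sumZ.
  have bij : bijective (fun d : int => d + k%:Z).
    by exists (fun d => d - k%:Z) => d; rewrite ?addrK ?subrK.
  apply: eq_has_sum (has_sum_reindex bij (theta_kernel q_gt0 q_lt1 (ux j) (hx j) (n0 + k%:Z))) => d /=.
  by congr (emb A (theta_coef q _) * _); lia.
have h2 := has_sum_bigop (index_enum 'I_m) (fun j => has_sum_bigop (index_enum 'I_M.+1) (h j)).
apply: eq_has_sum h2 => d; rewrite trunc_coef_fractions ?(leq_trans n_gt0) // mulr_sumr.
apply: eq_bigr => j _; rewrite mulr_sumr; apply: eq_bigr => k _.
by ring.
Qed.

(** Sum [trunc_coef_fractions] against the theta coefficients with
   [theta_kernel] and let M tend to infinity on both sides: over d on the left,
   over k on the right.  Both limits are dominated, because the theta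
   coefficients decay faster than any geometric sequence. *)
Lemma connection_coefficient n0 (Y : 'I_m -> A) :
  (forall j, has_sum N (fun k : nat => emb A (w j k * theta_coef q (n0 + k%:Z)) * Palpha j ^ (n0 + k%:Z)) (Y j)) ->
  has_sum N (fun d : nat => emb A (theta_coef q (n0 - d%:Z)) * (lhs_coef d * qlim q (P * A.q) ^+ n))
    (\sum_j other_prods j * kernel_const j * emb A (residue_limit j) * Y j).
Proof.
move=> hY.
have [E [K K1 [E0 hE]]] := trunc_coef_bound n_gt0.
have K0 : 0 <= K by apply: le_trans K1.
have hb : bounded_sums (fun d : int => E * (normc (theta_coef q (n0 - d)) * K ^+ `|d|%N)).
  apply: bounded_sumsZ => //.
  have := bounded_sums_inj (f := fun d : int => - d) oppr_inj (theta_coef_shift_sums q_gt0 q_lt1 n0 K0).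
  by apply: bounded_sums_le => d /=; rewrite abszN.
have ub M d : N (emb A (theta_coef q (n0 - d)) * trunc_coef M d) <= E * (normc (theta_coef q (n0 - d)) * K ^+ `|d|%N).
  apply: le_trans (norm_embM _ _) _; rewrite mulrCA.
  by apply: ler_wpM2l; rewrite ?normc_ge0.
have ut d : tends N \oo (fun M => emb A (theta_coef q (n0 - d)) * trunc_coef M d) (emb A (theta_coef q (n0 - d)) * lhs_coefz d).
  by apply: tendsZ; apply: trunc_coef_tends.
have [W hW] : exists W, has_sum N (fun d => emb A (theta_coef q (n0 - d)) * lhs_coefz d) W.
  apply: rn_complete; apply: bounded_sums_le hb => d.
  by apply: tends_norm_le (ut d) _; apply: nearW => M.
(* Limit over d. *)
have t1 : tends N \oo (fun M => \sum_j \sum_(k < M.+1) emb A (residue_coef M (j, k)) * other_prods j *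
     (emb A (theta_coef q (n0 + k%:Z)) * Palpha j ^ (n0 + k%:Z) * kernel_const j)) W.
  apply: (tannery (u := fun M d => emb A (theta_coef q (n0 - d)) * trunc_coef M d) ut hb _ _ hW).
    by apply: nearW => M d; apply: ub.
  by apply: nearW => M; apply: has_sum_trunc_coef.
(* Limit over k, for each j separately. *)
have t2 : tends N \oo (fun M => \sum_j \sum_(k < M.+1) emb A (residue_coef M (j, k)) * other_prods j *
     (emb A (theta_coef q (n0 + k%:Z)) * Palpha j ^ (n0 + k%:Z) * kernel_const j))
     (\sum_j other_prods j * kernel_const j * emb A (residue_limit j) * Y j).
  apply: tends_sum => j.
  pose v (M k : nat) := emb A (w j k * (if (k <= M)%N then residue_tail j (M - k) else 0)
       * theta_coef q (n0 + k%:Z)) * Palpha j ^ (n0 + k%:Z).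
  have [B B0 hB] := residue_tail_bound n q_gt0 q_lt1 alpha0 alpha_inj alpha_sep j.
  have t3 : tends N \oo (fun M => \sum_(k < M.+1) v M k) (emb A (residue_limit j) * Y j).
    apply: (tannery (u := v) _ (bounded_sumsZ B0 (Wterm_sums j n0)) _ _ (has_sumZ (emb A (residue_limit j)) (hY j))).
    - move=> k; have h : tends N \oo (fun M => emb A (w j k * theta_coef q (n0 + k%:Z)) * Palpha j ^ (n0 + k%:Z) * emb A (residue_tail j (M - k)))
         (emb A (w j k * theta_coef q (n0 + k%:Z)) * Palpha j ^ (n0 + k%:Z) * emb A (residue_limit j)).
        apply: tendsZ; apply: tends_emb.
        have ht : tends NC \oo (residue_tail j) (residue_limit j) by apply: residue_tail_tends.
        apply: tends_comp ht; apply: cvg_infty => d; exists (d + k)%N => M; lia.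
      rewrite mulrC; apply: (tends_near_eq _ h); exists k => // M /= kM.
      by rewrite /v kM !rmorphM; ring.
    - apply: nearW => M k; rewrite /v; apply: le_trans (norm_embM _ _) _.
      rewrite 2!normcM [B * _]mulrC -!mulrA; apply: ler_wpM2l; first exact: normc_ge0.
      rewrite [X in _ <= X]mulrA [X in _ <= X]mulrC; apply: ler_wpM2r.
        by rewrite mulr_ge0 ?normc_ge0 ?rn_ge0.
      by case: ifP => // _; have := normc0 R => ->.
    - apply: nearW => M; apply: has_sum_nat_fin => k kM.
      by rewrite /v (_ : (k <= M)%N = false) ?mulr0 ?mul0r ?rmorph0 ?mul0r //; lia.
  have t4 : tends N \oo (fun M => other_prods j * kernel_const j * \sum_(k < M.+1) v M k) (other_prods j * kernel_const j * (emb A (residue_limit j) * Y j)).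
    exact: tendsZ.
  rewrite -mulrA; apply: (tends_near_eq _ t4); apply: nearW => M.
  rewrite mulr_sumr; apply: eq_bigr => k _.
  by rewrite residue_coefE // /v -ltnS ltn_ord !rmorphM; ring.
have e := tends_uniq t1 t2; rewrite -e.
have inj : injective Posz by move=> ? ? [].
have supp i : (forall k, i != Posz k) -> emb A (theta_coef q (n0 - i)) * lhs_coefz i = 0.
  by case: i => [d /(_ d)|d _]; rewrite ?eqxx //= mulr0.
exact: (proj2 (has_sum_inj N W inj supp) hW).
Qed.

(** * The identity of Laurent series *)

Lemma lhs_coef_bound : exists2 B, 0 <= B & forall d, N (lhs_coef d) <= B.
Proof.
have [c c0 hc] := qpoch_lower q_gt0 q_lt1 (qq_no_zero q_gt0 q_lt1).
have [D D0 hD] := inv_bound A (expR (N (P * A.q) / (1 - r))) c0.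
pose E := \prod_i expR (N (Palpha i) / (1 - r)).
have E0 : 0 <= E by apply: prodr_ge0 => i _; exact: expR_ge0.
exists (E * D ^+ n) => [|d]; first by rewrite mulr_ge0 ?exprn_ge0.
rewrite /lhs_coef -exprVn; apply: le_trans (rnM _ _ _) _; apply: ler_pM; rewrite ?rn_ge0 //.
  by apply: norm_prod => i; apply: qpoch_norm_le.
apply: le_trans (normX _ _) _; apply: lerXn2r; rewrite ?nnegrE ?rn_ge0 //.
apply: hD; first exact: qpoch_norm_le.
by rewrite (rmorph_qpoch (res A)) rmorphM resP mul1r embK; apply: hc.
Qed.

Lemma lhs_sums Q : normc Q < 1 -> bounded_sums (fun d => N (emb A (Q ^+ d) * lhs_coef d)).
Proof.
move=> Q1; have [B B0 hB] := lhs_coef_bound.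
apply: (@bounded_sums_geo _ (normc Q) B) => [|d]; first by rewrite normc_ge0.
apply: le_trans (norm_embM _ _) _; rewrite normcX mulrC.
by apply: ler_wpM2r; rewrite ?exprn_ge0 ?normc_ge0.
Qed.

Variable rho : C.

(** The coefficients of the product of (rho z)_oo and the series of W_j. *)
Definition twist_coef (j : 'I_m) (s : nat) : C :=
  \sum_(a < s.+1) euler_coef q a * rho ^+ a * w j (s - a).

(** The double series behind [twist_coef_rows]: x.1 is the index in the Euler
   series and x.2 the index in the series of W_j. *)
Definition twist_term j (l : int) (x : nat * nat) : A :=
  emb A (euler_coef q x.1 * rho ^+ x.1 * (w j x.2 * theta_coef q (l + x.1%:Z + x.2%:Z))) *
  Palpha j ^ (l + x.1%:Z + x.2%:Z).

(** The theta coefficient of index l + s is of size q^(s(s-1)/2) up to a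
   geometric factor in s = x.1 + x.2, which dominates the rest. *)
Lemma twist_term_sums j l : bounded_sums (fun x => N (twist_term j l x)).
Proof.
have [K K1 hK] := Wcoef_bound q_gt0 q_lt1 alpha0 alpha_sep j nm.
have K0 : 0 <= K by apply: le_trans K1.
have [D1 D10 hD1] := euler_coef_bound q_gt0 q_lt1 ler01.
pose B := N (Palpha j); have B0 : 0 <= B by exact: rn_ge0.
pose p := 1 + normc rho; have p1 : 1 <= p by rewrite lerDl normc_ge0.
have p0 : 0 <= p by apply: le_trans p1.
pose X := r^-1 ^+ `|l|%N * B * K * p.
have rV : 0 <= r^-1 ^+ `|l|%N by rewrite exprn_ge0 ?invr_ge0.
have X0 : 0 <= X by rewrite !mulr_ge0.
have r01 : 0 <= r < 1 by rewrite r0.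
have [D2 D20 hD2] := superexponential r01 X0.
pose C0 := D1 * normc (theta_coef q l) * N (Palpha j ^ l) * D2.
have C00 : 0 <= C0 by rewrite !mulr_ge0 ?normc_ge0 ?rn_ge0.
have half : bounded_sums (fun k : nat => (1/2 : R) ^+ k).
  by apply: (@bounded_sums_half _ 1) => k; rewrite [leRHS]mul1r.
have h0 k : 0 <= (1/2 : R) ^+ k by rewrite exprn_ge0.
apply: bounded_sums_le (bounded_sumsZ C00 (bounded_sums_prod h0 h0 half half)) => -[c k].
rewrite /twist_term /= -exprD -addrA -PoszD.
set s := (c + k)%N.
have e1 : normc (euler_coef q c) <= D1.
  by apply: le_trans (_ : D1 * (1/2) ^+ c <= _); [have := hD1 c; rewrite expr1n mulr1|rewrite ler_piMr // exprn_ile1 //; lra].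
have e2 : normc (rho ^+ c) <= p ^+ s.
  rewrite normcX; apply: le_trans (_ : p ^+ c <= _); last by apply: ler_weXn2l => //; apply: leq_addr.
  by apply: lerXn2r; rewrite ?nnegrE ?normc_ge0 // lerDr.
have e3 : normc (w j k) <= K ^+ s.
  apply: le_trans (hK k) _; apply: le_trans (_ : K ^+ k <= _).
    by rewrite ler_piMr ?exprn_ge0 // exprn_ile1 // ltW.
  by apply: ler_weXn2l => //; apply: leq_addl.
have e4 : normc (theta_coef q (l + s%:Z)) <= normc (theta_coef q l) * (r ^+ 'C(s, 2) * (r^-1 ^+ `|l|%N) ^+ s).
  rewrite theta_coefD // 2!normcM -mulrA; apply: ler_wpM2l; first exact: normc_ge0.
  rewrite norm_theta_coef_nat; apply: ler_wpM2l; first exact: exprn_ge0.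
  by apply: le_trans (norm_q_exprz q_gt0 q_lt1 _) _; rewrite abszM exprM.
have e5 : N (Palpha j ^ (l + s%:Z)) <= N (Palpha j ^ l) * B ^+ s.
  rewrite exprzDr // -exprnP; apply: le_trans (rnM _ _ _) _.
  by apply: ler_wpM2l; rewrite ?rn_ge0 ?normX.
apply: le_trans (norm_embM _ _) _; rewrite normcM [normc (_ * rho ^+ c)]normcM [normc (w j k * _)]normcM.
apply: (@le_trans _ _ (D1 * p ^+ s * (K ^+ s * (normc (theta_coef q l) * (r ^+ 'C(s, 2) * (r^-1 ^+ `|l|%N) ^+ s))) * (N (Palpha j ^ l) * B ^+ s))).
  have m1 := ler_pM (normc_ge0 _) (normc_ge0 _) e1 e2.
  have m2 := ler_pM (normc_ge0 _) (normc_ge0 _) e3 e4.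
  have n1 := mulr_ge0 (normc_ge0 (euler_coef q c)) (normc_ge0 (rho ^+ c)).
  have n2 := mulr_ge0 (normc_ge0 (w j k)) (normc_ge0 (theta_coef q (l + s%:Z))).
  exact: ler_pM (mulr_ge0 n1 n2) (rn_ge0 _ _) (ler_pM n1 n2 m1 m2) e5.
rewrite (_ : _ * _ = D1 * normc (theta_coef q l) * N (Palpha j ^ l) * (r ^+ 'C(s, 2) * X ^+ s)); last first.
  by rewrite /X !exprMn; ring.
by rewrite /C0 -[X in _ <= X]mulrA; apply: ler_wpM2l; rewrite ?hD2 // !mulr_ge0 ?normc_ge0 ?rn_ge0.
Qed.

(** Sum the double family by rows and by antidiagonals. *)
Lemma twist_coef_rows j l (Y : int -> A) :
  (forall n0, has_sum N (fun k : nat => emb A (w j k * theta_coef q (n0 + k%:Z)) * Palpha j ^ (n0 + k%:Z)) (Y n0)) ->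
  exists2 S, has_sum N (fun c : nat => emb A (euler_coef q c * rho ^+ c) * Y (l + c%:Z)) S &
    has_sum N (fun s : nat => emb A (twist_coef j s * theta_coef q (l + s%:Z)) * Palpha j ^ (l + s%:Z)) S.
Proof.
move=> hY; have [S hS] := rn_complete (twist_term_sums j l); exists S.
  apply: (has_sum_fubini hS) => c.
  apply: eq_has_sum (has_sumZ (emb A (euler_coef q c * rho ^+ c)) (hY (l + c%:Z))) => k.
  by rewrite /twist_term [LHS]mulrA -[in LHS]rmorphM.
apply: eq_has_sum (has_sum_antidiag hS) => s.
rewrite /twist_coef mulr_suml rmorph_sum mulr_suml; apply: eq_bigr => a _; rewrite /twist_term /=.
have -> : l + a%:Z + (s - a)%N%:Z = l + s%:Z by have := ltn_ord a; lia.
by congr (emb A _ * _); ring.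
Qed.

Hypothesis twist_coef_entire : forall j B, 0 <= B -> bounded_sums (fun s => normc (twist_coef j s) * B ^+ s).

(** The product side of [jacobi_triple_product], that is theta_q(-y). *)
Definition theta_prod (y : A) : A := qlim q A.q * qlim q y * qlim q (A.q / y).

(** Expand both sides as Laurent series in Q and compare coefficients.  On the
   left, the coefficients of theta(Q) (Pq)_oo^n L are given by
   [connection_coefficient], and those of the product with (rho/Q)_oo by
   [twist_coef_rows]; on the right, the triple product for x_j Q is multiplied
   by the entire series of T_j. *)
Lemma global_identity (Q : C) (L : A) (T : 'I_m -> C) : Q != 0 -> normc Q < 1 ->
  has_sum N (fun d => emb A (Q ^+ d) * lhs_coef d) L ->
  (forall j, has_sum NC (fun s => twist_coef j s * Q ^- s) (T j)) ->
  theta_prod (emb A Q) * (L * qlim q (P * A.q) ^+ n) * qlim q (emb A (rho / Q)) =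
  \sum_j other_prods j * kernel_const j * emb A (residue_limit j) * (theta_prod (Palpha j * emb A Q) * emb A (T j)).
Proof.
move=> Q0 Q1 hL hT.
have uQ : emb A Q \is a GRing.unit by rewrite unit_res embK.
have eQz (z : int) : emb A Q ^ z = emb A (Q ^ z).
  by case: z => k; rewrite ?NegzE -?exprnP -?exprnN ?fmorphV ?rmorphXn.
have /choice [Y hY] : forall x : 'I_m * int, exists y,
    has_sum N (fun k : nat => emb A (w x.1 k * theta_coef q (x.2 + k%:Z)) * Palpha x.1 ^ (x.2 + k%:Z)) y.
  move=> [j n0] /=; apply: rn_complete.
  apply: bounded_sums_le (Wterm_sums j n0) => k.
  by apply: le_trans (norm_embM _ _) _; rewrite normcM mulrA.
pose F j := other_prods j * kernel_const j * emb A (residue_limit j).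
pose U n0 := \sum_j F j * Y (j, n0).
have hU n0 : has_sum N (fun d : nat => emb A (theta_coef q (n0 - d%:Z)) * (lhs_coef d * qlim q (P * A.q) ^+ n)) (U n0).
  by apply: connection_coefficient => // j; apply: (hY (j, n0)).
(* The theta series times L, regrouped by the total power of Q. *)
pose u1 (x : int * nat) := (emb A (theta_coef q x.1) * emb A Q ^ x.1) *
   (qlim q (P * A.q) ^+ n * (emb A (Q ^+ x.2) * lhs_coef x.2)).
have bth := theta_coef_power_sums q_gt0 q_lt1 uQ.
have bL : bounded_sums (fun d => N (qlim q (P * A.q) ^+ n * (emb A (Q ^+ d) * lhs_coef d))).
  apply: bounded_sums_le (bounded_sumsZ (rn_ge0 N (qlim q (P * A.q) ^+ n)) (lhs_sums Q1)) => d.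
  exact: rnM.
have b1 : bounded_sums (fun x => N (u1 x)) := bounded_sums_mul bth bL.
have s1 : has_sum N u1 (theta_prod (emb A Q) * (qlim q (P * A.q) ^+ n * L)).
  exact: has_sum_mul bth bL (jacobi_triple_product q_gt0 q_lt1 uQ) (has_sumZ _ hL).
pose f1 (x : int * nat) : int * nat := (x.1 - x.2%:Z, x.2).
have bf1 : bijective f1.
  by exists (fun x : int * nat => (x.1 + x.2%:Z, x.2)) => -[a b]; rewrite /f1 /= ?subrK ?addrK.
have b1' : bounded_sums (fun x => N (u1 (f1 x))) by exact: bounded_sums_inj (bij_inj bf1) b1.
have s1' := has_sum_reindex bf1 s1.
have r1 n0 : has_sum N (fun d => u1 (f1 (n0, d))) (emb A (Q ^ n0) * U n0).
  apply: eq_has_sum (has_sumZ (emb A (Q ^ n0)) (hU n0)) => d.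
  rewrite /u1 /f1 /= eQz.
  rewrite (_ : Q ^ n0 = Q ^ (n0 - d%:Z) * Q ^+ d) ?rmorphM; first by ring.
  by rewrite exprnP -expfzDr // subrK.
have s2 := has_sum_fubini s1' r1.
have b2 := bounded_sums_rows b1' r1.
(* The result times the Euler series of (rho/Q)_oo, regrouped in the same way. *)
pose u2 (x : int * nat) := (emb A (Q ^ x.1) * U x.1) * (emb A (euler_coef q x.2) * emb A (rho / Q) ^+ x.2).
have be := euler_coef_sums q_gt0 q_lt1 (emb A (rho / Q)).
have b3 : bounded_sums (fun x => N (u2 x)) := bounded_sums_mul b2 be.
have s3 : has_sum N u2 (theta_prod (emb A Q) * (qlim q (P * A.q) ^+ n * L) * qlim q (emb A (rho / Q))).
  exact: has_sum_mul b2 be s2 (euler q_gt0 q_lt1 _).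
pose f2 (x : int * nat) : int * nat := (x.1 + x.2%:Z, x.2).
have bf2 : bijective f2.
  by exists (fun x : int * nat => (x.1 - x.2%:Z, x.2)) => -[a b]; rewrite /f2 /= ?subrK ?addrK.
have b3' : bounded_sums (fun x => N (u2 (f2 x))) by exact: bounded_sums_inj (bij_inj bf2) b3.
have s3' := has_sum_reindex bf2 s3.
have /choice [S hS] : forall x : 'I_m * int, exists y,
   has_sum N (fun c : nat => emb A (euler_coef q c * rho ^+ c) * Y (x.1, x.2 + c%:Z)) y /\
   has_sum N (fun s : nat => emb A (twist_coef x.1 s * theta_coef q (x.2 + s%:Z)) * Palpha x.1 ^ (x.2 + s%:Z)) y.
  move=> -[j l] /=.
  by have [S0 h1 h2] := twist_coef_rows l (fun n0 => hY (j, n0)); exists S0.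
have QzS (l : int) (c : nat) : Q ^ (l + c%:Z) / Q ^+ c = Q ^ l.
  by rewrite expfzDr // -exprnP mulfK // expf_neq0.
have r2 l : has_sum N (fun c => u2 (f2 (l, c))) (\sum_j F j * (emb A (Q ^ l) * S (j, l))).
  have h j : has_sum N (fun c : nat => F j * (emb A (Q ^ l) * (emb A (euler_coef q c * rho ^+ c) * Y (j, l + c%:Z))))
      (F j * (emb A (Q ^ l) * S (j, l))).
    by do 2!apply: has_sumZ; have [] := hS (j, l).
  apply: eq_has_sum (has_sum_bigop (index_enum 'I_m) h) => c.
  rewrite /u2 /f2 /= /U mulr_sumr mulr_suml; apply: eq_bigr => j _.
  rewrite -(QzS l c) -rmorphXn exprMn exprVn !rmorphM; ring.
have s4 := has_sum_fubini s3' r2.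
(* The Laurent coefficients of theta(x_j Q) T_j are the same numbers. *)
have s5 j : has_sum N (fun l => emb A (Q ^ l) * S (j, l)) (theta_prod (Palpha j * emb A Q) * emb A (T j)).
  have uxQ : Palpha j * emb A Q \is a GRing.unit by rewrite unitrM ux uQ.
  pose u3 (x : int * nat) := (emb A (theta_coef q x.1) * (Palpha j * emb A Q) ^ x.1) * emb A (twist_coef j x.2 * Q ^- x.2).
  have bT : bounded_sums (fun s : nat => N (emb A (twist_coef j s * Q ^- s))).
    apply: bounded_sums_le (twist_coef_entire j (normc_ge0 Q^-1)) => s.
    by rewrite norm_emb normcM -exprVn normcX.
  have hs : has_sum NC (fun s => twist_coef j s * Q ^- s) (T j) by exact: hT.
  have s6 : has_sum N u3 (theta_prod (Palpha j * emb A Q) * emb A (T j)).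
    exact: has_sum_mul (theta_coef_power_sums q_gt0 q_lt1 uxQ) bT (jacobi_triple_product q_gt0 q_lt1 uxQ) (has_sum_emb A hs).
  apply: (has_sum_fubini (has_sum_reindex bf2 s6)) => l.
  apply: eq_has_sum (has_sumZ (emb A (Q ^ l)) (proj2 (hS (j, l)))) => s.
  rewrite /u3 /f2 /= -(QzS l s) (exprMz_comm (l + s%:Z) (ux j) uQ (mulrC _ _)) eQz !rmorphM; ring.
have s6 := has_sum_bigop (index_enum 'I_m) (fun j => has_sumZ (F j) (s5 j)).
by have := has_sum_uniq s4 s6; rewrite [_ ^+ n * L]mulrC.
Qed.

End TruncatedCoefficients.

(** * Decay of convolutions with Euler coefficients *)

Section Approximation.
Variables (R : realType) (q : R[i]).
Hypotheses (q_gt0 : 0 < normc q) (q_lt1 : normc q < 1).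
Local Notation C := R[i].
Local Notation CC := (complexAlg R).
Local Notation NC := (complexNorm R).
Local Notation r := (normc q).
Let r0 : 0 <= r. Proof. exact: ltW. Qed.
Let r01 : 0 <= r < 1. Proof. by rewrite r0. Qed.
Let q0 := q_neq0 q_gt0.

Lemma normc_sum_le (I : Type) (s : seq I) (P : pred I) (u : I -> C) :
  normc (\sum_(i <- s | P i) u i) <= \sum_(i <- s | P i) normc (u i).
Proof. exact: (rn_sum NC). Qed.

Lemma normc_q_pow k : normc (q ^+ k) <= 1.
Proof. by rewrite normcX; apply: exprn_ile1 => //; apply: ltW. Qed.

(** h has an asymptotic expansion in powers of q^k, to every order d. *)
Definition qpoly_approx (h : nat -> C) : Prop := forall d : nat,
  exists p : {poly C}, exists2 D, 0 <= D & forall k, normc (h k - p.[q ^+ k]) <= D * (r ^+ d) ^+ k.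

Lemma poly_bounded (p : {poly C}) : exists2 B, 0 <= B & forall k, normc p.[q ^+ k] <= B.
Proof.
exists (\sum_(i < size p) normc p`_i) => [|k]; first by apply: sumr_ge0 => i _; exact: normc_ge0.
rewrite horner_coef; apply: le_trans (normc_sum_le _ _ _) _; apply: ler_sum => i _.
rewrite normcM ler_piMr ?normc_ge0 // -exprM; exact: normc_q_pow.
Qed.

Let decay_ge0 d k : 0 <= (r ^+ d) ^+ k. Proof. by rewrite !exprn_ge0. Qed.
Let decay_le1 d k : (r ^+ d) ^+ k <= 1.
Proof. by rewrite -exprM; apply: exprn_ile1 => //; apply: ltW. Qed.

Lemma approx_cst c : qpoly_approx (fun=> c).
Proof.
by move=> d; exists c%:P; exists 0 => // k; rewrite hornerC subrr mul0r; have := normc0 R => ->.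
Qed.

Lemma approxM g h : qpoly_approx g -> qpoly_approx h -> qpoly_approx (fun k => g k * h k).
Proof.
move=> hg hh d; have [p1 [D1 D10 h1]] := hg d; have [p2 [D2 D20 h2]] := hh d.
have [B1 B10 b1] := poly_bounded p1; have [B2 B20 b2] := poly_bounded p2.
exists (p1 * p2), ((D1 + B1) * D2 + D1 * B2) => [|k].
  by rewrite addr_ge0 ?mulr_ge0 ?addr_ge0.
rewrite hornerM (_ : _ - _ = g k * (h k - p2.[q ^+ k]) + (g k - p1.[q ^+ k]) * p2.[q ^+ k]); last by ring.
apply: le_trans (le_normcD _ _) _; rewrite !normcM mulrDl; apply: lerD.
  rewrite -mulrA; apply: ler_pM; rewrite ?normc_ge0 //.
  have := le_normcD (g k - p1.[q ^+ k]) p1.[q ^+ k]; rewrite subrK.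
  have := h1 k; have := b1 k; have := decay_le1 d k.
  have : D1 * (r ^+ d) ^+ k <= D1 by rewrite ler_piMr.
  lra.
by rewrite mulrAC; apply: ler_pM; rewrite ?normc_ge0.
Qed.

Lemma eq_approx g h : g =1 h -> qpoly_approx g -> qpoly_approx h.
Proof.
move=> gh hg d; have [p [D D0 hp]] := hg d; exists p, D => // k.
by rewrite -gh; apply: hp.
Qed.

Lemma approxX h n : qpoly_approx h -> qpoly_approx (fun k => h k ^+ n).
Proof.
move=> hh; elim: n => [|n IH]; first exact: approx_cst.
by apply: eq_approx (approxM hh IH) => k; rewrite exprS.
Qed.

Lemma approx_prod (I : Type) (s : seq I) (P : pred I) (h : I -> nat -> C) :
  (forall i, qpoly_approx (h i)) -> qpoly_approx (fun k => \prod_(i <- s | P i) h i k).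
Proof.
move=> hh; elim: s => [|i s IH].
  by apply: eq_approx (approx_cst 1) => k; rewrite big_nil.
case Pi: (P i).
  by apply: eq_approx (approxM (hh i) IH) => k; rewrite big_cons Pi.
by apply: eq_approx IH => k; rewrite big_cons Pi.
Qed.

Lemma approx_eventually0 h K : (forall k, (K <= k)%N -> h k = 0) -> qpoly_approx h.
Proof.
move=> hK d; exists 0, (\sum_(i < K) normc (h i) / (r ^+ d) ^+ i) => [|k].
  by apply: sumr_ge0 => i _; rewrite divr_ge0 ?normc_ge0.
rewrite horner0 subr0; case: (ltnP k K) => kK; last first.
  rewrite hK //; have := normc0 R => ->; rewrite mulr_ge0 // sumr_ge0 // => i _.
  by rewrite divr_ge0 ?normc_ge0.
rewrite (bigD1 (Ordinal kK)) //= mulrDl divfK; last by rewrite !expf_neq0 // gt_eqF.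
by rewrite lerDl mulr_ge0 // sumr_ge0 // => i _; rewrite divr_ge0 ?normc_ge0.
Qed.

(** h is bounded below and tends to p(0), so p(0) != 0 and p has an inverse u
   modulo X^(d+1); then u approximates 1/h. *)
Lemma approx_inv h c : 0 < c -> (forall k, c <= normc (h k)) ->
  qpoly_approx h -> qpoly_approx (fun k => (h k)^-1).
Proof.
move=> c0 hc hh [|d].
  exists 0, c^-1 => [|k]; first by rewrite invr_ge0 ltW.
  rewrite horner0 subr0 expr0 expr1n mulr1 normcV.
  by rewrite lef_pV2 // posrE (lt_le_trans c0).
have [p [D D0 hp]] := hh d.+1.
(* Otherwise p, hence h, would take arbitrarily small values at q^K. *)
have p0 : ~~ root p 0.
  apply/negP => /factor_theorem [g]; rewrite subr0 => pg.
  have [B B0 hB] := poly_bounded g.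
  have c2 : 0 < c / 2 by lra.
  have [K hK] := power_small r01 (addr_ge0 D0 B0) c2.
  have := hK K (leqnn K); have := hc K; have := hp K.
  rewrite pg hornerM hornerX => h1 h2 h3.
  have := normcB_ge (h K) (g.[q ^+ K] * q ^+ K); rewrite normcM normcX.
  have : normc g.[q ^+ K] * r ^+ K <= B * r ^+ K by apply: ler_wpM2r; rewrite ?exprn_ge0.
  have : D * (r ^+ d.+1) ^+ K <= D * r ^+ K.
    apply: ler_wpM2l => //; rewrite -exprM; apply: ler_wiXn2l => //; first exact: ltW.
    by rewrite mulSn leq_addr.
  move: h3; rewrite mulrDr; lra.
(* p is prime to X, hence invertible modulo X^(d+1). *)
have /Bezout_eq1_coprimepP [[u v] /= uv] : coprimep p 'X^(d.+1).
  by rewrite coprimep_expr // coprimepX.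
have [Bu Bu0 hBu] := poly_bounded u; have [Bv Bv0 hBv] := poly_bounded v.
exists u, (c^-1 * (Bv + Bu * D)) => [|k].
  by rewrite mulr_ge0 ?addr_ge0 ?mulr_ge0 ?invr_ge0 // ltW.
have hk : h k != 0.
  by apply: contraTneq (hc k) => ->; have := normc0 R => ->; rewrite -ltNge.
have e : u.[q ^+ k] * p.[q ^+ k] + v.[q ^+ k] * (q ^+ k) ^+ d.+1 = 1.
  have := congr1 (fun g : {poly C} => g.[q ^+ k]) uv.
  by rewrite hornerD !hornerM hornerXn hornerC.
have -> : (h k)^-1 - u.[q ^+ k] = (h k)^-1 *
   (v.[q ^+ k] * (q ^+ k) ^+ d.+1 - u.[q ^+ k] * (h k - p.[q ^+ k])).
  rewrite (_ : v.[_] * _ - _ = 1 - u.[q ^+ k] * h k); last by rewrite -e; ring.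
  by field.
rewrite normcM -mulrA; apply: ler_pM; rewrite ?normc_ge0 //.
  by rewrite normcV lef_pV2 // posrE (lt_le_trans c0).
apply: le_trans (le_normcD _ _) _; rewrite normcN !normcM mulrDl; apply: lerD.
  by rewrite exprAC !normcX; apply: ler_wpM2r.
by rewrite -mulrA; apply: ler_pM; rewrite ?normc_ge0.
Qed.

Lemma euler_tail (x : C) : exists2 B, 0 <= B & forall s t : nat,
  normc (qlim q (x * q ^+ t : CC) - \sum_(a < s) euler_coef q a * (x * q ^+ t) ^+ a) <= B * r ^+ (t * s).
Proof.
have hx := euler_coef_sums q_gt0 q_lt1 (x : CC); have [B hB] := hx.
have B0 : 0 <= B by apply: le_trans (hB fset0); rewrite big_seq_fset0.
exists B => // s t; set y := x * q ^+ t.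
have h1 : has_sum NC (fun a => euler_coef q a * y ^+ a) (qlim q (y : CC)) by exact: (euler q_gt0 q_lt1 (y : CC)).
have h2 := @has_sum_nat_fin _ _ NC (fun a => if (a < s)%N then euler_coef q a * y ^+ a else 0) s.
have h3 := has_sumD h1 (has_sumZ (-1) (h2 _)).
rewrite (_ : \sum_(a < s) _ = \sum_(a < s) (if (a < s)%N then euler_coef q a * y ^+ a else 0)); last first.
  by apply: eq_bigr => a _; rewrite ltn_ord.
rewrite -mulN1r; apply: has_sum_norm (h3 _) _; first by move=> k; rewrite leqNgt => /negPf ->.
move=> F; apply: le_trans (_ : \sum_(a <- F) normc (euler_coef q a * x ^+ a) * r ^+ (t * s) <= _); last first.
  by rewrite -mulr_suml; apply: ler_wpM2r; [rewrite exprn_ge0|exact: hB].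
apply: ler_sum => a _; case: ltnP => h.
  rewrite mulN1r subrr; have := normc0 R; rewrite /= => ->.
  by rewrite mulr_ge0 ?normc_ge0 ?exprn_ge0.
rewrite mulr0 addr0 /y exprMn mulrA [X in X <= _]normcM.
apply: ler_wpM2l; first exact: normc_ge0.
rewrite -exprM normcX; apply: ler_wiXn2l => //; first exact: ltW.
by rewrite leq_mul2l h orbT.
Qed.

Lemma approx_qlim (y : C) : qpoly_approx (fun k => qlim q (y * q ^+ k : CC)).
Proof.
move=> d; have [B B0 hB] := euler_tail y.
exists (\sum_(a < d) (euler_coef q a * y ^+ a) *: 'X^a), B => // k.
rewrite horner_sum (eq_bigr (fun a : 'I_d => euler_coef q a * (y * q ^+ k) ^+ a)) => [|a _].
  by rewrite -exprM mulnC; apply: hB.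
by rewrite hornerZ hornerXn exprMn mulrA.
Qed.

Lemma qlim_qpoch (y : C) k : qlim q (y : CC) = qpoch y q k * qlim q (y * q ^+ k : CC).
Proof. exact: (@qlim_shift _ _ q_gt0 q_lt1 CC). Qed.

(** 1 / (y)_k = (y q^k)_oo / (y)_oo, and (y q^k)_oo is given by its Euler
   series. *)
Lemma approx_qpochV (y : C) : (forall k, y * q ^+ k != 1) -> qpoly_approx (fun k => (qpoch y q k)^-1).
Proof.
move=> hy; have h : qlim q (y : CC) != 0.
  by rewrite -unitfE; apply: (@qlim_unit _ _ _ _ CC).
apply: eq_approx (approxM (approx_cst (qlim q (y : CC))^-1) (approx_qlim y)) => k.
have hk : qlim q (y * q ^+ k : CC) != 0.
  by apply: contraNneq h => e; rewrite (qlim_qpoch y k) e mulr0.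
rewrite (qlim_qpoch y k) invfM -mulrA (mulVf hk); exact: mulr1.
Qed.

(** Either some factor vanishes and the sequence is eventually zero, or it is
   the inverse of the sequence of [approx_qpochV]. *)
Lemma approx_qpoch (y : C) : qpoly_approx (qpoch y q).
Proof.
have [[k /eqP yk]|hy] := pselect (exists k, y * q ^+ k == 1).
  apply: (@approx_eventually0 _ k.+1) => d kd.
  by rewrite -(subnKC kd) qpochD qpochS yk subrr mulr0 mul0r.
have hy' k : y * q ^+ k != 1 by apply/negP => e; apply: hy; exists k.
have [c c0 hc] := qpoch_lower q_gt0 q_lt1 hy'.
have E0 : 0 < expR (normc y / (1 - r)) by exact: expR_gt0.
apply: eq_approx (approx_inv (c := (expR (normc y / (1 - r)))^-1) _ _ (approx_qpochV hy')) => [k||k].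
- by rewrite invrK.
- by rewrite invr_gt0.
rewrite normcV lef_pV2 ?posrE //; last by rewrite (lt_le_trans c0).
by apply: (@qpoch_norm_le _ _ _ _ CC).
Qed.

(** Since (q^(-i))_oo = 0, partial sums of its Euler series are minus the
   tails.  To see the decay at rate d, apply [euler_tail] to
   q^(-i) = q^(-i-d) q^d. *)
Lemma euler_partial (i d : nat) : exists2 D, 0 <= D & forall s,
  normc (\sum_(a < s.+1) euler_coef q a * (q ^- i) ^+ a) <= D * (r ^+ d) ^+ s.
Proof.
have [B B0 hB] := euler_tail (q ^- (i + d)).
exists B => // s; have := hB s.+1 d.
have -> : q ^- (i + d) * q ^+ d = q ^- i.
  by rewrite exprD invfM -mulrA mulVf ?mulr1 // expf_neq0.
have -> : qlim q (q ^- i : CC) = 0.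
  rewrite (qlim_qpoch (q ^- i) i.+1) qpochS mulVf ?expf_neq0 // subrr mulr0.
  exact: mul0r.
rewrite sub0r normcN => h; apply: le_trans h _; apply: ler_wpM2l => //.
by rewrite -exprM; apply: ler_wiXn2l => //; [exact: ltW|rewrite mulnS leq_addl].
Qed.

(** Replace h by its approximation p of order d.  For the monomial X^i, the
   convolution is q^(is) times the partial sum of [euler_partial]; the error
   is a convolution of two geometrically decaying sequences. *)
Lemma convolution_decay h d : qpoly_approx h -> exists2 D, 0 <= D & forall s,
  normc (\sum_(a < s.+1) euler_coef q a * h (s - a)%N) <= D * (r ^+ d) ^+ s.
Proof.
move=> hh; have [p [D D0 hp]] := hh d.
have /choice [E hE] : forall i : 'I_(size p), exists E, 0 <= E /\ forall s,
   normc (\sum_(a < s.+1) euler_coef q a * (q ^- i) ^+ a) <= E * (r ^+ d) ^+ s.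
  by move=> i; have [E E0 hE] := euler_partial i d; exists E.
have rV : 0 <= (r ^+ d)^-1 by rewrite invr_ge0 exprn_ge0.
have [D1 D10 hD1] := euler_coef_bound q_gt0 q_lt1 rV.
have rdn : r ^+ d != 0 by rewrite expf_neq0 // gt_eqF.
exists (\sum_(i < size p) normc p`_i * E i + D * (D1 * 2)) => [|s].
  rewrite addr_ge0 ?mulr_ge0 // sumr_ge0 // => i _; rewrite mulr_ge0 ?normc_ge0 //.
  by case: (hE i).
rewrite (eq_bigr (fun a : 'I_s.+1 => euler_coef q a * p.[q ^+ (s - a)] + euler_coef q a * (h (s - a)%N - p.[q ^+ (s - a)]))); last first.
  by move=> a _; rewrite -mulrDr addrC subrK.
rewrite big_split /= mulrDl; apply: le_trans (le_normcD _ _) _; apply: lerD.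
  have -> : \sum_(a < s.+1) euler_coef q a * p.[q ^+ (s - a)] =
     \sum_(i < size p) p`_i * q ^+ (i * s) * \sum_(a < s.+1) euler_coef q a * (q ^- i) ^+ a.
    under [RHS]eq_bigr do rewrite mulr_sumr.
    rewrite exchange_big /=; apply: eq_bigr => a _; rewrite horner_coef mulr_sumr.
    apply: eq_bigr => i _.
    have -> : (q ^+ (s - a)) ^+ i = q ^+ (i * s) * (q ^- i) ^+ a.
      rewrite exprVn -!exprM; apply: (mulIf (expf_neq0 (i * a) q0)).
      rewrite mulfVK ?expf_neq0 // -exprD; congr (q ^+ _).
      by have := ltn_ord a; rewrite ltnS => h1; rewrite mulnC -mulnDr subnK.
    by ring.
  rewrite mulr_suml; apply: le_trans (normc_sum_le _ _ _) _; apply: ler_sum => i _.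
  rewrite normcM -[X in _ <= X]mulrA; apply: ler_pM; rewrite ?normc_ge0 //.
    by rewrite normcM ler_piMr ?normc_ge0 ?normc_q_pow.
  by case: (hE i).
apply: le_trans (normc_sum_le _ _ _) _.
apply: le_trans (_ : \sum_(a < s.+1) (D * (r ^+ d) ^+ s) * (D1 * (1/2) ^+ a) <= _).
  apply: ler_sum => a _; have as1 : (a <= s)%N by rewrite -ltnS.
  rewrite normcM; apply: le_trans (_ : normc (euler_coef q a) * (D * (r ^+ d) ^+ (s - a)) <= _).
    by apply: ler_wpM2l; rewrite ?normc_ge0.
  rewrite (_ : _ * _ = D * (r ^+ d) ^+ s * (normc (euler_coef q a) * (r ^+ d)^-1 ^+ a)).
    by apply: ler_wpM2l; rewrite ?mulr_ge0.
  have -> : (r ^+ d) ^+ s = (r ^+ d) ^+ (s - a) * (r ^+ d) ^+ a by rewrite -exprD subnK.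
  by rewrite exprVn; field; exact: expf_neq0.
rewrite -mulr_sumr mulrAC; apply: ler_wpM2r => //; apply: ler_wpM2l => //.
rewrite -mulr_sumr; apply: ler_wpM2l => //.
have h2 : 0 <= (1/2 : R) < 1 by lra.
by apply: le_trans (geometric_sum_le _ h2) _; rewrite (_ : (1 - 1/2)^-1 = 2 :> R) //; field.
Qed.

End Approximation.

(** * Entire power series *)

Section ComplexTopology.
Variable R : realType.
Local Notation C := R[i].
Local Notation NC := (complexNorm R).

Lemma normc_normr (x : C) : `|x| = (normc x)%:C%C.
Proof. by case: x. Qed.

Lemma gt0_real_complex (e : C) : 0 < e -> exists2 d : R, 0 < d & e = d%:C%C.
Proof.
case: e => a b; rewrite ltcE /= => /andP [/eqP b0 a0].
by exists a => //; rewrite b0.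
Qed.

Lemma tends_cvg (T : Type) (G : set_system T) (FG : Filter G) (u : T -> C^o) (s : C^o) :
  tends NC G u s -> u @ G --> s.
Proof.
move=> h; apply/cvgrPdist_le => _ /gt0_real_complex [e e0 ->].
apply: filterS (h e e0) => t ht.
by rewrite distrC normc_normr lecR.
Qed.

Lemma climn_tends (u : nat -> C) s : tends NC \oo u s -> climn u = s.
Proof.
move=> h; apply: (@cvg_lim C^o (@norm_hausdorff _ C^o)).
exact: tends_cvg.
Qed.

Lemma near0_normc (e : R) : 0 < e -> \forall h \near (0 : C^o), normc h <= e.
Proof.
move=> e0; have e0' : (0 : C) < e%:C%C by rewrite ltcR.
apply: filterS (nbhs0_le (V := C^o) e0') => h.
by rewrite normc_normr lecR.
Qed.

Lemma tends_id0 : tends NC (0 : C^o)^' (fun h => h) 0.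
Proof.
move=> e e0; apply: filterS (nbhs_dnbhs (near0_normc e0)) => h.
by rewrite subr0.
Qed.

Definition entire_coef (c : nat -> C) := forall B : R, 0 <= B ->
  bounded_sums (fun k => normc (c k) * B ^+ k).

(** The difference quotient of y^k is a sum of k monomials; its series is
   dominated uniformly for |h| <= 1, so its limit exists by [tannery]. *)
Lemma entire_derivable (c : nat -> C) (S : C -> C) (z : C) :
  entire_coef c -> (forall y, has_sum NC (fun k => c k * y ^+ k) (S y)) ->
  derivable (S : C^o -> C^o) z 1.
Proof.
move=> hc hS.
(* The difference quotients of the terms c_k y^k at z. *)
pose u (h : C) (k : nat) : C := c k * \sum_(a < k) (z + h) ^+ (k.-1 - a) * z ^+ a.
pose b (k : nat) : R := normc (c k) * (2 * (normc z + 1)) ^+ k.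
have z0 := normc_ge0 z.
have hb : bounded_sums b by apply: hc; lra.
have ub (h : C) k : normc h <= 1 -> normc (u h k) <= b k.
  move=> h1; rewrite /u /b normcM; apply: ler_wpM2l; first exact: normc_ge0.
  apply: le_trans (normc_sum_le _ _ _) _.
  apply: le_trans (_ : \sum_(a < k) (normc z + 1) ^+ k <= _).
    apply: ler_sum => a _; rewrite normcM !normcX.
    apply: le_trans (_ : (normc z + 1) ^+ (k.-1 - a) * (normc z + 1) ^+ a <= _).
      apply: ler_pM; rewrite ?exprn_ge0 ?normc_ge0 //; apply: lerXn2r; rewrite ?nnegrE ?normc_ge0 //; try lra.
      by have := le_normcD z h; lra.
    rewrite -exprD; apply: ler_weXn2l; first lra.
    by have := ltn_ord a; lia.
  rewrite sumr_const card_ord -[X in X <= _]mulr_natl exprMn; apply: ler_wpM2r.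
    by rewrite exprn_ge0 //; lra.
  by rewrite -natrX ler_nat ltnW // ltn_expl.
have /choice [Phi hPhi] : forall h, exists s, normc h <= 1 -> has_sum NC (u h) s.
  move=> h; have [h1|h1] := pselect (normc h <= 1); last by exists 0.
  have [s hs] := @rn_complete _ _ NC _ (u h) (bounded_sums_le (fun k => ub h k h1) hb).
  by exists s.
have n0 : normc (0 : C) <= 1 by have := normc0 R => ->.
have near1 : \forall h \near (0 : C^o)^', normc h <= 1 by exact: nbhs_dnbhs (near0_normc ltr01).
have hlim : tends NC (0 : C^o)^' Phi (Phi 0).
  apply: (tannery (u := u) _ hb _ _ (hPhi 0 n0)).
  - move=> k; rewrite /u; apply: tendsZ; apply: tends_sum => a.
    apply: tendsM; last exact: tends_cst.
    by apply: tendsX; apply: tendsD; [exact: tends_cst|exact: tends_id0].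
  - by apply: filterS near1 => h h1 k; apply: ub.
  - by apply: filterS near1 => h; apply: hPhi.
have hq h : normc h <= 1 -> S (z + h) - S z = h * Phi h.
  move=> h1; have h2 := has_sumD (hS (z + h)) (has_sumZ (-1) (hS z)).
  rewrite mulN1r in h2; apply: has_sum_uniq h2 _.
  apply: eq_has_sum (has_sumZ h (hPhi h h1)) => k.
  rewrite /u mulrCA mulN1r -mulrBr; congr (_ * _).
  by rewrite subrXX addrAC subrr add0r.
apply/cvg_ex; exists (Phi 0).
apply: tends_cvg; apply: (tends_near_eq _ hlim).
have nz : \forall h \near (0 : C^o)^', h != 0 by apply: nbhs_dnbhs_neq.
apply: filterS2 near1 nz => h h1 hn /=.
have e : h *: (1 : C^o) = h by exact: mulr1.
rewrite /= e (_ : h + z = z + h) ?(hq h h1); last exact: addrC.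
  by rewrite -[RHS]/(h^-1 * (h * Phi h)) mulKf.
Qed.

End ComplexTopology.

(** * Analytic continuation of W_j *)

Section Continuation.
Variables (R : realType) (q : R[i]) (m n : nat) (alpha : 'I_m -> R[i]).
Hypotheses (q_gt0 : 0 < normc q) (q_lt1 : normc q < 1).
Hypothesis (nm : (n <= m)%N).
Hypotheses (alpha0 : forall j, alpha j != 0) (alpha_inj : injective alpha).
Hypothesis alpha_sep : forall (i j : 'I_m) (k : int), k != 0 -> alpha i != alpha j * q ^ k.
Local Notation C := R[i].
Local Notation CC := (complexAlg R).
Local Notation NC := (complexNorm R).
Local Notation r := (normc q).
Local Notation w := (Wcoef q n alpha).
Let r0 : 0 <= r. Proof. exact: ltW. Qed.
Let r01 : 0 <= r < 1. Proof. by rewrite r0. Qed.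
Let q0 := q_neq0 q_gt0.

(** For m = n the poles of the continued W_j are the zeros of (rho z)_oo; for
   n < m there are none and the choice rho = 0 makes this product 1. *)
Definition rho : C := if m == n then q ^+ n / \prod_i alpha i else 0.
Local Notation twist_coef := (twist_coef q n alpha rho).

(** w_jk / rho^k in the case m = n. *)
Definition reduced_coef (j : 'I_m) (k : nat) : C :=
  qpoch (alpha j) q k ^+ n * \prod_i (qpoch (q * (alpha j / alpha i)) q k)^-1.

Lemma ratio_pole_free i j k : q * (alpha j / alpha i) * q ^+ k != 1.
Proof.
have := alpha_sep i j (k := k.+1) isT; apply: contra => /eqP h.
apply/eqP; rewrite -[LHS]mulr1 -h -exprnP exprS; field; exact: alpha0.
Qed.

Lemma reduced_coef_approx j : qpoly_approx q (reduced_coef j).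
Proof.
apply: approxM => //; first by apply: approxX => //; exact: approx_qpoch.
apply: (approx_prod q_gt0 q_lt1) => i; apply: approx_qpochV => // k.
exact: ratio_pole_free.
Qed.

(** Each factor 1 - a q^(-s) is written as - a q^(-s) (1 - q^s / a); for m = n
   the powers of q cancel between numerator and denominator up to rho^k. *)
Lemma Wcoef_equal_rank j k : m = n -> w j k = rho ^+ k * reduced_coef j k.
Proof.
(* As m = n, the power of q can be distributed over the m factors. *)
move=> mn; have rhoE : rho = \prod_i (q / alpha i).
  rewrite /rho ifT; last by apply/eqP.
  by rewrite big_split /= prodr_const card_ord prodfV -mn.
elim: k => [|k IH].
  rewrite Wcoef0 expr0 mul1r /reduced_coef qpoch0 expr1n mul1r big1 // => i _.
  by rewrite qpoch0 invr1.
rewrite WcoefS // IH [rho ^+ k.+1]exprSr -[LHS]mulrA -[RHS]mulrA; congr (_ * _).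
have powE (x : C) : x ^+ n = \prod_(i < m) x by rewrite prodr_const card_ord mn.
rewrite /reduced_coef qpochS exprMn.
have -> : \prod_i (qpoch (q * (alpha j / alpha i)) q k.+1)^-1 =
    \prod_i (qpoch (q * (alpha j / alpha i)) q k)^-1 *
    \prod_i (1 - q * (alpha j / alpha i) * q ^+ k)^-1.
  by rewrite -big_split; apply: eq_bigr => i _; rewrite qpochS invfM.
rewrite [X in _ = _ * X]mulrACA [RHS]mulrCA; congr (_ * _).
rewrite rhoE !powE -!big_split; apply: eq_bigr => i _ /=.
have aj := alpha0 j; have ai := alpha0 i; have Qk : q ^+ k != 0 by exact: expf_neq0.
have h1 : 1 - q * (alpha j / alpha i) * q ^+ k != 0.
  by rewrite subr_eq0 eq_sym ratio_pole_free.
have h2 : alpha i - q * alpha j * q ^+ k != 0.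
  apply: contra h1 => /eqP h; apply/eqP.
  rewrite (_ : _ - _ = (alpha i - q * alpha j * q ^+ k) / alpha i); first by rewrite h mul0r.
  by field.
have h3 : alpha j * (q * q ^+ k) - alpha i != 0.
  apply: contra h2 => /eqP h; apply/eqP.
  by rewrite (_ : _ - _ = - (alpha j * (q * q ^+ k) - alpha i)); [rewrite h oppr0|ring].
by rewrite exprS; field; rewrite ai h2 Qk q0 aj h3.
Qed.

(** For m = n this is [convolution_decay] with d so large that r^d |rho| B is
   at most 1/2; for n < m the twist is trivial and [Wcoef_bound] suffices. *)
Lemma twist_coef_entire j : entire_coef (twist_coef j).
Proof.
move=> B B0; have [mn|mn] := eqVneq m n.
  have c0 : 0 <= normc rho * B by rewrite mulr_ge0 ?normc_ge0.
  have h1 : 0 < (1/2 : R) by lra.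
  have [d hd] := power_small r01 c0 h1.
  have [D D0 hD] := convolution_decay q_gt0 q_lt1 d (reduced_coef_approx j).
  apply: (@bounded_sums_half _ D) => s.
  have -> : twist_coef j s = rho ^+ s * \sum_(a < s.+1) euler_coef q a * reduced_coef j (s - a).
    rewrite /twist_coef mulr_sumr; apply: eq_bigr => a _.
    rewrite Wcoef_equal_rank //.
    have -> : rho ^+ s = rho ^+ a * rho ^+ (s - a) by rewrite -exprD subnKC // -ltnS.
    by ring.
  rewrite normcM normcX -mulrA.
  apply: le_trans (_ : normc rho ^+ s * (D * (r ^+ d) ^+ s * B ^+ s) <= _).
    apply: ler_wpM2l; first by rewrite exprn_ge0 ?normc_ge0.
    by apply: ler_wpM2r; rewrite ?exprn_ge0.
  rewrite (_ : _ * _ = D * (r ^+ d * (normc rho * B)) ^+ s); last by rewrite !exprMn; ring.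
  apply: ler_wpM2l => //; apply: lerXn2r; rewrite ?nnegrE; last exact: hd.
    by rewrite mulr_ge0 ?exprn_ge0.
  by lra.
have [K K1 hK] := Wcoef_bound q_gt0 q_lt1 alpha0 alpha_sep j nm.
have K0 : 0 <= K by apply: le_trans K1.
have [D D0 hD] := superexponential r01 (mulr_ge0 K0 B0).
apply: (@bounded_sums_half _ D) => s; apply: le_trans (hD s).
have -> : twist_coef j s = w j s.
  rewrite /twist_coef big_ord_recl big1 => [|a _]; last first.
    by rewrite /rho (negPf mn) expr0n /= mulr0 mul0r.
  rewrite addr0 /euler_coef subn0 qpoch0 (_ : 'C(ord0, 2) = 0%N) // !expr0 invr1.
  by rewrite !mul1r.
rewrite exprMn mulrA; apply: ler_wpM2r; first exact: exprn_ge0.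
apply: le_trans (hK s) _; rewrite mulrC; apply: ler_wpM2r; first exact: exprn_ge0.
apply: ler_wiXn2l => //; first exact: ltW.
by rewrite leq_pmull // subn_gt0 ltn_neqAle eq_sym mn.
Qed.

Definition twist_sum (j : 'I_m) (z : C) : C := climn (series (fun s => twist_coef j s * z ^+ s)).

Lemma twist_sum_has_sum j z : has_sum NC (fun s => twist_coef j s * z ^+ s) (twist_sum j z).
Proof.
have hb : bounded_sums (fun s => normc (twist_coef j s * z ^+ s)).
  apply: bounded_sums_le (twist_coef_entire j (normc_ge0 z)) => s.
  by rewrite normcM normcX.
have [s hs] := @rn_complete _ _ NC _ _ hb.
by rewrite /twist_sum (climn_tends (has_sum_series hs)).
Qed.

(** The quotient of an entire function by (rho z)_oo. *)
Definition Wcont (j : 'I_m) (z : C) : C := twist_sum j z / qlim q (rho * z : CC).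

Lemma denominator_derivable z : derivable ((fun y : C => qlim q (rho * y : CC)) : C^o -> C^o) z 1.
Proof.
apply: (@entire_derivable _ (fun k => euler_coef q k * rho ^+ k)) => [B B0|y].
  have [D D0 hD] := euler_coef_bound q_gt0 q_lt1 (mulr_ge0 (normc_ge0 rho) B0).
  apply: (@bounded_sums_half _ D) => k; apply: le_trans (hD k).
  by rewrite normcM normcX exprMn mulrA.
by apply: eq_has_sum (euler q_gt0 q_lt1 (rho * y : CC)) => k; rewrite exprMn mulrA.
Qed.

Lemma denominator_neq0 z : (forall k, rho * z * q ^+ k != 1) -> qlim q (rho * z : CC) != 0.
Proof. by move=> h; rewrite -unitfE; apply: (@qlim_unit _ _ _ _ CC). Qed.

(** The zeros of (rho z)_oo are z = 1 / (rho q^k). *)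
Lemma Wdom_denominator z : Wdom q n alpha z -> forall k, rho * z * q ^+ k != 1.
Proof.
move=> hz k; rewrite /rho; case: (eqVneq m n) => mn; last by rewrite !mul0r eq_sym oner_eq0.
apply/negP => /eqP h; apply: (hz mn k).
have Pi0 : \prod_i alpha i != 0 by apply/prodf_neq0.
apply: (mulfI (_ : q ^+ n / (\prod_i alpha i) * q ^+ k != 0)).
  by rewrite !mulf_neq0 ?invr_eq0 ?expf_neq0.
rewrite mulrAC h exprD; field; rewrite !expf_neq0 //.
Qed.

Lemma Wcont_derivable j z : Wdom q n alpha z -> derivable (Wcont j : C^o -> C^o) z 1.
Proof.
move=> hz.
have h1 : derivable (twist_sum j : C^o -> C^o) z 1.
  exact: entire_derivable (twist_coef_entire j) (twist_sum_has_sum j).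
have h0 : derivable ((fun y : C => qlim q (rho * y : CC)) : C^o -> C^o) z 1.
  exact: denominator_derivable.
have h2 : derivable (fun y : C^o => (qlim q (rho * y : CC))^-1 : C^o) z 1.
  apply: (derivableV _ h0); exact: denominator_neq0 (Wdom_denominator hz).
exact: derivableM h1 h2.
Qed.

(** For small z the series of W_j converges absolutely, so [twist_sum] is its
   Cauchy product with (rho z)_oo. *)
Lemma Wcont_series j : \forall z \near (0 : C^o),
  (series (fun d => w j d * z ^+ d) : nat -> C^o) @ \oo --> (Wcont j z : C^o).
Proof.
have [K K1 hK] := Wcoef_bound q_gt0 q_lt1 alpha0 alpha_sep j nm.
have K0 : 0 <= K by apply: le_trans K1.
have rh := normc_ge0 rho.
have e0 : 0 < 1/2 / (K + normc rho) by apply: divr_gt0; lra.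
apply: filterS (near0_normc e0) => z hz.
have hz' : normc z * (K + normc rho) <= 1/2 by rewrite -ler_pdivlMr //; lra.
have zz := normc_ge0 z.
have Kz : K * normc z <= 1/2.
  have : 0 <= normc z * normc rho by rewrite mulr_ge0.
  by move: hz'; rewrite mulrDr [K * _]mulrC; lra.
have rz : normc rho * normc z <= 1/2.
  have : 0 <= normc z * K by rewrite mulr_ge0.
  by move: hz'; rewrite mulrDr [normc rho * _]mulrC; lra.
have bw : bounded_sums (fun k => normc (w j k * z ^+ k)).
  apply: (@bounded_sums_half _ 1) => k; rewrite [leRHS]mul1r normcM normcX.
  apply: le_trans (_ : (K * normc z) ^+ k <= _).
    rewrite exprMn; apply: ler_wpM2r; first by rewrite exprn_ge0.
    apply: le_trans (hK k) _; rewrite ler_piMr ?exprn_ge0 //.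
    by apply: exprn_ile1 => //; apply: ltW.
  by apply: lerXn2r; rewrite ?nnegrE ?mulr_ge0 //; lra.
have [s hs] := @rn_complete _ _ NC _ _ bw.
have be := euler_coef_sums q_gt0 q_lt1 (rho * z : CC).
have hp := has_sum_antidiag (has_sum_mul be bw (euler q_gt0 q_lt1 (rho * z : CC)) hs).
(* Cauchy product of the Euler series with the convergent series of W_j. *)
have e : twist_sum j z = qlim q (rho * z : CC) * s.
  apply: has_sum_uniq (twist_sum_has_sum j z) _; apply: eq_has_sum hp => k.
  rewrite /twist_coef mulr_suml; apply: eq_bigr => a _ /=.
  have -> : z ^+ k = z ^+ a * z ^+ (k - a) by rewrite -exprD subnKC // -ltnS.
  by rewrite exprMn; ring.
have nz : qlim q (rho * z : CC) != 0.
  apply: denominator_neq0 => k; apply/negP => /eqP /(congr1 (@normc R)).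
  rewrite !normcM; have := normc1 R => -> h.
  have h3 : normc (q ^+ k) <= 1 by apply: normc_q_pow.
  have : normc rho * normc z * normc (q ^+ k) <= 1/2 * 1.
    by apply: ler_pM; rewrite ?mulr_ge0 ?normc_ge0.
  by rewrite h; lra.
have -> : Wcont j z = s by rewrite /Wcont e mulrC mulKf.
apply: tends_cvg; exact: has_sum_series.
Qed.

End Continuation.

(** * The connection formula *)

Section ConnectionFormula.
Variables (R : realType) (q : R[i]) (m n : nat) (alpha : 'I_m -> R[i]).
Hypotheses (q_gt0 : 0 < normc q) (q_lt1 : normc q < 1).
Hypothesis (nm : (n <= m)%N).
Hypotheses (alpha0 : forall j, alpha j != 0) (alpha_inj : injective alpha).
Hypothesis alpha_sep : forall (i j : 'I_m) (k : int), k != 0 -> alpha i != alpha j * q ^ k.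
Hypothesis alpha_nopole : forall (j : 'I_m) (k : nat), alpha j != q ^+ k.+1.
Hypothesis n_gt0 : (0 < n)%N.
Local Notation C := R[i].
Local Notation CC := (complexAlg R).
Local Notation "x .q" := (emb x q) (at level 2, format "x .q").

Variables (A : localAlg R) (P : A).
Hypotheses (resP : res A P = 1) (nilP : (1 - P) ^+ n = 0).
Local Notation N := (la_norm A).
Local Notation Palpha := (Palpha alpha P).

Lemma qlim_Pq_unit : qlim q (P * A.q) \is a GRing.unit.
Proof.
apply: qlim_unit => // k; rewrite rmorphM resP mul1r embK; exact: qq_no_zero.
Qed.

Lemma qlim_qx_unit j : qlim q (A.q / Palpha j) \is a GRing.unit.
Proof.
apply: qlim_unit => // k; rewrite rmorphM rmorphV ?Palpha_unit // embK res_Palpha //.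
apply: contra (alpha_nopole j k) => /eqP h; apply/eqP.
by rewrite -[LHS]mul1r -h exprS; field; exact: alpha0.
Qed.

(** [global_identity] divided by its invertible factors. *)
Lemma connection_formula (Q : C) (L : A) : Q != 0 -> normc Q < 1 ->
  has_sum N (fun d => emb A (Q ^+ d) * lhs_coef q n alpha P d) L ->
  qlim q (Q : CC) != 0 -> qlim q (q / Q : CC) != 0 -> Wdom q n alpha (1 / Q) ->
  L = (qlim q (P * A.q) ^+ n)^-1 * \sum_j other_prods q alpha P j *
    (qlim q A.q * qlim q A.q * qlim q (Palpha j * emb A Q) * qlim q (A.q / (Palpha j * emb A Q))) /
    (qlim q (A.q / Palpha j) * qlim q (emb A Q) * qlim q (A.q / emb A Q)) *
    emb A (residue_limit q n alpha j * Wcont q n alpha j (1 / Q)).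
Proof.
move=> Q0 Q1 hL hQ hqQ hW.
pose T j := twist_sum q n alpha j (1 / Q).
have hT j : has_sum (complexNorm R) (fun s => twist_coef q n alpha (rho q n alpha) j s * Q ^- s) (T j).
  apply: eq_has_sum (twist_sum_has_sum q_gt0 q_lt1 nm alpha0 alpha_sep j (1 / Q)) => s.
  by rewrite div1r exprVn.
have h := global_identity q_gt0 q_lt1 nm alpha0 alpha_inj alpha_sep alpha_nopole resP nilP n_gt0
  (twist_coef_entire q_gt0 q_lt1 nm alpha0 alpha_sep) Q0 Q1 hL hT.
have D0 : qlim q (rho q n alpha / Q : CC) != 0.
  apply: denominator_neq0 => // k; have := Wdom_denominator q_gt0 alpha0 hW k.
  by rewrite div1r.
have u1 : qlim q (emb A Q) \is a GRing.unit by rewrite -(emb_qlim q_gt0 q_lt1); exact: (@emb_unit _ A _ hQ).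
have qQ : A.q / emb A Q = emb A (q / Q) by rewrite rmorphM rmorphV // unitfE.
have u2 : qlim q (A.q / emb A Q) \is a GRing.unit.
  by rewrite qQ -(emb_qlim q_gt0 q_lt1); exact: (@emb_unit _ A _ hqQ).
have u0 : qlim q A.q \is a GRing.unit by rewrite -(emb_qlim q_gt0 q_lt1); apply: emb_unit; exact: qq_unit.
have u3 := qlim_Pq_unit; have u4 : qlim q (emb A (rho q n alpha / Q)) \is a GRing.unit.
  by rewrite -(emb_qlim q_gt0 q_lt1); exact: (@emb_unit _ A _ D0).
have u5 : theta_prod q (emb A Q) \is a GRing.unit by rewrite /theta_prod !unitrM u0 u1 u2.
have u6 : qlim q (P * A.q) ^+ n \is a GRing.unit by rewrite unitrX.
apply: (mulrI u6); rewrite mulVKr // [LHS]mulrC.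
apply: (mulrI u5); apply: (mulIr u4); rewrite h mulr_sumr mulr_suml; apply: eq_bigr => j _.
have u7 := qlim_qx_unit j.
have -> : emb A (residue_limit q n alpha j * Wcont q n alpha j (1 / Q)) =
   emb A (residue_limit q n alpha j) * emb A (T j) / qlim q (emb A (rho q n alpha / Q)).
  rewrite -(emb_qlim q_gt0 q_lt1) -(rmorphV _ (_ : _ \is a GRing.unit)) ?unitfE //.
  by rewrite -!rmorphM /Wcont div1r mulrA /T div1r.
rewrite /kernel_const /theta_prod rmorphM !(emb_qlim q_gt0 q_lt1).
set a := qlim q A.q; set b := qlim q (emb A Q); set c := qlim q (A.q / emb A Q).
set d := qlim q (A.q / Palpha j); set e := qlim q (emb A (_ / _)).
rewrite (_ : (d * b * c)^-1 = d^-1 * b^-1 * c^-1); last first.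
  by rewrite !invrM ?unitrM ?u7 ?u1 ?u2 // mulrC [d^-1 * _]mulrC.
have hb : b / b = 1 by rewrite divrr.
have hc : c / c = 1 by rewrite divrr.
have he : e / e = 1 by rewrite divrr.
set x0 := other_prods _ _ _ _; set s := emb A (residue_limit _ _ _ _); set t := emb A (T j).
set y := qlim q (Palpha j * _); set z := qlim q (A.q / (Palpha j * _)).
rewrite [RHS](_ : _ = x0 * (a * a * d^-1) * s * (a * y * z * t) * (b / b) * (c / c) * (e / e)); last by ring.
by rewrite hb hc he !mulr1.
Qed.

End ConnectionFormula.

Section Translation.
Variables (R : realType) (q : R[i]).
Hypotheses (q_gt0 : 0 < normc q) (q_lt1 : normc q < 1).
Local Notation C := R[i].
Local Notation CC := (complexAlg R).

Lemma qpoch_inf_qlim (a : C) : qpoch_inf a q = qlim q (a : CC).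
Proof. by apply: climn_tends; apply: (@qlim_tends _ _ _ _ CC). Qed.


Variables (n : nat) (n_gt0 : (0 < n)%N).
Local Notation KK := (truncatedAlg R n).

(** Each coordinate is bounded by the norm. *)
Lemma Klim_tends (u : nat -> KP n) (s : KP n) :
  tends (truncatedNorm R n) \oo u s -> Klim u = s.
Proof.
move=> h; apply: KP_eqP => a ha; rewrite coef_in_qpoly ha coef_poly.
have -> : (a < n)%N by rewrite -(prednK n_gt0).
apply: climn_tends => e /h; apply: filterS => N; apply: le_trans.
rewrite /= /knorm (bigD1 (Ordinal ha)) //= coefB lerDl.
by apply: sumr_ge0 => b _; exact: normc_ge0.
Qed.

Lemma Kqpoch_inf_qlim (a : KP n) : Kqpoch_inf a q = qlim q (a : KK).
Proof. by apply: Klim_tends; apply: (@qlim_tends _ _ _ _ KK). Qed.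

Lemma ctcoef_Pcl : ctcoef (Pcl n : @KP R n) = 1.
Proof. by rewrite /ctcoef coef_in_qpoly coefB coefC coefX /= subr0. Qed.

Lemma Pcl_nilpotent : (1 - Pcl n : @KP R n) ^+ n = 0.
Proof.
have := KP_nilpotent (Pcl n : @KP R n).
rewrite ctcoef_Pcl scale1r prednK // => h.
by rewrite -[1 - _]opprB exprNn h mulr0.
Qed.

End Translation.

Lemma big_seq3 (A : comNzRingType) (T : Type) (f : T -> A) a b c :
  \prod_(x <- [:: a; b; c]) f x = f a * f b * f c.
Proof. by rewrite !big_cons big_nil mulr1 mulrA. Qed.

Lemma big_seq4 (A : comNzRingType) (T : Type) (f : T -> A) a b c d :
  \prod_(x <- [:: a; b; c; d]) f x = f a * f b * f c * f d.
Proof. by rewrite !big_cons big_nil mulr1 !mulrA. Qed.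

Lemma cancel_common_factor (A : comUnitRingType) (k : nat) (f a d s t : 'I_k -> A) (D : A) :
  (forall j, f j \is a GRing.unit) -> (forall j, d j \is a GRing.unit) ->
  (\prod_j f j) / D * \sum_j a j / (f j * d j) * s j * t j =
  D^-1 * \sum_j (\prod_(i < k | i != j) f i) * a j / d j * s j * t j.
Proof.
move=> fu du; rewrite [LHS]mulrAC [LHS]mulrC mulr_sumr; congr (_ * _).
apply: eq_bigr => j _; rewrite (bigD1 j) //= invrM ?fu ?du //.
move: (\prod_(i < k | _) _) => p.
rewrite [LHS](_ : _ = (f j / f j) * (p * a j / d j * s j * t j)); last by ring.
by rewrite (mulrV (fu j)) mul1r.
Qed.

Lemma unitr_mul3 (A : comUnitRingType) (a b c : A) :
  a \is a GRing.unit -> b \is a GRing.unit -> c \is a GRing.unit -> a * b * c \is a GRing.unit.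
Proof. by rewrite !unitrM => -> -> ->. Qed.

Section ProjectiveSpace.
Variables (R : realType) (q : R[i]) (m n : nat) (alpha : 'I_m -> R[i]).
Hypotheses (q_gt0 : 0 < normc q) (q_lt1 : normc q < 1).
Hypothesis (nm : (n <= m)%N) (n_gt0 : (0 < n)%N).
Hypotheses (alpha0 : forall j, alpha j != 0) (alpha_inj : injective alpha).
Hypothesis alpha_sep : forall (i j : 'I_m) (k : int), k != 0 -> alpha i != alpha j * q ^ k.
Local Notation C := R[i].
Local Notation KK := (truncatedAlg R n).
Local Notation P := (Pcl n : KP n).
Local Notation S := (Wcont q n alpha).

Lemma lhs_series_sum (Q : C) : normc Q < 1 ->
  has_sum (la_norm KK) (fun d => emb KK (Q ^+ d) * lhs_coef q n alpha (P : KK) d)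
    (lhs_series q n alpha Q : KK).
Proof.
move=> Q1.
have h := @lhs_sums R q m n alpha q_gt0 q_lt1 KK P (ctcoef_Pcl R n) Q Q1.
have [L hL] := rn_complete h.
suff -> : lhs_series q n alpha Q = L by [].
apply: Klim_tends => //.
have e : (fun d => (Q ^+ d) *: ((\prod_(i < m) Kqpoch (P * (alpha i)%:A) q d)
                 / Kqpoch (P * q%:A) q d ^+ n)) =
  (fun d => emb KK (Q ^+ d) * lhs_coef q n alpha (P : KK) d).
  apply: funext => d; rewrite -[LHS]mulr_algl /lhs_coef.
  have e1 : \prod_(i < m) Kqpoch (P * (alpha i)%:A) q d = \prod_i qpoch (Palpha alpha (P : KK) i) (emb KK q) d.
    by [].
  have e2 : Kqpoch (P * q%:A) q d = qpoch ((P : KK) * emb KK q) (emb KK q) d by [].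
  rewrite e1 e2; reflexivity.
rewrite e; exact: has_sum_series hL.
Qed.

(** The factors e_(q, alpha_j) of the scalar coefficient and of W_j cancel. *)
Lemma scalar_coef_Wfun j Q : regular_point q n alpha Q ->
  scalar_coef q n alpha j Q * Wfun q alpha S j (1 / Q) =
  residue_limit q n alpha j * S j (1 / Q).
Proof.
move=> [[_ h1] h2 _ _ _].
have e0 : echar q (alpha j) (1 / Q) != 0.
  by apply: mulf_neq0; [exact: h1 | rewrite invr_eq0; exact: h2].
rewrite /scalar_coef /Wfun /residue_limit !(qpoch_inf_qlim q_gt0 q_lt1).
rewrite (eq_bigr _ (fun i _ => qpoch_inf_qlim q_gt0 q_lt1 (alpha i / alpha j))).
move: (_ ^+ n) (_ * qlim q _) (S j _) (echar _ _ _) e0 => a b c d d0.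
rewrite (_ : a / d / b * (d * c) = (d / d) * (a / b * c)); last by ring.
by rewrite (divff d0) mul1r.
Qed.


Local Notation "x .q" := (emb x q) (at level 2, format "x .q").
Local Notation Palpha := (Palpha alpha (P : KK)).

Lemma Kqpochs_inf3 (a b c : KP n) :
  Kqpochs_inf [:: a; b; c] q = qlim q (a : KK) * qlim q (b : KK) * qlim q (c : KK).
Proof. rewrite /Kqpochs_inf big_seq3 !(Kqpoch_inf_qlim q_gt0 q_lt1 n_gt0); reflexivity. Qed.

Lemma Kqpochs_inf4 (a b c d : KP n) :
  Kqpochs_inf [:: a; b; c; d] q =
  qlim q (a : KK) * qlim q (b : KK) * qlim q (c : KK) * qlim q (d : KK).
Proof. rewrite /Kqpochs_inf big_seq4 !(Kqpoch_inf_qlim q_gt0 q_lt1 n_gt0); reflexivity. Qed.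

Lemma other_prodsE j : \prod_(i < m | i != j) Kqpoch_inf (P * (alpha i)%:A) q = other_prods q alpha (P : KK) j.
Proof. by apply: eq_bigr => i _; exact: (Kqpoch_inf_qlim q_gt0 q_lt1 n_gt0). Qed.

Lemma cancelled_identity (Q : C) : Q != 0 -> normc Q < 1 ->
  regular_point q n alpha Q ->
  (forall (j : 'I_m) (k : nat), alpha j != q ^+ k.+1) ->
  lhs_series q n alpha Q = connection_rhs_cancelled q n alpha S Q.
Proof.
move=> Q0 Q1 hQ alpha_nopole; have [_ _ h1 h2 h3] := hQ.
rewrite (qpoch_inf_qlim q_gt0 q_lt1) in h1; rewrite (qpoch_inf_qlim q_gt0 q_lt1) in h2.
have h := @connection_formula R q m n alpha q_gt0 q_lt1 nm alpha0 alpha_inj alpha_sep alpha_nopole n_gt0 KK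
  (P : KK) (ctcoef_Pcl R n) (Pcl_nilpotent R n_gt0) Q _ Q0 Q1 (lhs_series_sum Q1) h1 h2 h3.
rewrite h /connection_rhs_cancelled (Kqpoch_inf_qlim q_gt0 q_lt1 n_gt0).
rewrite [in RHS](eq_bigr _ (fun j _ => _ : _ = other_prods q alpha (P : KK) j *
    (qlim q KK.q * qlim q KK.q * qlim q (Palpha j * emb KK Q) * qlim q (KK.q / (Palpha j * emb KK Q))) /
    (qlim q (KK.q / Palpha j) * qlim q (emb KK Q) * qlim q (KK.q / emb KK Q)) *
    emb KK (residue_limit q n alpha j * S j (1 / Q)))) => [|j _]; first reflexivity.
rewrite other_prodsE Kqpochs_inf4 Kqpochs_inf3 -(scalar_coef_Wfun j hQ) rmorphM.
rewrite [RHS]mulrA; reflexivity.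
Qed.

(** If no alpha_j is a power of q, then all the (P alpha_j)_oo are
   invertible. *)
Lemma uncancelled_identity (Q : C) : regular_point q n alpha Q ->
  (forall (j : 'I_m) (k : int), alpha j != q ^ k) ->
  connection_rhs q n alpha S Q = connection_rhs_cancelled q n alpha S Q.
Proof.
move=> [_ _ h1 h2 _] h.
rewrite (qpoch_inf_qlim q_gt0 q_lt1) in h1; rewrite (qpoch_inf_qlim q_gt0 q_lt1) in h2.
have ux j : Kqpoch_inf (P * (alpha j)%:A) q \is a GRing.unit.
  rewrite (Kqpoch_inf_qlim q_gt0 q_lt1 n_gt0).
  apply: (@qlim_unit R q q_gt0 q_lt1 KK (Palpha j)) => k.
  rewrite (@res_Palpha R m alpha KK P (ctcoef_Pcl R n)).
  apply: contra (h j (- k%:Z)) => /eqP e; apply/eqP.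
  by rewrite -exprnN -[RHS]mul1r -e mulfK // expf_neq0 // (q_neq0 q_gt0).
have ud j : Kqpochs_inf [:: q%:A / (P * (alpha j)%:A); Q%:A; q%:A / Q%:A] q \is a GRing.unit.
  rewrite Kqpochs_inf3.
  have qQ : KK.q / emb KK Q = emb KK (q / Q).
    have [->|Q0] := eqVneq Q 0; first by rewrite rmorph0 !invr0 !mulr0 rmorph0.
    by rewrite rmorphM rmorphV // unitfE.
  rewrite qQ -(emb_qlim q_gt0 q_lt1 KK Q) -(emb_qlim q_gt0 q_lt1 KK (q / Q)).
  have np i k : alpha i != q ^+ k.+1 by exact: (h i k.+1).
  have u := @qlim_qx_unit R q m alpha q_gt0 q_lt1 alpha0 np KK (P : KK) (ctcoef_Pcl R n) j.
  exact: (unitr_mul3 u (@emb_unit _ KK _ h1) (@emb_unit _ KK _ h2)).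
have hc := cancel_common_factor
  (fun j => Kqpochs_inf [:: q%:A; q%:A; P * (alpha j)%:A * Q%:A; q%:A / (P * (alpha j)%:A * Q%:A)] q)
  (fun j => (scalar_coef q n alpha j Q)%:A) (fun j => (Wfun q alpha S j (1 / Q))%:A)
  (Kqpoch_inf (P * q%:A) q ^+ n) ux ud.
apply: etrans hc; rewrite /connection_rhs.
congr (_ * _); apply: eq_bigr => j _.
rewrite [Kqpochs_inf [:: P * (alpha j)%:A; _; _; _] q]/Kqpochs_inf big_cons; reflexivity.
Qed.

End ProjectiveSpace.

Theorem theorem1p2 (R : realType) (q : R[i]) (m n : nat) (alpha : 'I_m -> R[i])
    (hq : 0 < `|q| < 1) (hn : (1 <= n)%N) (hmn : (n <= m)%N)
    (halpha0 : forall j, alpha j != 0) (halpha_inj : injective alpha)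
    (halpha : forall (i j : 'I_m) (k : int), k != 0 -> alpha i != alpha j * q ^ k) :
  exists S : 'I_m -> R[i] -> R[i],
    (forall j, power_series_continuation (Wdom q n alpha) (Wcoef q n alpha j) (S j)) /\
    forall (delta : R) (Q : R[i]),
      0 < delta < pi -> Q != 0 -> `|Q| < 1 -> `|carg (- Q)| < pi - delta ->
      regular_point q n alpha Q ->
      ((forall (j : 'I_m) (k : int), alpha j != q ^ k) ->
         Ppow n (ell q Q) * lhs_series q n alpha Q
         = Ppow n (ell q Q) * connection_rhs q n alpha S Q) /\
      ((forall (j : 'I_m) (k : nat), alpha j != q ^+ k.+1) ->
         Ppow n (ell q Q) * lhs_series q n alpha Q
         = Ppow n (ell q Q) * connection_rhs_cancelled q n alpha S Q).
Proof.
move: hq; rewrite normc_normr !ltcR => /andP [q0 q1].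
exists (Wcont q n alpha); split=> [j|delta Q _ Q0 Q1 _ hQ].
  split=> [z hz|]; last exact: Wcont_series.
  exact: Wcont_derivable.
move: Q1; rewrite normc_normr ltcR => Q1.
have cancelled : (forall (j : 'I_m) (k : nat), alpha j != q ^+ k.+1) ->
    lhs_series q n alpha Q = connection_rhs_cancelled q n alpha (Wcont q n alpha) Q.
  exact: cancelled_identity.
split=> h; last by rewrite cancelled.
by rewrite uncancelled_identity // cancelled // => j k; apply: (h j k.+1).
Qed.
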